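(* Let $\varepsilon_0>0$, let $q$ be an even integer (possibly depending on $N$) with $2\leqslant q\leqslant N^{\frac12-\varepsilon_0}$, and let $R\geqslant0$ be an integer. For $\tau\in\{\text{Full},+,-\}$ define the spectral form factor $$K_{N,\tau}(t)=\mathbb{E}\left[\left|\operatorname{tr}_\tau(e^{-\mathrm{i}tH_q})\right|^2\right].$$ There is $C_R>0$, depending only on $R$, such that for every $\delta\in(0,1)$ the following holds for $N$ large enough. Let $T$ satisfy $$1\leqslant T\leqslant\sqrt{(1-\delta)\min\left(\frac{4(R+1)}5\log\frac1{\alpha_{N,q}},\ \log M\right)}.$$ Then $$\sup_{|t|\leqslant T}\left|K_{N,\tau}(t)-\left|\widehat{\varrho_R}(t)\right|^2\right|\leqslant C_R\left[\left(\alpha_{N,q}^{R+1}T^{2R+2}\right)^{\frac45}+\frac{T^2}M\right]\leqslant C_R\left[\left(\alpha_{N,q}\log\frac1{\alpha_{N,q}}\right)^{\frac{4(R+1)}5}+\frac{\log M}M\right].$$ (As usual, the value of the constant $C_R$ may differ between the two inequalities.)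
   Context: SYK model. $N$ is an even positive integer, $n=N/2$, $D=2^n$, $\mathcal{H}_N=(\mathbb{C}^2)^{\otimes n}$. With Pauli matrices $\sigma_x,\sigma_y,\sigma_z$, the Majorana matrices are $\gamma_{2j-1}=\sigma_z^{\otimes(j-1)}\otimes\sigma_x\otimes I_2^{\otimes(n-j)}$ and $\gamma_{2j}=\sigma_z^{\otimes(j-1)}\otimes\sigma_y\otimes I_2^{\otimes(n-j)}$ for $1\leqslant j\leqslant n$; they satisfy $\gamma_i\gamma_j+\gamma_j\gamma_i=2\delta_{ij}I$. For a $q$-subset $A=\{i_1<\dots<i_q\}$ of $\{1,\dots,N\}$ let $\Gamma_A=\mathrm{i}^{\binom q2}\gamma_{i_1}\cdots\gamma_{i_q}$. Let $M=\binom Nq$ and $$H_q=\frac1{\sqrt M}\sum_{|A|=q}J_A\Gamma_A,\qquad (J_A)_A\ \text{i.i.d. } \mathcal{N}(0,1).$$ Parity sectors: $P_N=\sigma_z^{\otimes n}$, $\mathcal{H}_N^\pm=\ker(P_N\mp I)$, of dimension $D^\pm=D/2$; since $q$ is even, $H_q$ preserves $\mathcal{H}_N^\pm$. Put $\mathcal{H}_N^{\text{Full}}=\mathcal{H}_N$, $D^{\text{Full}}=D$. For an operator $X$ preserving $\mathcal{H}_N^\tau$, $\operatorname{tr}_\tau(X)$ is the trace of $X|_{\mathcal{H}_N^\tau}$ divided by $D^\tau$ (and $\operatorname{tr}=\operatorname{tr}_{\text{Full}}$). Anticommutation proportion: for any $q$-subset $A$, $$\alpha_{N,q}=\frac1M\left|\{B:|B|=q,\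 \Gamma_A\Gamma_B=-\Gamma_B\Gamma_A\}\right|=\frac1M\sum_{0\leqslant r\leqslant q,\ r\text{ odd}}\binom qr\binom{N-q}{q-r}.$$ Deterministic profile: let $\rho_G(x)=\frac1{\sqrt{2\pi}}e^{-x^2/2}$, $m(z)=\int_{\mathbb{R}}\frac{\rho_G(x)}{x-z}dx$ for $z\in\mathbb{C}_+=\{\operatorname{Im}z>0\}$, and $\mu_{2k}=\mathbb{E}[\operatorname{tr}(H_q^{2k})]$. Define recursively, for $r\geqslant1$, $c_r=c_r(N,q)$ by $$c_r\alpha_{N,q}^r=(2r+1)\mu_{2r}-\mu_{2r+2}-\sum_{s=1}^{r-1}\binom{2r+1}{2s+1}c_s\alpha_{N,q}^s\mu_{2r-2s}.$$ Set $\Theta_0=m$ and, for $s\geqslant1$, let $\Theta_s$ be the unique holomorphic function on $\mathbb{C}_+$ vanishing as $\operatorname{Im}z\to\infty$ with $$\Theta_s'(z)+z\Theta_s(z)=\sum_{r=1}^s\frac{c_r}{(2r+1)!}\Theta_{s-r}^{(2r+1)}(z).$$ For each $s\geqslant1$, $\Theta_s$ is a finite linear combination of the derivatives $m^{(2s+2)},m^{(2s+4)},\dots,m^{(4s)}$, i.e. $\Theta_s=\mathcal{D}_sm$ for a constant-coefficient differential operator $\mathcal{D}_s$ involving only even derivatives of these orders. Define $$\varrho_R=\rho_G+\sum_{s=1}^R\alpha_{N,q}^s\,\mathcal{D}_s\rho_G,\qquad \widehat{\varrho_R}(t)=\int_{\mathbb{R}}e^{-\mathrm{i}tE}\varrho_R(E)\,dE.$$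 Equivalently $\widehat{\varrho_R}(t)=e^{-t^2/2}\big(1+\sum_{s=1}^R\alpha_{N,q}^sp_s(t)\big)$, where $p_s$ is the polynomial obtained from $\mathcal{D}_s$ by replacing each $\partial^k$ by $(\mathrm{i}t)^k$. *)

(* Defs.v *)
From HB Require Import structures.
From mathcomp Require Import all_boot all_order all_algebra.
From mathcomp Require Import all_classical all_reals all_analysis.
From mathcomp Require Import complex mxtens ring zify.

Set Implicit Arguments.
Unset Strict Implicit.
Unset Printing Implicit Defensive.

Import Order.TTheory GRing.Theory Num.Theory.
Import numFieldNormedType.Exports.

Local Open Scope complex_scope.
Local Open Scope ring_scope.

Section Majorana.
Variable R : realType.
Local Notation C := R[i].

Definition pauli_x : 'M[C]_2 := \matrix_(i, j) (i != j)%:R.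
Definition pauli_y : 'M[C]_2 :=
  \matrix_(i, j) (if i == j then 0 else if i == 0 then - 'i%C else 'i%C).
Definition pauli_z : 'M[C]_2 :=
  \matrix_(i, j) (if i == j then (-1) ^+ i else 0).

(* F 0 (x) F 1 (x) ... (x) F (n - 1) *)
Fixpoint tens (n : nat) : ('I_n -> 'M[C]_2) -> 'M[C]_(2 ^ n) :=
  match n with
  | 0 => fun=> 1%:M
  | n'.+1 => fun F =>
      castmx (esym (expnS 2 n'), esym (expnS 2 n'))
             (F ord0 *t tens (fun k => F (lift ord0 k)))
  end.

(* Indices are shifted by one: the usual gamma_(2j-1) and gamma_(2j),
   1 <= j <= n, are [majorana] at 2(j-1) and 2(j-1)+1. *)
Definition majorana (N : nat) (i : 'I_N) : 'M[C]_(2 ^ N./2) :=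
  tens (fun k : 'I_(N./2) =>
    if (k < i./2)%N then pauli_z
    else if k == i./2 :> nat then (if odd i then pauli_y else pauli_x)
    else 1%:M).

(* [enum A] lists A in increasing order. *)
Definition Gam (N : nat) (A : {set 'I_N}) : 'M[C]_(2 ^ N./2) :=
  'i%C ^+ 'C(#|A|, 2) *: \prod_(i <- enum A) majorana i.

Definition parity (N : nat) : 'M[C]_(2 ^ N./2) := tens (fun=> pauli_z).

Definition qsubsets (N q : nat) : {set {set 'I_N}} := [set A : {set 'I_N} | #|A| == q].

Definition syk (N q : nat) (J : {set 'I_N} -> R) : 'M[C]_(2 ^ N./2) :=
  ((Num.sqrt 'C(N, q)%:R)^-1)%:C *:
    \sum_(A in qsubsets N q) (J A)%:C *: Gam A.

Definition alpha (N q : nat) : R :=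
  (\sum_(r < q.+1 | odd r) 'C(q, r) * 'C(N - q, q - r))%:R / 'C(N, q)%:R.

End Majorana.

Section Anticommutation.
Variable R : realType.
Local Notation C := R[i].

Lemma castmx_mulmx (m n : nat) (e : m = n) (A B : 'M[C]_m) :
  castmx (e, e) A *m castmx (e, e) B = castmx (e, e) (A *m B).
Proof. by case: n / e; rewrite !castmx_id. Qed.

Lemma castmx_scale (m n : nat) (e : m = n) a (A : 'M[C]_m) :
  castmx (e, e) (a *: A) = a *: castmx (e, e) A.
Proof. by case: n / e; rewrite !castmx_id. Qed.

Lemma tensM n (F G : 'I_n -> 'M[C]_2) :
  tens F *m tens G = tens (fun k => F k *m G k).
Proof.
elim: n F G => [|n IHn] F G /=; first by rewrite mul1mx.
by rewrite castmx_mulmx tensmx_mul IHn.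
Qed.

Lemma tensZ n (a : 'I_n -> C) (F : 'I_n -> 'M[C]_2) :
  tens (fun k => a k *: F k) = (\prod_k a k) *: tens F.
Proof.
elim: n a F => [|n IHn] a F /=; first by rewrite big_ord0 scale1r.
rewrite IHn big_ord_recl -castmx_scale; congr castmx.
by apply/matrixP => i j; rewrite !mxE mulrACA.
Qed.

Lemma eq_tens n (F G : 'I_n -> 'M[C]_2) : F =1 G -> tens F = tens G.
Proof. by move=> /funext ->. Qed.

Lemma tens1 n : tens (fun=> 1%:M) = 1%:M :> 'M[C]_(2 ^ n).
Proof.
elim: n => //= n ->.
apply/matrixP => i j; rewrite castmxE !mxE.
set x := cast_ord _ i; set y := cast_ord _ j.
have -> : (i == j) = (x == y) by rewrite (inj_eq (@cast_ord_inj _ _ _)).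
rewrite -(can_eq (@mxtens_unindexK _ _) x y).
case: (mxtens_unindex x) (mxtens_unindex y) => [a b] [a' b'].
by rewrite xpair_eqE -natrM mulnb.
Qed.

Local Ltac pauli := apply/matrixP => -[[|[|//]] ?] -[[|[|//]] ?];
  rewrite !mxE !big_ord_recl !big_ord0 !mxE /=; 
  apply/eqP; rewrite eq_complex /=; apply/andP; split;
  apply/eqP; ring.

Definition site_pauli (i k : nat) : 'M[C]_2 :=
  if (k < i./2)%N then pauli_z R
  else if k == i./2 then (if odd i then pauli_y R else pauli_x R) else 1%:M.

Lemma pauli_xx : pauli_x R *m pauli_x R = 1%:M. Proof. pauli. Qed.
Lemma pauli_yy : pauli_y R *m pauli_y R = 1%:M. Proof. pauli. Qed.
Lemma pauli_zz : pauli_z R *m pauli_z R = 1%:M. Proof. pauli. Qed.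
Lemma pauli_yx : pauli_y R *m pauli_x R = -1 *: (pauli_x R *m pauli_y R).
Proof. pauli. Qed.
Lemma pauli_zx : pauli_z R *m pauli_x R = -1 *: (pauli_x R *m pauli_z R).
Proof. pauli. Qed.
Lemma pauli_zy : pauli_z R *m pauli_y R = -1 *: (pauli_y R *m pauli_z R).
Proof. pauli. Qed.


Lemma site_pauli_sq (i k : nat) : site_pauli i k *m site_pauli i k = 1%:M.
Proof.
rewrite /site_pauli; case: ifP => _; first exact: pauli_zz.
case: ifP => _; last exact: mul1mx.
by case: ifP => _; [exact: pauli_yy | exact: pauli_xx].
Qed.

Lemma scaleN1K (A B : 'M[C]_2) : A = -1 *: B -> B = -1 *: A.
Proof. by move=> ->; rewrite scalerA mulrNN mulr1 scale1r. Qed.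

Lemma site_pauli_anti (i j k : nat) : i != j ->
  site_pauli i k *m site_pauli j k =
  (if k == minn i./2 j./2 then -1 else 1) *:
    (site_pauli j k *m site_pauli i k).
Proof.
wlog le_ij : i j / (i./2 <= j./2)%N.
  move=> th ij; case/orP: (leq_total i./2 j./2) => h; first exact: th.
  rewrite minnC; move: (th j i h); rewrite eq_sym => /(_ ij).
  case: eqP => _ thji; first exact: scaleN1K.
  by rewrite thji !scale1r.
rewrite (minn_idPl le_ij) => ij.
rewrite /site_pauli; case: (ltngtP k i./2) => [ki|ik|->].
- by rewrite (leq_trans ki le_ij) scale1r.
- by rewrite scale1r mul1mx mulmx1.
case: (ltngtP i./2 j./2) le_ij => // [_ _|e _].
  apply: scaleN1K; case: ifP => _; [exact: pauli_zy | exact: pauli_zx].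
have : odd i != odd j.
  by apply: contra ij => /eqP oij; rewrite -(odd_double_half i) oij e odd_double_half.
case: (odd i) (odd j) => [] [] // _; first exact: pauli_yx.
exact/scaleN1K/pauli_yx.
Qed.

Section EvenN.
Variable N : nat.
Hypothesis oN : ~~ odd N.

Lemma majorana_sq (i : 'I_N) : majorana R i *m majorana R i = 1%:M.
Proof.
rewrite /majorana tensM -(tens1 N./2); apply: eq_tens => k.
exact: site_pauli_sq.
Qed.

Lemma majorana_comm (i j : 'I_N) :
  majorana R i *m majorana R j =
  (-1) ^+ (i != j) *: (majorana R j *m majorana R i).
Proof.
case: (eqVneq i j) => [->|ij]; first by rewrite scale1r.
have lt_half (k : 'I_N) : (k./2 < N./2)%N by have := ltn_ord k; lia.
have mN : (minn i./2 j./2 < N./2)%N by rewrite gtn_min lt_half.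
rewrite /majorana !tensM.
under eq_tens => k do rewrite (@site_pauli_anti i j k ij).
rewrite tensZ; congr (_ *: _).
rewrite (bigD1 (Ordinal mN)) //= eqxx big1 ?mulr1 ?expr1// => k.
by rewrite -val_eqE /= => /negPf ->.
Qed.

Local Notation mon s := (\prod_(i <- s) majorana R i).

Lemma mscaleAl (a : C) (A B : 'M[C]_(2 ^ N./2)) : a *: (A * B) = a *: A * B.
Proof. exact: scalemxAl. Qed.

Lemma mscaleAr (a : C) (A B : 'M[C]_(2 ^ N./2)) : a *: (A * B) = A * (a *: B).
Proof. exact: scalemxAr. Qed.

Lemma mon_comm1 (i : 'I_N) (s : seq 'I_N) :
  majorana R i * mon s =
  (-1) ^+ (\sum_(j <- s) (i != j)) *: (mon s * majorana R i).
Proof.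
elim: s => [|j s IHs]; first by rewrite !big_nil scale1r mulr1 mul1r.
rewrite !big_cons mulrA [X in X * _]majorana_comm -mscaleAl -[X in _ *: X = _]mulrA IHs.
by rewrite -mscaleAr scalerA -exprD mulrA.
Qed.

Lemma mon_comm (s t : seq 'I_N) :
  mon s * mon t =
  (-1) ^+ (\sum_(i <- s) \sum_(j <- t) (i != j)) *: (mon t * mon s).
Proof.
elim: s => [|i s IHs]; first by rewrite !big_nil scale1r mulr1 mul1r.
rewrite !big_cons -mulrA IHs -mscaleAr mulrA mon_comm1 -mscaleAl scalerA.
by rewrite -exprD addnC mulrA.
Qed.

Lemma mon_inv (s : seq 'I_N) : mon (rev s) * mon s = 1.
Proof.
elim: s => [|i s IHs]; first by rewrite !big_nil mulr1.
rewrite rev_cons big_rcons /= big_cons -mulrA (mulrA (majorana R i)).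
by rewrite [X in _ * (X * _)]majorana_sq mul1r.
Qed.

Lemma card_neq_pairs (A B : {set 'I_N}) :
  (\sum_(i <- enum A) \sum_(j <- enum B) (i != j) + #|A :&: B| = #|A| * #|B|)%N.
Proof.
rewrite big_enum /= -sum1_card (eq_bigl (fun i => (i \in A) && (i \in B))); last first.
  by move=> i; rewrite inE.
rewrite big_mkcondr -big_split /= -sum_nat_const; apply: eq_bigr => i _.
rewrite big_enum /= -[RHS]sum1_card.
case: ifP => iB; last first.
  rewrite addn0; apply: eq_bigr => j jB; case: eqP => // ij.
  by rewrite ij jB in iB.
rewrite (bigD1 i) //= eqxx add0n [RHS](bigD1 i) //= addnC; congr addn.
by apply: eq_bigr => j /andP[_]; rewrite eq_sym => ->.
Qed.

Lemma Gam_anti (A B : {set 'I_N}) : ~~ odd #|A| ->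
  (Gam R A *m Gam R B == - (Gam R B *m Gam R A)) = odd #|A :&: B|.
Proof.
move=> oA; rewrite /Gam -!scalemxAl -!scalemxAr !scalerA.
rewrite [X in _ == - (X *: _)]mulrC -scalerN.
have i0 : 'i%C != 0 :> C by rewrite eq_complex /= oner_eq0 andbF.
set c := _ * _.
have c0 : c != 0 by rewrite /c mulf_eq0 !expf_eq0 (negPf i0) !andbF.
rewrite (inj_eq (scalerI c0)).
rewrite [X in X == _]mon_comm.
set m := (\sum_(i <- _) _)%N.
have -> : odd #|A :&: B| = odd m.
  have := card_neq_pairs A B; rewrite -/m => /(congr1 odd).
  by rewrite oddD oddM (negPf oA)/=; case: odd; case: odd.
set X := mon (enum B) * mon (enum A); rewrite -[_ *m _]/X -signr_odd.
case: odd; first by rewrite expr1 scaleN1r eqxx.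
rewrite expr0 scale1r; apply/negbTE; apply/eqP => XN.
have X0 : X = 0.
  have : 2 *: X = 0 by rewrite scaler_nat mulr2n {2}XN subrr.
  by move/eqP; rewrite scaler_eq0 pnatr_eq0 /= => /eqP.
have : mon (rev (enum A)) * (mon (rev (enum B)) * X) = 1.
  by rewrite /X (mulrA (mon (rev (enum B)))) mon_inv mul1r mon_inv.
rewrite X0 !mulr0 => /matrixP.
have n0 : (0 < 2 ^ N./2)%N by rewrite expn_gt0.
move=> /(_ (Ordinal n0) (Ordinal n0)); rewrite !mxE eqxx => /eqP.
by rewrite eq_sym oner_eq0.
Qed.

Lemma card_meet (q r : nat) (A : {set 'I_N}) : #|A| = q -> (r <= q)%N ->
  #|[set B : {set 'I_N} | (#|B| == q) && (#|A :&: B| == r)]| =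
  ('C(q, r) * 'C(N - q, q - r))%N.
Proof.
move=> qA rq.
have cC : #|~: A| = (N - q)%N by rewrite cardsCs finset.setCK card_ord qA.
have -> : 'C(q, r) = 'C(#|A|, r) by rewrite qA.
rewrite -cC -!cards_draws -cardsX.
set D1 := (X in finset.setX X _); set D2 := (X in finset.setX _ X).
rewrite -(card_in_imset (f := fun u => u.1 :|: u.2) (D := finset.setX D1 D2)).
  apply: eq_card => B; rewrite inE; apply/andP/imsetP.
    move=> [/eqP cB /eqP cAB]; exists (A :&: B, B :\: A) => /=.
      rewrite !inE /= finset.subsetIl cAB eqxx /= finset.subsetDr cardsD (finset.setIC B) cAB cB.
      by rewrite eqxx.
    by rewrite -{1}(finset.setID B A) (finset.setIC B).
  move=> [[B1 B2]]; rewrite !inE /= => /andP[/andP[B1A /eqP c1]].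
  move=> /andP[B2A /eqP c2] ->.
  have d1 : A :&: (B1 :|: B2) = B1.
    rewrite finset.setIUr (finset.setIidPr B1A); apply/finset.setUidPl; apply/fintype.subsetP => x.
    by rewrite inE => /andP[xA /(fintype.subsetP B2A)]; rewrite inE xA.
  have d2 : B1 :&: B2 = finset.set0.
    apply/finset.setP => x; rewrite !inE; apply/negP => /andP[/(fintype.subsetP B1A) xA].
    by move=> /(fintype.subsetP B2A); rewrite inE xA.
  by rewrite d1 c1 cardsU d2 cards0 c1 c2 subn0 subnKC// eqxx.
move=> [B1 B2] [B1' B2']; rewrite !inE /=.
move=> /andP[/andP[B1A _] /andP[B2A _]] /andP[/andP[B1A' _] /andP[B2A' _]] e.
have mem x : ((x \in B1) = (x \in B1')) /\ ((x \in B2) = (x \in B2')).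
  move/finset.setP: e => /(_ x); rewrite !inE.
  move/fintype.subsetP: B1A => /(_ x); move/fintype.subsetP: B2A => /(_ x).
  move/fintype.subsetP: B1A' => /(_ x); move/fintype.subsetP: B2A' => /(_ x).
  rewrite !inE; case: (x \in A) (x \in B1) (x \in B2) (x \in B1') (x \in B2');
  move=> [] [] [] [] //= h1 h2 h3 h4 h5;
    solve [by split | by move: (h1 isT) | by move: (h2 isT)
          | by move: (h3 isT) | by move: (h4 isT) | by move: h5].
by congr (_, _); apply/finset.setP => x; have [] := mem x.
Qed.

(* [alpha] is the proportion of q-subsets anticommuting with a given one. *)
Lemma alphaP (q : nat) (A : {set 'I_N}) : ~~ odd q -> #|A| = q ->
  alpha R N q =
  #|[set B : {set 'I_N} | (#|B| == q) &&
      (Gam R A *m Gam R B == - (Gam R B *m Gam R A))]|%:R / 'C(N, q)%:R.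
Proof.
move=> oq qA; congr (_%:R / _).
rewrite -sum1_card.
rewrite (eq_bigl (fun B : {set 'I_N} => (#|B| == q) && odd #|A :&: B|)); last first.
  by move=> B; rewrite inE Gam_anti ?qA.
rewrite (partition_big (fun B => inord #|A :&: B|) (fun r : 'I_q.+1 => odd r)).
  apply: eq_bigr => r orr.
  have rq : (r <= q)%N by rewrite -ltnS ltn_ord.
  rewrite -(card_meet qA rq) -sum1_card; apply: eq_bigl => B; rewrite inE.
  have h : (#|A :&: B| <= q)%N by rewrite -qA subset_leq_card // finset.subsetIl.
  rewrite -val_eqE /= inordK //.
  by case: eqP => //= _; case: eqP => [->|]; rewrite ?orr ?andbF.
move=> B /andP[_]; rewrite inordK //.
by rewrite ltnS -qA subset_leq_card // finset.subsetIl.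
Qed.

End EvenN.
End Anticommutation.

Variant sector := Full | Plus | Minus.

Section Trace.
Variable R : realType.
Local Notation C := R[i].

(* MathComp subspaces are row spaces and matrices act on rows from the right,
   whereas operators here act on columns: the kernel of P - a on columns is
   the transpose of [eigenspace P^T a], and the restriction of X to it is the
   transpose of the restriction of X^T to [eigenspace P^T a]. *)
Definition sector_trace (N : nat) (tau : sector) (X : 'M[C]_(2 ^ N./2)) : C :=
  let D : C := (2 ^ N./2)%:R in
  match tau with
  | Full => \tr X / D
  | Plus => \tr (restrictmx (eigenspace (parity R N)^T 1) X^T) / (D / 2)
  | Minus => \tr (restrictmx (eigenspace (parity R N)^T (-1)) X^T) / (D / 2)
  end.

(* Complex limits are taken in C seen as a normed module over itself. *)
Definition mexp (d : nat) (X : 'M[C]_d) : 'M[C]_d :=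
  \matrix_(i, j)
    limn (series (fun k : nat => (k`!%:R^-1 * (X ^+ k) i j : C^o))).

Definition sqnormc (z : C) : R := complex.Re z ^+ 2 + complex.Im z ^+ 2.

Definition Cintegral (f : R -> C) : C :=
  (\int[lebesgue_measure]_x complex.Re (f x)) +i*
  (\int[lebesgue_measure]_x complex.Im (f x)).

End Trace.

Local Open Scope classical_set_scope.

Section Probability.
Context (d : measure_display) (Omega : measurableType d) (R : realType).
Variable P : probability Omega R.

Definition independent_on (I : finType) (D : {set I})
    (X : I -> {RV P >-> R}) : Prop :=
  forall (S : {set I}) (B : I -> set R), (S \subset D)%SET ->
    (forall i, measurable (B i)) ->
    P (\bigcap_(i in [set` S]) (X i @^-1` B i)) =
    (\prod_(i in S) P (X i @^-1` B i))%E.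

Definition std_normal (X : {RV P >-> R}) : Prop :=
  forall B : set R, measurable B -> P (X @^-1` B) = normal_prob 0 1 B.

Definition iid_std_normal (I : finType) (D : {set I})
    (X : I -> {RV P >-> R}) : Prop :=
  independent_on D X /\ (forall i, i \in D -> std_normal (X i)).

Variables (N q : nat) (J : {set 'I_N} -> {RV P >-> R}).

Definition sykH (w : Omega) : 'M[R[i]]_(2 ^ N./2) := syk q (fun A => J A w).

Definition sff (tau : sector) (t : R) : R :=
  fine (\int[P]_w (sqnormc
    (sector_trace tau (mexp (- ('i%C * t%:C) *: sykH w))))%:E)%E.

(* tr (H ^+ j) is real, as H is Hermitian. *)
Definition moment (j : nat) : R :=
  fine (\int[P]_w (complex.Re (sector_trace Full (sykH w ^+ j)))%:E)%E.

End Probability.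

Section Profile.
Variable R : realType.
Local Notation C := R[i].

Definition rhoG (x : R) : R :=
  (Num.sqrt (2 * pi))^-1 * expR (- (x ^+ 2 / 2)).

Definition stieltjes_rhoG (z : C) : C :=
  Cintegral (fun x => (rhoG x)%:C / (x%:C - z)).

Definition upper_half : set C := [set z | 0 < complex.Im z].

(* Over K = R[i], [derive1n] and [derivable] are the complex derivatives and
   complex differentiability; [nderive] and [holomorphic_on] let the normed
   module structure of K over itself be found for K abstract. *)
Definition nderive (K : numFieldType) (k : nat) (f : K -> K) : K -> K :=
  derive1n k f.

Definition holomorphic_on (K : numFieldType) (U : set K) (f : K -> K) : Prop :=
  forall z, U z -> derivable f z 1.

(* sum_k p_k d^k *)
Definition diffop (K : numFieldType) (p : {poly K}) (f : K -> K) (x : K) : K :=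
  \sum_(k < size p) p`_k * nderive k f x.

Definition vanishes_at_i_infty (f : C -> C) : Prop :=
  forall e : R, 0 < e -> exists Y : R, forall z : C,
    Y < complex.Im z -> sqnormc (f z) < e ^+ 2.

(* c_0, ..., c_r, with a placeholder c_0 = 0; [mu] j is the j-th moment. *)
Fixpoint coefs (a : R) (mu : nat -> R) (r : nat) : seq R :=
  match r with
  | 0 => [:: 0]
  | r'.+1 =>
    let cs := coefs a mu r' in
    rcons cs
      (((2 * r).+1%:R * mu (2 * r)%N - mu (2 * r + 2)%N
        - \sum_(1 <= s < r) 'C((2 * r).+1, (2 * s).+1)%:R *
            cs`_s * a ^+ s * mu (2 * r - 2 * s)%N) / a ^+ r)
  end.

Definition coef_c (a : R) (mu : nat -> R) (r : nat) : R := (coefs a mu r)`_r.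

Definition is_theta_family (c : nat -> R) (F : nat -> C -> C) : Prop :=
  (forall z, upper_half z -> F 0%N z = stieltjes_rhoG z) /\
  forall s, (0 < s)%N ->
    [/\ holomorphic_on upper_half (F s),
        vanishes_at_i_infty (F s) &
        forall z, upper_half z ->
          nderive 1 (F s) z + z * F s z =
          \sum_(1 <= r < s.+1)
            (c r / (2 * r).+1`!%:R)%:C * nderive (2 * r).+1 (F (s - r)%N) z].

(* Only the values on the upper half-plane are determined. *)
Definition theta (c : nat -> R) : nat -> C -> C :=
  xget (fun _ _ => 0) [set F | is_theta_family c F].

Definition is_theta_op (c : nat -> R) (s : nat) (p : {poly R}) : Prop :=
  (forall k, p`_k != 0 -> ~~ odd k && (2 * s + 2 <= k <= 4 * s)%N) /\
  forall z, upper_half z ->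
    theta c s z = diffop (map_poly (real_complex R) p) stieltjes_rhoG z.

Definition theta_op (c : nat -> R) (s : nat) : {poly R} :=
  xget 0 [set p | is_theta_op c s p].

Definition varrho (a : R) (c : nat -> R) (L : nat) (x : R) : R :=
  rhoG x + \sum_(1 <= s < L.+1) a ^+ s * diffop (theta_op c s) rhoG x.

Definition fourier (f : R -> R) (t : R) : C :=
  Cintegral (fun x => (cos (t * x) -i* sin (t * x)) * (f x)%:C).

End Profile.

Definition syk_profile (d : measure_display) (Omega : measurableType d)
    (R : realType) (P : probability Omega R) (N q : nat)
    (J : {set 'I_N} -> {RV P >-> R}) (L : nat) : R -> R :=
  varrho (alpha R N q) (coef_c (alpha R N q) (moment q J)) L.

(* Main.v *)
(* Both quantities are compared with F(t)^2, where F(t) = E tr exp(-itH) =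
   sum_k (-1)^k mu_2k t^(2k) / (2k)! does not depend on the sector.

   The form factor: K(t) - F(t)^2 is the variance of tr exp(-itH), and the Gaussian
   Poincare inequality bounds it by sum_A E |d_A tr exp(-itH)|^2.  The derivatives are
   -it M^(-1/2) tr(Gamma_A exp(-itH)), and Bessel's inequality for the orthonormal family
   Gamma_A bounds the sum by t^2 / M, as exp(-itH) is unitary.

   The profile: the recursion for c_r says that -c_r alpha^r is the (2r+2)-th cumulant
   of the moments, so that F' = F h with h(t) = -t + sum_s (-1)^s c_s alpha^s
   t^(2s+1) / (2s+1)!, while the polynomial factor of the Fourier transform of the profile
   solves the truncation of this equation at order alpha^R.  By Wick's formula the moments
   are sums over perfect matchings in which every crossing of anticommuting chords costs a
   sign.  Writing this sign as 1 + (sign - 1) and expanding, the c_r are connected sums, and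
   since two chords anticommute with probability alpha, |c_r| <= 2 (2r+1)! 4^r: this bounds
   the truncation error uniformly in N and q. *)
Require Import Defs.
From HB Require Import structures.
From mathcomp Require Import all_boot all_order all_algebra.
From mathcomp Require Import all_classical all_reals all_analysis.
From mathcomp Require Import measurable_realfun.
From mathcomp Require Import complex mxtens ring lra zify.
From mathcomp Require Import -(notations) mpoly.

Set Implicit Arguments.
Unset Strict Implicit.
Unset Printing Implicit Defensive.

Import Order.TTheory GRing.Theory Num.Theory.
Import numFieldNormedType.Exports.

Local Open Scope classical_set_scope.
Local Open Scope ring_scope.

(** * Cluster expansion for chord diagrams *)

(** The crux is a bound on c_r that is uniform in N and q. Estimating moments term by term yields no
    power of alpha, so the vacuum has to be divided out first: chords not linked by signs to the
    pinned ones factor off, and every other chord carries a factor sign - 1 with an earlier one,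
    whose average is O(alpha). The price 4 alpha per chord is shared as b = sqrt(4 alpha) per
    position; the factorial left over is absorbed by the Taylor coefficient.

    exp(-itH) is not a polynomial in the couplings, while integration by parts and the Poincare
    inequality are proved algebraically, for polynomials. Hence the estimates concern truncated
    exponentials, which are unitary up to a vanishing tail, and dominated convergence comes last.

    The comparison of the two differential equations loses powers of T: its error is T^2 (alpha
    T^4)^(R+1) rather than alpha^(R+1) T^(2R+2). As T^2 = O(log 1/alpha), a factor alpha^((R+1)/5)
    outweighs any fixed power of T when N is large; this is what the exponent 4/5 pays for. *)

Section ListSums.
Variable R : realFieldType.

(** The sum runs over positions, so repeated entries and types without decidable equality cause no
    trouble; [u] is what remains of [s], in order. *)
Fixpoint sum_pick (T : Type) (h : T -> seq T -> R) (s : seq T) : R :=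
  if s is y :: s' then h y s' + sum_pick (fun z u => h z (y :: u)) s' else 0.

(** The unshuffle coproduct: all ways to deal the entries into two complementary subsequences. On
    functions of the two lengths it becomes the binomial convolution. *)
Fixpoint sum_split (T : Type) (h : seq T -> seq T -> R) (s : seq T) : R :=
  if s is y :: s' then
    sum_split (fun a b => h (y :: a) b) s' + sum_split (fun a b => h a (y :: b)) s'
  else h [::] [::].

Section Untyped.
Variable T : Type.
Implicit Types (s u : seq T).

Lemma eq_sum_pick (h k : T -> seq T -> R) s :
  (forall y u, (size u).+1 = size s -> h y u = k y u) ->
  sum_pick h s = sum_pick k s.
Proof.
elim: s h k => //= y s IH h k hk; rewrite hk //; congr (_ + _).
by apply: IH => z u su; apply: hk; rewrite /= su.
Qed.

Lemma eq_sum_split (h k : seq T -> seq T -> R) s :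
  (forall a b, (size a + size b)%N = size s -> h a b = k a b) ->
  sum_split h s = sum_split k s.
Proof.
elim: s h k => [|y s IH] h k hk /=; first exact: hk.
by congr (_ + _); apply: IH => a b ab; apply: hk; rewrite /= ?addnS -ab.
Qed.

Lemma sum_pickD (h k : T -> seq T -> R) s :
  sum_pick (fun y u => h y u + k y u) s = sum_pick h s + sum_pick k s.
Proof. by elim: s h k => /= [|y s IH] h k; rewrite ?addr0 // IH addrACA. Qed.

Lemma sum_pickZ c (h : T -> seq T -> R) s :
  sum_pick (fun y u => c * h y u) s = c * sum_pick h s.
Proof. by elim: s h => /= [|y s IH] h; rewrite ?mulr0 // IH mulrDr. Qed.

Lemma sum_splitD (h k : seq T -> seq T -> R) s :
  sum_split (fun a b => h a b + k a b) s = sum_split h s + sum_split k s.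
Proof. by elim: s h k => //= y s IH h k; rewrite !IH addrACA. Qed.

Lemma sum_splitZ c (h : seq T -> seq T -> R) s :
  sum_split (fun a b => c * h a b) s = c * sum_split h s.
Proof. by elim: s h => //= y s IH h; rewrite !IH mulrDr. Qed.

Lemma sum_split0 s : sum_split (fun _ _ : seq T => 0) s = 0.
Proof. by elim: s => //= y s ->; rewrite addr0. Qed.

Lemma sum_split_pickl (h : T -> seq T -> seq T -> R) s :
  sum_split (fun a b => sum_pick (fun y u => h y u b) a) s =
  sum_pick (fun y u => sum_split (h y) u) s.
Proof.
elim: s h => //= y s IH h.
by rewrite sum_splitD -addrA !IH sum_pickD.
Qed.

Lemma sum_split_pickr (h : T -> seq T -> seq T -> R) s :
  sum_split (fun a b => sum_pick (fun y u => h y a u) b) s =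
  sum_pick (fun y u => sum_split (h y) u) s.
Proof.
elim: s h => //= y s IH h.
by rewrite sum_splitD addrCA !IH sum_pickD.
Qed.

(** Coassociativity: both sides range over the ordered splittings into three parts. *)
Lemma sum_splitA (h : seq T -> seq T -> seq T -> R) s :
  sum_split (fun a x => sum_split (h a) x) s =
  sum_split (fun x c => sum_split (fun a b => h a b c) x) s.
Proof.
elim: s h => //= y s IH h.
by rewrite !sum_splitD !IH addrA.
Qed.

Lemma sum_split_size (h : nat -> nat -> R) s :
  sum_split (fun a b => h (size a) (size b)) s =
  \sum_(i < (size s).+1) 'C(size s, i)%:R * h i (size s - i)%N.
Proof.
elim: s h => [|y s IH] h /=.
  by rewrite big_ord1 bin0 mul1r.
rewrite (IH (fun i j => h i.+1 j)) (IH (fun i j => h i j.+1)).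
rewrite [RHS]big_ord_recl /= bin0 mul1r subn0.
under [in RHS]eq_bigr => i _ do rewrite /bump /= add1n binS natrD mulrDl subSS.
rewrite big_split /= [RHS]addrA [RHS]addrC; congr (_ + _).
rewrite big_ord_recl /= bin0 mul1r subn0; congr (_ + _).
rewrite [RHS]big_ord_recr /= bin_small // mul0r addr0.
by apply: eq_bigr => i _; rewrite /bump /= add1n subnSK // ltn_ord.
Qed.

Lemma ler_norm_sum_pick (h : T -> seq T -> R) (g : nat -> R) s :
  (forall y u, (size u).+1 = size s -> `|h y u| <= g (size u)) ->
  `|sum_pick h s| <= (size s)%:R * g (size s).-1.
Proof.
elim: s h g => [|y s IH] h g hg /=; first by rewrite normr0 mul0r.
rewrite (le_trans (ler_normD _ _)) // -natr1 mulrDl mul1r addrC lerD ?hg //.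
apply: le_trans (IH _ (fun n => g n.+1) _) _.
  by move=> z u su; apply: hg; rewrite /= su.
by case: (size s) => [|n]; rewrite ?mul0r.
Qed.

Lemma ler_norm_sum_pick2 (h g : T -> seq T -> R) s :
  (forall y u, (size u).+1 = size s -> `|h y u| <= g y u) ->
  `|sum_pick h s| <= sum_pick g s.
Proof.
elim: s h g => [|y s IH] h g hg /=; first by rewrite normr0.
rewrite (le_trans (ler_normD _ _)) // lerD ?hg ?IH // => z u su.
by apply: hg; rewrite /= su.
Qed.

Lemma ler_norm_sum_split (h g : seq T -> seq T -> R) s :
  (forall a b, (size a + size b)%N = size s -> `|h a b| <= g a b) ->
  `|sum_split h s| <= sum_split g s.
Proof.
elim: s h g => [|y s IH] h g hg /=; first exact: hg.
rewrite (le_trans (ler_normD _ _)) // lerD // IH // => a b ab; apply: hg;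
  by rewrite /= ?addnS -ab.
Qed.

(** Mayer expansion: each factor contributes 1 or [f t], and [a] collects the entries where [f t] is
    taken. Moving an entry to the front is the only rearrangement of [W] that the induction
    needs. *)
Lemma prodr_add1_split (f : T -> R) (W : seq T -> R) s :
  (forall a t b, W (a ++ t :: b) = W (t :: a ++ b)) ->
  (\prod_(t <- s) (1 + f t)) * W s =
  sum_split (fun a b => (\prod_(t <- a) f t) * W (a ++ b)) s.
Proof.
elim: s W => [|t s IH] W hW /=; first by rewrite !big_nil.
rewrite big_cons addrC mulrDl mulrDl mul1r; congr (_ + _).
  rewrite -mulrA (IH (fun u => W (t :: u))); last first.
    move=> a t' b; rewrite (hW (t :: a)) (hW [:: t']) //=.
  rewrite -sum_splitZ; apply: eq_sum_split => a b _.
  by rewrite big_cons mulrA.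
rewrite (IH (fun u => W (t :: u))); last first.
  by move=> a t' b; rewrite (hW (t :: a)) /= -(hW [:: t] t').
by apply: eq_sum_split => a b _; rewrite hW.
Qed.

End Untyped.

Lemma eq_sum_split_subseq (T : eqType) (h k : seq T -> seq T -> R) (s : seq T) :
  (forall a b, subseq a s -> subseq b s -> (size a + size b)%N = size s ->
     h a b = k a b) ->
  sum_split h s = sum_split k s.
Proof.
elim: s h k => [|y s IH] h k hk /=; first exact: hk.
have sub a : subseq a s -> subseq a (y :: s).
  by move=> sa; apply: subseq_trans sa (suffix_subseq [:: y] s).
congr (_ + _); apply: IH => a b sa sb ab; apply: hk.
- by rewrite /= eqxx.
- exact: sub.
- by rewrite /= -ab.
- exact: sub.
- by rewrite /= eqxx.
- by rewrite /= addnS ab.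
Qed.

End ListSums.

(** * Sums over perfect matchings with labelled chords *)

Section Chords.
Variables (R : realFieldType) (I : finType).

Definition chord := (nat * nat * I)%type.

Definition average (f : I -> R) : R := #|I|%:R^-1 * \sum_A f A.

Lemma eq_average f g : f =1 g -> average f = average g.
Proof. by move=> fg; rewrite /average (eq_bigr g). Qed.

Lemma averageD f g : average (fun A => f A + g A) = average f + average g.
Proof. by rewrite /average big_split mulrDr. Qed.

Lemma averageZ c f : average (fun A => c * f A) = c * average f.
Proof. by rewrite /average -mulr_sumr mulrCA. Qed.

Lemma ler_average f g : (forall A, f A <= g A) -> average f <= average g.
Proof. by move=> fg; rewrite ler_wpM2l ?invr_ge0// ler_sum. Qed.

Lemma ler_norm_average f : `|average f| <= average (fun A => `|f A|).
Proof.
by rewrite normrM ger0_norm ?invr_ge0// ler_wpM2l ?invr_ge0// ler_norm_sum.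
Qed.

Lemma average_le c f : 0 <= c -> (forall A, f A <= c) -> average f <= c.
Proof.
move=> c0 fc; apply: le_trans (ler_average fc) _.
rewrite /average sumr_const -(mulr_natl c) mulrA.
have [->|n0] := eqVneq (#|I|%:R : R) 0; first by rewrite mulr0 mul0r.
by rewrite mulVf // mul1r.
Qed.

Lemma sum_pick_average T (h : T -> seq T -> I -> R) s :
  sum_pick (fun y u => average (h y u)) s =
  average (fun A => sum_pick (fun y u => h y u A) s).
Proof.
elim: s h => /= [|y s IH] h.
  by rewrite /average big1 ?mulr0.
by rewrite IH averageD.
Qed.

Lemma sum_split_average T (h : seq T -> seq T -> I -> R) s :
  sum_split (fun y u => average (h y u)) s =
  average (fun A => sum_split (fun y u => h y u A) s).
Proof. by elim: s h => //= y s IH h; rewrite !IH averageD. Qed.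

(** The first position is paired with some later entry. The remainder after a pick is not a subterm
    of [s], so the recursion runs on the fuel [n]. *)
Fixpoint sum_match_rec (n : nat) (F : seq chord -> R) (s : seq nat) : R :=
  match s with
  | [::] => F [::]
  | x :: s' => if n is n'.+1 then
      sum_pick (fun y u =>
        average (fun A => sum_match_rec n' (fun V => F ((x, y, A) :: V)) u)) s'
      else 0
  end.

(* The sum over the perfect matchings of the positions in s, each chord (x, y, A)
   being decorated by a label A that is averaged over I. *)
Definition sum_match (F : seq chord -> R) (s : seq nat) : R :=
  sum_match_rec (size s) F s.

Lemma sum_match_rec_fuel n F s :
  (size s <= n)%N -> sum_match_rec n F s = sum_match F s.
Proof.
rewrite /sum_match; have [m] := ubnP (size s).
elim: m s n F => // m IH [|x s] [|n] F //=; rewrite !ltnS => sm sn.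
apply: eq_sum_pick => y u su; apply: eq_average => A.
by rewrite (IH u n) ?[RHS](IH u (size s)) //; lia.
Qed.

Lemma sum_match_cons F x s :
  sum_match F (x :: s) =
  sum_pick (fun y u => average (fun A => sum_match (fun V => F ((x, y, A) :: V)) u)) s.
Proof.
rewrite {1}/sum_match /=; apply: eq_sum_pick => y u su; apply: eq_average => A.
by rewrite sum_match_rec_fuel // -su.
Qed.

Lemma sum_match_ind (P : seq nat -> Prop) :
  P [::] -> (forall x s, (forall u, (size u < size s)%N -> P u) -> P (x :: s)) ->
  forall s, P s.
Proof.
move=> P0 PS s; have [m] := ubnP (size s).
elim: m s => // m IH [|x s] //= sm; apply: PS => u us.
by apply: IH; apply: leq_trans us _; rewrite -ltnS ltnW.
Qed.

Lemma eq_sum_match F G s :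
  (forall V, (size V).*2 = size s -> F V = G V) -> sum_match F s = sum_match G s.
Proof.
elim/sum_match_ind: s F G => [|x s IH] F G FG; first exact: FG.
rewrite !sum_match_cons; apply: eq_sum_pick => y u su; apply: eq_average => A.
by apply: IH; rewrite -?su // => V sV; apply: FG; rewrite /= doubleS sV su.
Qed.

Lemma sum_matchD F G s :
  sum_match (fun V => F V + G V) s = sum_match F s + sum_match G s.
Proof.
elim/sum_match_ind: s F G => [|x s IH] F G //.
rewrite !sum_match_cons -sum_pickD; apply: eq_sum_pick => y u su.
by rewrite -averageD; apply: eq_average => A; rewrite IH // -su.
Qed.

Lemma sum_matchZ c F s : sum_match (fun V => c * F V) s = c * sum_match F s.
Proof.
elim/sum_match_ind: s F => [|x s IH] F //.
rewrite !sum_match_cons -sum_pickZ; apply: eq_sum_pick => y u su.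
by rewrite -averageZ; apply: eq_average => A; rewrite IH // -su.
Qed.

Lemma sum_match0 s : sum_match (fun=> 0) s = 0.
Proof.
rewrite -[RHS](mul0r (sum_match (fun=> 0) s)) -sum_matchZ.
by apply: eq_sum_match => V _; rewrite mul0r.
Qed.

Lemma sum_match_sum (J : Type) (r : seq J) (F : J -> seq chord -> R) s :
  sum_match (fun V => \sum_(j <- r) F j V) s = \sum_(j <- r) sum_match (F j) s.
Proof.
elim: r => [|j r IH].
  by rewrite big_nil -[RHS](sum_match0 s); apply: eq_sum_match => V _; rewrite big_nil.
by rewrite big_cons -IH -sum_matchD; apply: eq_sum_match => V _; rewrite big_cons.
Qed.

Lemma sum_match_average (F : I -> seq chord -> R) s :
  sum_match (fun V => average (F^~ V)) s = average (fun A => sum_match (F A) s).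
Proof. by rewrite sum_matchZ sum_match_sum. Qed.

Lemma sum_match_pick T (F : T -> seq T -> seq chord -> R) (u : seq T) s :
  sum_match (fun V => sum_pick (fun y v => F y v V) u) s =
  sum_pick (fun y v => sum_match (F y v) s) u.
Proof. by elim: u F => /= [|y u IH] F; rewrite ?sum_match0 // sum_matchD IH. Qed.

Lemma sum_match_split T (F : seq T -> seq T -> seq chord -> R) (u : seq T) s :
  sum_match (fun V => sum_split (fun y v => F y v V) u) s =
  sum_split (fun y v => sum_match (F y v) s) u.
Proof. by elim: u F => //= y u IH F; rewrite sum_matchD !IH. Qed.

(** A matching with a distinguished subset of its chords is the same as a splitting of the positions
    together with a matching of each part. In the induction the chord at the first position goes to
    one of the two sides, which is a Leibniz rule. *)
Lemma sum_match_regroup (G : seq chord -> seq chord -> R) s :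
  sum_match (sum_split G) s =
  sum_split (fun Z X => sum_match (fun T => sum_match (G T) X) Z) s.
Proof.
elim/sum_match_ind: s G => [|x s IH] G //=.
rewrite sum_match_cons.
under [X in _ = X + _]eq_sum_split => a b _ do rewrite sum_match_cons.
rewrite sum_split_pickl.
under [X in _ = _ + X]eq_sum_split => a b _.
  under eq_sum_match => V _ do rewrite sum_match_cons.
  rewrite sum_match_pick.
  under eq_sum_pick => y u _ do rewrite (sum_match_average (fun A V => sum_match _ _)).
  over.
rewrite sum_split_pickr -sum_pickD; apply: eq_sum_pick => y u su.
rewrite !sum_split_average -averageD; apply: eq_average => A /=.
by rewrite sum_matchD !IH // -su.
Qed.

Lemma ler_norm_sum_match (F G : seq chord -> R) s :
  (forall V, (size V).*2 = size s -> `|F V| <= G V) ->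
  `|sum_match F s| <= sum_match G s.
Proof.
elim/sum_match_ind: s F G => [|x s IH] F G FG; first exact: FG.
rewrite !sum_match_cons; apply: ler_norm_sum_pick2 => y u su.
apply: le_trans (ler_norm_average _) _; apply: ler_average => A.
by apply: IH; rewrite -?su // => V sV; apply: FG; rewrite /= doubleS sV su.
Qed.

(** The number of perfect matchings of n points, (n-1)!! for even n and 0 for odd n; it is also the
    n-th moment of a standard Gaussian. *)
Fixpoint nmatch (n : nat) : nat :=
  match n with 0 => 1 | 1 => 0 | m.+2 => m.+1 * nmatch m end.

(** The labels of different chords are averaged independently, so a product weight factors over the
    chords of each matching. *)
Lemma sum_match_prod_le (phi : chord -> R) (e : R) s :
  (forall v, 0 <= phi v) ->
  (forall x y, average (fun A => phi (x, y, A)) <= e) ->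
  0 <= sum_match (fun V => \prod_(v <- V) phi v) s
    <= (nmatch (size s))%:R * e ^+ (size s)./2.
Proof.
move=> phi0 phie.
have e0 : 0 <= e.
  by apply: le_trans (phie 0%N 0%N); rewrite mulr_ge0 ?invr_ge0 ?sumr_ge0.
elim/sum_match_ind: s => [|x s IH].
  by rewrite /sum_match /= big_nil expr0 mulr1 ler01 lexx.
rewrite sum_match_cons.
have E y u : average (fun A =>
    sum_match (fun V => \prod_(v <- (x, y, A) :: V) phi v) u) =
    average (fun A => phi (x, y, A)) * sum_match (fun V => \prod_(v <- V) phi v) u.
  rewrite mulrC -averageZ; apply: eq_average => A.
  rewrite mulrC -sum_matchZ; apply: eq_sum_match => V _.
  by rewrite big_cons.
under eq_sum_pick => y u _ do rewrite E.
have a0 x' y : 0 <= average (fun A => phi (x', y, A)).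
  by rewrite mulr_ge0 ?invr_ge0 ?sumr_ge0.
apply/andP; split.
  have : forall t h, (forall y u, (size u).+1 = size t -> 0 <= h y u) -> 
      0 <= sum_pick (T := nat) h t :> R.
    elim=> //= y t IHt h h0; rewrite addr_ge0 ?h0 // IHt // => z u ut.
    by apply: h0; rewrite /= ut.
  apply => y u su; rewrite mulr_ge0 //.
  by have /IH/andP[] : (size u < size s)%N by rewrite -su.
apply: le_trans (ler_norm _) _.
apply: le_trans (@ler_norm_sum_pick _ _ _
  (fun n => (nmatch n)%:R * e ^+ n./2.+1) s _) _.
  move=> y u su.
  have /IH/andP[m0 m1] : (size u < size s)%N by rewrite -su.
  have b0 : 0 <= e * ((nmatch (size u))%:R * e ^+ (size u)./2).
    by rewrite !mulr_ge0 ?exprn_ge0.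
  have -> : (nmatch (size u))%:R * e ^+ (size u)./2.+1 =
     e * ((nmatch (size u))%:R * e ^+ (size u)./2) by rewrite exprS mulrCA.
  rewrite ger0_norm; first by rewrite ler_pM.
  by rewrite mulr_ge0 // a0.
rewrite -[size (x :: s)]/(size s).+1.
case: (size s) => [|n] /=; first by rewrite !mul0r.
by rewrite natrM mulrA.
Qed.

Lemma nmatch_odd n : odd n -> nmatch n = 0%N.
Proof.
elim/ltn_ind: n => -[|[|n]] // IH /=.
by rewrite negbK => on; rewrite IH ?muln0.
Qed.

Lemma nmatch_fact k : (nmatch k.*2 * (2 ^ k * k`!) = (k.*2)`!)%N.
Proof.
elim: k => // k IH.
rewrite doubleS !factS -IH expnS /=; move: (nmatch _) (2 ^ k)%N (k`!)%N => a b c.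
rewrite -[k.*2]addnn; ring.
Qed.

(** After division by m! the sum is a partial sum of nmatch i / i!. The even terms are 1 / (2^k k!),
    with total sqrt(e) < 2; bounding them by 2^-k gives a telescoping proof. *)
Lemma sum_nmatch_le m :
  \sum_(i < m.+1) 'C(m, i)%:R * ((nmatch i)%:R * (m - i)`!%:R) <= 2 * m`!%:R :> R.
Proof.
have -> : \sum_(i < m.+1) 'C(m, i)%:R * ((nmatch i)%:R * (m - i)`!%:R) =
          m`!%:R * \sum_(i < m.+1) ((nmatch i)%:R / i`!%:R) :> R.
  rewrite mulr_sumr; apply: eq_bigr => i _.
  have im : (i <= m)%N by rewrite -ltnS.
  rewrite -(bin_fact im) !natrM.
  have f0 : i`!%:R != 0 :> R by rewrite pnatr_eq0 -lt0n fact_gt0.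
  by field.
rewrite mulrC ler_wpM2r //.
pose t i : R := (nmatch i)%:R / i`!%:R.
have B k : \sum_(0 <= i < k.*2.+1) t i <= 2 - 2^-1 ^+ k :> R.
  elim: k => [|k IH]; first by rewrite big_nat1 /t /= fact0 invr1 mul1r expr0; lra.
  have E1 : t k.*2.+1 = 0 by rewrite /t nmatch_odd ?mul0r //= odd_double.
  rewrite doubleS big_nat_recr //= big_nat_recr //= E1 addr0 /t.
  apply: le_trans (lerD IH (_ : _ <= 2^-1 ^+ k.+1)) _; last by rewrite exprS; lra.
  rewrite -doubleS -nmatch_fact.
  have n0 : (0 < nmatch k.+1.*2)%N.
    rewrite lt0n; apply/eqP => h; have := nmatch_fact k.+1; rewrite h mul0n.
    by move=> /esym/eqP; rewrite -leqn0 leqNgt fact_gt0.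
  have n1 : (nmatch k.+1.*2)%:R != 0 :> R by rewrite pnatr_eq0 -lt0n.
  have f0 : (k.+1)`!%:R != 0 :> R by rewrite pnatr_eq0 -lt0n fact_gt0.
  have p0 : (2 ^+ k.+1 : R) != 0 by rewrite expf_neq0 // pnatr_eq0.
  have := fact_gt0 k.+1; move: (nmatch k.+1.*2) (k.+1`!)%N n1 f0 => a b a0 b0 bp.
  rewrite !natrM natrX exprVn.
  have -> : a%:R / (a%:R * (2 ^+ k.+1 * b%:R)) = (2 ^+ k.+1)^-1 / b%:R :> R.
    by field; rewrite a0 b0 p0.
  by rewrite ler_piMr ?invr_ge0 ?exprn_ge0 // invf_le1 ?ltr0n // ler1n.
have [k] : exists k, (m.+1 <= k.*2.+1)%N by exists m; lia.
move=> mk; apply: le_trans (le_trans (B k) _).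
  rewrite (@big_cat_nat _ _ _ m.+1) //= big_mkord lerDl.
  by apply: sumr_ge0 => i _; rewrite divr_ge0.
by rewrite lerBlDr lerDl exprn_ge0 // invr_ge0.
Qed.

End Chords.

(** * Ursell weights of pinned chords and the bound on cumulants *)

Section Cluster.
Variables (R : realFieldType) (I : finType) (anti : rel I) (b : R).
Hypothesis anti_sym : ssrbool.symmetric anti.
Hypothesis b_ge0 : 0 <= b.
Hypothesis anti_average :
  forall A : I, average (fun B => (anti A B)%:R) <= b ^+ 2 / 4.

Local Notation chord := (chord I).
Implicit Types (v t : chord) (P V X : seq chord).

Definition crossing v t : bool :=
  let: (x, y) := v.1 in let: (x', y') := t.1 in
  ((x < x') && (x' < y) && (y < y') || (x' < x) && (x < y') && (y' < y))%N.

Definition chord_sign v t : R := (-1) ^+ (crossing v t && anti v.2 t.2).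

Lemma chord_sign_sym v t : chord_sign v t = chord_sign t v.
Proof.
rewrite /chord_sign anti_sym /crossing.
by case: v t => -[x y] A [[x' y'] B] /=; rewrite orbC.
Qed.

Definition row_sign v V : R := \prod_(t <- V) chord_sign v t.

Fixpoint diagram_sign V : R :=
  if V is v :: V' then row_sign v V' * diagram_sign V' else 1.

(** The sign is a product over unordered pairs of chords, because [chord_sign] is symmetric; the
    recursive definition only fixes an enumeration of the pairs. *)
Lemma diagram_sign_perm P V : perm_eq P V -> diagram_sign P = diagram_sign V.
Proof.
have rp v s1 s2 : perm_eq s1 s2 -> row_sign v s1 = row_sign v s2.
  by move=> p12; apply: perm_big.
have mid v s1 s2 : diagram_sign (s1 ++ v :: s2) = diagram_sign (v :: s1 ++ s2).
  elim: s1 => //= t s1 ->; rewrite /= /row_sign big_cons.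
  rewrite !big_cat big_cons /= chord_sign_sym; ring.
move=> pq; apply: (catCA_perm_subst (fun s1 s2 s3 => _) pq).
elim=> [|t s1 IH] s2 s3 //.
by rewrite mid cat_cons /= IH; congr (_ * _); apply: rp; rewrite perm_catCA.
Qed.

Lemma chord_signE v t : chord_sign v t = 1 + (chord_sign v t - 1).
Proof. by rewrite addrC subrK. Qed.

Lemma norm_row_sign v V : `|row_sign v V| = 1.
Proof.
rewrite normr_prod big1_seq // => t _.
by rewrite normrX normrN normr1 expr1n.
Qed.

Lemma norm_diagram_sign V : `|diagram_sign V| = 1.
Proof. by elim: V => /= [|v V IH]; rewrite ?normr1 // normrM norm_row_sign IH mulr1. Qed.

Definition pinned_sum P s : R := sum_match (fun V => diagram_sign (V ++ P)) s.
Definition match_sum s : R := sum_match diagram_sign s.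

(** A recursion of Kirkwood-Salsburg type. Only the row of [v] is expanded: the chords for which
    sign - 1 is taken become pinned in its place, and the other chords no longer see [v]. *)
Lemma pinned_sum_cons v P s :
  pinned_sum (v :: P) s = row_sign v P *
    sum_split (fun z x => sum_match (fun V =>
      (\prod_(t <- V) (chord_sign v t - 1)) * pinned_sum (V ++ P) x) z) s.
Proof.
rewrite /pinned_sum.
transitivity (row_sign v P * sum_match (sum_split (fun V W =>
    (\prod_(t <- V) (chord_sign v t - 1)) * diagram_sign (W ++ V ++ P))) s).
  rewrite -sum_matchZ; apply: eq_sum_match => V _.
  have -> : diagram_sign (V ++ v :: P) = diagram_sign (v :: V ++ P).
    by apply: diagram_sign_perm; rewrite perm_catC /= perm_cons perm_catC.
  rewrite /= {1}/row_sign big_cat /= -/(row_sign v P) mulrAC mulrC; congr (_ * _).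
  under eq_bigr => t _ do rewrite chord_signE.
  rewrite (@prodr_add1_split _ _ _ (fun V => diagram_sign (V ++ P))).
    apply: eq_sum_split => a c _; congr (_ * _); apply: diagram_sign_perm.
    by rewrite catA perm_cat2r perm_catC.
  move=> a t c; apply: diagram_sign_perm.
  by rewrite perm_cat2r -cat1s perm_catCA.
rewrite sum_match_regroup; congr (_ * _); apply: eq_sum_split => z x _.
by apply: eq_sum_match => V _; rewrite sum_matchZ.
Qed.

(* The truncated (Ursell) weights of pinned chords P: they divide the vacuum out of
   [pinned_sum], and satisfy the same recursion with a trivial initial value. *)
Fixpoint truncated (n : nat) P (s : seq nat) : R :=
  match P with
  | [::] => (nilp s)%:R
  | v :: P' => if n is n'.+1 then
      row_sign v P' * sum_split (fun z x => sum_match (fun V =>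
        (\prod_(t <- V) (chord_sign v t - 1)) * truncated n' (V ++ P') x) z) s
      else 0
  end.

(** Both sides obey the same recursion in [P], and a three-way splitting may be done in either
    order, so the vacuum factor [match_sum] can be carried outside. The fuel suffices because each
    step trades one pinned chord for chords that use two positions each. *)
Lemma pinned_sum_truncated n P s : (size P + size s <= n)%N ->
  pinned_sum P s = sum_split (fun z x => truncated n P z * match_sum x) s.
Proof.
elim: n P s => [|n IH] [|v P] s //=.
- case: s => //= _; rewrite mul1r /pinned_sum; apply: eq_sum_match => V _.
  by rewrite cats0.
- move=> _; have -> : pinned_sum [::] s = match_sum s.
    by apply: eq_sum_match => V _; rewrite cats0.
  elim: s match_sum => /= [|x s IHs] F; first by rewrite mul1r.
  rewrite -(IHs (fun u => F (x :: u))) -[LHS]add0r; congr (_ + _).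
  by rewrite -[LHS](sum_split0 R s); apply: eq_sum_split => a c _; rewrite mul0r.
rewrite addSn ltnS => sn; rewrite pinned_sum_cons -sum_splitZ.
under [RHS]eq_sum_split => z x _ do
  rewrite -mulrA (mulrC (sum_split _ _)) -sum_splitZ -sum_splitZ.
rewrite -[RHS]sum_splitA; apply: eq_sum_split => z x zx.
transitivity (row_sign v P * sum_match (fun V => sum_split (fun y y' =>
    match_sum y' * ((\prod_(t <- V) (chord_sign v t - 1)) * truncated n (V ++ P) y)) x) z).
  congr (_ * _); apply: eq_sum_match => V sV.
  rewrite (IH (V ++ P) x); last by rewrite size_cat; lia.
  by rewrite -sum_splitZ; apply: eq_sum_split => y y' _; ring.
rewrite sum_match_split -sum_splitZ; apply: eq_sum_split => y y' _.
by rewrite sum_matchZ.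
Qed.

Lemma norm_chord_sign_sub1 v t :
  `|chord_sign v t - 1| <= 2 * (anti v.2 t.2)%:R.
Proof.
rewrite /chord_sign; case: (anti _ _); last by rewrite andbF subrr normr0 mulr0.
rewrite andbT mulr1; case: (crossing _ _); last by rewrite subrr normr0.
by rewrite expr1 -opprD normrN ger0_norm ?addr_ge0.
Qed.

(** The weight 2^|P| makes the induction close. A newly pinned chord costs on average b^2/2 for its
    factor sign - 1 and 2 for being pinned, hence b for each of its two endpoints; the sum over
    splittings, by [sum_nmatch_le], costs the factor 2 that belongs to [v]. *)
Lemma truncated_le n P s :
  `|truncated n P s| <= (size s)`!%:R * b ^+ size s * 2 ^+ size P.
Proof.
have bound0 m l : 0 <= m`!%:R * b ^+ m * 2 ^+ l :> R by rewrite !mulr_ge0 ?exprn_ge0.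
have base u : `|(nilp u)%:R| <= (size u)`!%:R * b ^+ size u * 2 ^+ 0 :> R.
  case: u => [|x u]; last by rewrite normr0.
  by rewrite normr1 expr0 fact0 !mulr1.
elim: n P s => [|n IH] [|v P] s /=; rewrite ?normr0 //.
rewrite normrM norm_row_sign mul1r.
pose w (i j : nat) : R := 2 ^+ size P * b ^+ (i + j) * ((nmatch i)%:R * j`!%:R).
apply: (@le_trans _ _ (sum_split (fun z x => w (size z) (size x)) s)).
  apply: ler_norm_sum_split => z x _.
  apply: (@le_trans _ _ (sum_match (fun V => ((size x)`!%:R * b ^+ size x * 2 ^+ size P) *
    \prod_(t <- V) (2 * `|chord_sign v t - 1|)) z)).
    apply: ler_norm_sum_match => V _.
    rewrite normrM normr_prod big_split /= mulrCA mulrA.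
    rewrite mulrC ler_wpM2r ?prodr_ge0 //.
    apply: le_trans (IH _ _) _.
    rewrite size_cat exprD big_const_seq count_predT iter_mulr_1.
    by rewrite le_eqVlt; apply/orP; left; apply/eqP; ring.
  rewrite sum_matchZ.
  have p0 t : 0 <= 2 * `|chord_sign v t - 1| by rewrite mulr_ge0.
  (* The constant b^2/4 in [anti_average] is chosen for this: |sign - 1| is at most 2 on
     anticommuting labels and 0 otherwise, and the pinning weight brings another factor 2. *)
  have p1 x' y' : average (fun A => 2 * `|chord_sign v (x', y', A) - 1|) <= b ^+ 2.
    rewrite averageZ.
    apply: (@le_trans _ _ (2 * (2 * (b ^+ 2 / 4)))); last by lra.
    rewrite ler_wpM2l //.
    apply: (@le_trans _ _ (average (fun B => 2 * (anti v.2 B)%:R))).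
      by apply: ler_average => B; apply: norm_chord_sign_sub1.
    by rewrite averageZ ler_wpM2l.
  have /andP[_ H] := sum_match_prod_le z p0 p1; move: H; rewrite -exprM => H.
  apply: le_trans (ler_wpM2l (bound0 _ _) H) _.
  rewrite /w; case: (boolP (odd (size z))) => oz.
    by rewrite nmatch_odd // !mul0r !mulr0.
  have -> : (2 * (size z)./2)%N = size z by rewrite mul2n even_halfK.
  by rewrite exprD le_eqVlt; apply/orP; left; apply/eqP; ring.
rewrite (sum_split_size w) /w.
have -> : \sum_(i < (size s).+1) 'C(size s, i)%:R *
    (2 ^+ size P * b ^+ (i + (size s - i)) * ((nmatch i)%:R * (size s - i)`!%:R)) =
  2 ^+ size P * b ^+ size s *
    \sum_(i < (size s).+1) 'C(size s, i)%:R * ((nmatch i)%:R * (size s - i)`!%:R).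
  rewrite mulr_sumr; apply: eq_bigr => i _.
  by rewrite subnKC; [ring | rewrite -ltnS].
apply: le_trans (ler_wpM2l _ (sum_nmatch_le _ _)) _.
  by rewrite mulr_ge0 ?exprn_ge0.
by rewrite exprS le_eqVlt; apply/orP; left; apply/eqP; ring.
Qed.

Definition cumulant_sum n x s : R :=
  sum_pick (fun y u => average (fun A => truncated n [:: (x, y, A)] u)) s.

(** The combinatorial form of F' = F h: the chord at [x], together with everything linked to it,
    uses the positions [z], and the remaining ones are matched freely. *)
Lemma match_sum_cons n x s : (size s <= n)%N ->
  match_sum (x :: s) = sum_split (fun z u => cumulant_sum n x z * match_sum u) s.
Proof.
move=> sn; rewrite /match_sum sum_match_cons.
transitivity (sum_pick (fun y u => average (fun A =>
    sum_split (fun z x' => match_sum x' * truncated n [:: (x, y, A)] z) u)) s).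
  apply: eq_sum_pick => y u su; apply: eq_average => A.
  transitivity (pinned_sum [:: (x, y, A)] u).
    by apply: eq_sum_match => V _; apply: diagram_sign_perm; rewrite perm_sym perm_catC.
  rewrite (@pinned_sum_truncated n); last by rewrite add1n su.
  by apply: eq_sum_split => z x' _; rewrite mulrC.
under [RHS]eq_sum_split => z u _ do rewrite mulrC /cumulant_sum -sum_pickZ.
rewrite sum_split_pickl; apply: eq_sum_pick => y u _.
by rewrite -sum_split_average; apply: eq_sum_split => z x' _; rewrite averageZ.
Qed.

(** One position of [s] is spent on the partner of [x], which lowers the exponent of b; the choice
    of that position restores the full factorial. *)
Lemma cumulant_sum_le n x s :
  `|cumulant_sum n x s| <= 2 * (size s)`!%:R * b ^+ (size s).-1.
Proof.
apply: le_trans (@ler_norm_sum_pick _ _ _ (fun m => m`!%:R * b ^+ m * 2) s _) _.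
  move=> y u _; apply: le_trans (ler_norm_average _) _.
  apply: average_le => [|A]; first by rewrite !mulr_ge0 ?exprn_ge0.
  exact: truncated_le.
case: (size s) => [|m] /=; first by rewrite mul0r !mulr_ge0 ?exprn_ge0.
by rewrite factS natrM le_eqVlt; apply/orP; left; apply/eqP; ring.
Qed.

Lemma match_sum_norm_le s : `|match_sum s| <= (nmatch (size s))%:R.
Proof.
apply: le_trans (ler_norm_sum_match (G := fun V => \prod_(v <- V) 1) _) _.
  by move=> V _; rewrite norm_diagram_sign big1_eq.
have p0 (v : chord) : 0 <= 1 :> R by [].
have p1 (x y : nat) : average (fun _ : I => 1) <= 1 :> R by apply: average_le.
have /andP[_] := sum_match_prod_le s p0 p1.
by rewrite expr1n mulr1.
Qed.

Variables (m k : nat -> R).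
Hypothesis match_sum_m : forall s, sorted ltn s -> match_sum s = m (size s).
Hypothesis cumulant_k : forall j, m j.+1 =
  \sum_(i < j.+1) 'C(j, i)%:R * (k i * m (j - i)%N).

(** The connected sum could depend on the actual positions. It does not: [match_sum] depends only on
    the length, and the recursion determines the cumulant of top order from it and from the smaller
    ones. *)
Lemma cumulant_sumE n x s : (size s <= n)%N -> sorted ltn (x :: s) ->
  cumulant_sum n x s = k (size s).
Proof.
have [j] := ubnP (size s); elim: j s => // j IH s; rewrite ltnS => sj sn ss.
have m0 : m 0%N = 1 by rewrite -(match_sum_m (s := [::])).
have := match_sum_cons x sn; rewrite match_sum_m // cumulant_k.
rewrite -(sum_split_size (fun i j => k i * m j)).
(* Terms of all splittings but the extreme one, with everything on the left, agree; cancelling them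
   leaves the extreme term. *)
have : forall (t : seq nat) (F G : seq nat -> seq nat -> R),
    (forall a c, subseq a t -> subseq c t -> (size a + size c)%N = size t ->
      (size a < size t)%N -> F a c = G a c) ->
    sum_split F t = sum_split G t -> F t [::] = G t [::].
  elim=> [|y t IHt] F G FG //= E.
  have sub u : subseq u t -> subseq u (y :: t).
    by move=> h; apply: subseq_trans h (subseq_cons _ _).
  apply: (IHt (fun a => F (y :: a)) (fun a => G (y :: a))).
    move=> a c sa sc ac lt; apply: FG => //=; [by rewrite eqxx | exact: sub |].
    by rewrite addSn ac.
  move: E; have -> : sum_split (fun a c => F a (y :: c)) t =
                     sum_split (fun a c => G a (y :: c)) t.
    apply: eq_sum_split_subseq => a c sa sc ac.
    apply: FG => /=; [exact: sub | by rewrite eqxx | by rewrite addnS ac |].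
    by rewrite ltnS -ac leq_addr.
  by move/addIr.
move=> /(_ s _ _ _) H /esym /H; rewrite /match_sum /= m0 !mulr1; apply.
move=> a c sa sc ac lt.
have sc' : sorted ltn c.
  apply: (subseq_sorted ltn_trans sc); exact: path_sorted ss.
rewrite -/(match_sum c) match_sum_m // IH //.
- exact: leq_trans lt sj.
- exact: leq_trans (ltnW lt) sn.
by apply: (subseq_sorted ltn_trans _ ss); rewrite /= eqxx.
Qed.

Lemma cumulant_bound i : `|k i| <= 2 * i`!%:R * b ^+ i.-1.
Proof.
have ss : sorted ltn (0%N :: iota 1 i) by apply: (iota_ltn_sorted 0 i.+1).
by have := cumulant_sum_le i 0 (iota 1 i); rewrite cumulant_sumE ?size_iota.
Qed.

End Cluster.

(** * Majorana algebra *)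

Section Adjoint.
Variable R : realType.
Local Notation C := R[i].

Definition adjmx d (A : 'M[C]_d) : 'M[C]_d := map_mx (@conjc R) A^T.

Lemma adjmxM d (A B : 'M[C]_d) : adjmx (A *m B) = adjmx B *m adjmx A.
Proof. by rewrite /adjmx trmx_mul map_mxM. Qed.

Lemma adjmxD d (A B : 'M[C]_d) : adjmx (A + B) = adjmx A + adjmx B.
Proof. by rewrite /adjmx linearD /= map_mxD. Qed.

Lemma adjmxZ d c (A : 'M[C]_d) : adjmx (c *: A) = conjc c *: adjmx A.
Proof. by rewrite /adjmx linearZ /= map_mxZ. Qed.

Lemma adjmx1 d : adjmx (1%:M : 'M[C]_d) = 1%:M.
Proof. by rewrite /adjmx trmx1 map_mx1. Qed.

Lemma adjmx_sum d (I : Type) (r : seq I) (P : pred I) (F : I -> 'M[C]_d) :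
  adjmx (\sum_(i <- r | P i) F i) = \sum_(i <- r | P i) adjmx (F i).
Proof.
apply: (big_morph _ (@adjmxD d)).
by rewrite /adjmx trmx0 map_mx0.
Qed.

Lemma adjmxK d : involutive (@adjmx d).
Proof. by move=> A; apply/matrixP => i j; rewrite !mxE conjcK. Qed.

Lemma mxtrace_adj d (A : 'M[C]_d) : \tr (adjmx A) = conjc (\tr A).
Proof. by rewrite /adjmx trace_map_mx mxtrace_tr. Qed.

Lemma conjc_mul_ge0 (x : C) : 0 <= conjc x * x.
Proof. by rewrite mulrC -sqr_normc exprn_ge0. Qed.

Lemma mxtrace_adj_mul_ge0 d (A : 'M[C]_d) : 0 <= \tr (adjmx A *m A).
Proof.
apply: sumr_ge0 => i _; rewrite mxE; apply: sumr_ge0 => j _.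
by rewrite !mxE conjc_mul_ge0.
Qed.

Lemma adj_tens n (F : 'I_n -> 'M[C]_2) : adjmx (tens F) = tens (fun k => adjmx (F k)).
Proof.
elim: n F => [|n IH] F /=; first exact: adjmx1.
rewrite -IH /adjmx trmx_cast map_castmx /= trmx_tens map_mxT.
by congr castmx.
Qed.

Lemma unitary_entry_le d (U : 'M[C]_d) (i j : 'I_d) :
  adjmx U *m U = 1%:M -> `|U i j| <= 1.
Proof.
move=> /matrixP/(_ j j); rewrite !mxE eqxx (bigD1 i) //= => U1.
have : `|U i j| ^+ 2 <= 1.
  rewrite -[leRHS]U1 !mxE sqr_normc mulrC lerDl; apply: sumr_ge0 => k _.
  by rewrite !mxE conjc_mul_ge0.
by rewrite -{1}(expr1n _ 2) ler_sqr ?nnegrE.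
Qed.

End Adjoint.

(** * Products of Majorana matrices and the sector traces *)

Section MajoranaAlgebra.
Local Open Scope complex_scope.
Local Open Scope ring_scope.
Variables (R : realType) (N : nat).
Hypothesis oN : ~~ odd N.
Local Notation C := R[i].
Local Notation D := (2 ^ N./2)%N.
Local Notation mon s := (\prod_(i <- s) majorana R i).
Implicit Types (A B : {set 'I_N}) (X Y : 'M[C]_D).

Local Ltac pauli_tac := apply/matrixP => -[[|[|//]] ?] -[[|[|//]] ?];
  rewrite !mxE ?big_ord_recl ?big_ord0 ?mxE /=;
  apply/eqP; rewrite eq_complex /=; apply/andP; split;
  apply/eqP; ring.

Lemma adj_pauli_x : adjmx (pauli_x R) = pauli_x R. Proof. pauli_tac. Qed.
Lemma adj_pauli_y : adjmx (pauli_y R) = pauli_y R. Proof. pauli_tac. Qed.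
Lemma adj_pauli_z : adjmx (pauli_z R) = pauli_z R. Proof. pauli_tac. Qed.

Lemma adj_majorana (i : 'I_N) : adjmx (majorana R i) = majorana R i.
Proof.
rewrite /majorana adj_tens; apply: eq_tens => k.
case: ifP => _; first exact: adj_pauli_z.
case: ifP => _; last exact: adjmx1.
by case: ifP => _; [exact: adj_pauli_y | exact: adj_pauli_x].
Qed.

Lemma adj_parity : adjmx (parity R N) = parity R N.
Proof. by rewrite /parity adj_tens; apply: eq_tens => k; exact: adj_pauli_z. Qed.

Lemma parity_sq : parity R N *m parity R N = 1%:M.
Proof. by rewrite /parity tensM -(tens1 R N./2); apply: eq_tens => k; exact: pauli_zz. Qed.

(** The two tensor products fail to commute at exactly one site, the one where the Majorana matrix
    carries [pauli_x] or [pauli_y]. *)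
Lemma parity_majorana (i : 'I_N) :
  parity R N *m majorana R i = - (majorana R i *m parity R N).
Proof.
have iN : (i./2 < N./2)%N by have := ltn_ord i; lia.
rewrite /parity /majorana !tensM.
transitivity (tens (fun k : 'I_N./2 => (if k == i./2 :> nat then -1 else 1) *:
   ((site_pauli R i k) *m pauli_z R))).
  apply: eq_tens => k; rewrite /site_pauli; case: ltngtP => [_|_|_]; rewrite ?scale1r //.
    by rewrite mulmx1 mul1mx.
  by case: ifP => _; [exact: pauli_zy | exact: pauli_zx].
rewrite tensZ (bigD1 (Ordinal iN)) //= eqxx big1 ?mulr1 ?scaleN1r //.
by move=> k; rewrite -val_eqE /= => /negPf ->.
Qed.

Lemma parity_mon (s : seq 'I_N) :
  parity R N *m mon s = (-1) ^+ size s *: (mon s *m parity R N).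
Proof.
elim: s => [|i s IH]; first by rewrite big_nil scale1r mulmx1 mul1mx.
rewrite big_cons -[X in _ *m X]/(majorana R i *m mon s) mulmxA parity_majorana.
rewrite mulNmx -mulmxA IH -scalemxAr mulmxA exprS mulN1r scaleNr.
by [].
Qed.

Lemma adj_mon (s : seq 'I_N) : adjmx (mon s) = mon (rev s).
Proof.
elim: s => [|i s IH]; first by rewrite !big_nil; exact: adjmx1.
rewrite rev_cons big_rcons /= big_cons.
rewrite -[X in adjmx X]/(majorana R i *m mon s) adjmxM IH adj_majorana.
by [].
Qed.

Lemma mon_rev (s : seq 'I_N) : uniq s -> mon (rev s) = (-1) ^+ 'C(size s, 2) *: mon s.
Proof.
elim: s => [|i s IH] /=; first by rewrite scale1r.
move=> /andP[is_ us]; rewrite rev_cons big_rcons /= IH // big_cons mon_comm1 //.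
have -> : (\sum_(j <- s) (i != j) = size s)%N.
  rewrite -sum1_size big_seq [RHS]big_seq; apply: eq_bigr => j js.
  by case: eqP => // ij; rewrite ij js in is_.
rewrite scalerA -exprD binS bin1 -addnA addnn.
by rewrite mscaleAl -[in RHS]signr_odd oddD odd_double addbF signr_odd.
Qed.

(** The phase in [Gam] is made for this: reversing the product and conjugating the phase both
    produce the sign (-1)^C(|A|,2), and the two cancel. *)
Lemma Gam_adj A : adjmx (Gam R A) = Gam R A.
Proof.
rewrite /Gam adjmxZ adj_mon mon_rev ?enum_uniq // scalerA -cardE; congr (_ *: _).
rewrite rmorphXn /= -exprMn; congr (_ ^+ _).
by apply/eqP; rewrite eq_complex /=; apply/andP; split; apply/eqP; ring.
Qed.

Lemma Gam_sq A : Gam R A *m Gam R A = 1%:M.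
Proof.
rewrite -{1}Gam_adj /Gam adjmxZ -scalemxAl -scalemxAr scalerA adj_mon.
rewrite -[_ *m _]/(mon (rev _) * mon _) mon_inv // rmorphXn /= -exprMn.
have -> : conjc 'i%C * 'i%C = 1 :> C.
  by apply/eqP; rewrite eq_complex /=; apply/andP; split; apply/eqP; ring.
by rewrite expr1n scale1r.
Qed.

Lemma Gam_comm A B : ~~ odd #|A| ->
  Gam R A *m Gam R B = (-1) ^+ #|A :&: B| *: (Gam R B *m Gam R A).
Proof.
move=> oA; rewrite /Gam -!scalemxAl -!scalemxAr !scalerA mulrC -[LHS]scalerA.
rewrite [X in _ *: (_ *: X) = _]mon_comm // scalerA scalerA; congr (_ *: _).
have := card_neq_pairs A B => /(congr1 odd).
rewrite oddD oddM (negPf oA) /= -(signr_odd _ (\sum_(i <- _) _)) -(signr_odd _ #|_|).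
by case: odd; case: odd => // _; ring.
Qed.

Lemma majorana_Gam (i : 'I_N) A : ~~ odd #|A| ->
  majorana R i *m Gam R A = (-1) ^+ (i \in A) *: (Gam R A *m majorana R i).
Proof.
move=> oA; rewrite /Gam -scalemxAr -scalemxAl [X in _ *: X = _]mon_comm1 //.
rewrite !scalerA mulrC; congr (_ * _ *: _).
have : (\sum_(j <- enum A) (i != j) + (i \in A) = #|A|)%N.
  rewrite big_enum /= -sum1_card; case: (boolP (i \in A)) => iA.
    rewrite (bigD1 i) //= eqxx add0n [RHS](bigD1 i) //= addnC; congr addn.
    by apply: eq_bigr => j /andP[_]; rewrite eq_sym => ->.
  rewrite addn0; apply: eq_bigr => j jA; case: eqP => // ij.
  by rewrite ij jA in iA.
move/(congr1 odd); rewrite oddD (negPf oA) oddb -signr_odd.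
by case: odd; case: (i \in A).
Qed.

Lemma parity_Gam A : ~~ odd #|A| -> comm_mx (parity R N) (Gam R A).
Proof.
move=> oA; rewrite /comm_mx /Gam -scalemxAr -scalemxAl parity_mon -cardE.
by rewrite -signr_odd (negPf oA) scale1r.
Qed.

(** Insert the square of the Majorana matrix, which is 1, move one factor through [X] at the cost of
    a sign, and bring it back by cyclicity. *)
Lemma trace_anticomm (i : 'I_N) X :
  majorana R i *m X = - (X *m majorana R i) -> \tr X = 0.
Proof.
move=> aX; have : \tr X = - \tr X.
  rewrite -{1}[X]mul1mx -(majorana_sq R i) -mulmxA aX mulmxN raddfN /= mulmxA.
  by rewrite mxtrace_mulC mulmxA majorana_sq // mul1mx.
move/eqP; rewrite -subr_eq0 opprK -mulr2n mulrn_eq0 /=.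
by move/eqP.
Qed.

Lemma trace_parity : (0 < N)%N -> \tr (parity R N) = 0.
Proof.
move=> N0; apply: (@trace_anticomm (Ordinal N0)).
by rewrite parity_majorana opprK.
Qed.

(** An index in exactly one of the two sets gives a Majorana matrix that commutes with one factor
    and anticommutes with the other, the sizes being even. *)
Lemma trace_Gam2 A B : ~~ odd #|A| -> ~~ odd #|B| -> A != B ->
  \tr (Gam R A *m Gam R B) = 0.
Proof.
move=> oA oB AB.
have [i iAB] : exists i, (i \in A) != (i \in B).
  apply/existsP; rewrite -negb_forall; apply: contra AB => /forallP h.
  by apply/eqP/finset.setP => x; apply/eqP.
apply: (@trace_anticomm i).
rewrite mulmxA majorana_Gam // -scalemxAl -mulmxA majorana_Gam // -scalemxAr scalerA mulmxA.
by case: (i \in A) (i \in B) iAB => [] [] //=; rewrite ?mulr1 ?mul1r scaleN1r.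
Qed.

(** As |A| + |B| < N, some index lies in neither set; its Majorana matrix commutes with both factors
    and anticommutes with the parity. This makes the family orthonormal in the half sectors as
    well. *)
Lemma trace_parity_Gam2 A B : ~~ odd #|A| -> ~~ odd #|B| -> (#|A| + #|B| < N)%N ->
  \tr (parity R N *m (Gam R A *m Gam R B)) = 0.
Proof.
move=> oA oB AB.
have [i iAB] : exists i, i \notin A :|: B.
  apply/existsP; rewrite -[X in is_true X]negbK negb_exists; apply/negP => /forallP h.
  have : (N <= #|A :|: B|)%N.
    rewrite -{1}(card_ord N); apply/subset_leq_card/fintype.subsetP => x _.
    by have := h x; rewrite negbK.
  by rewrite leqNgt (leq_ltn_trans (leq_card_setU A B) AB).
move: iAB; rewrite inE negb_or => /andP[/negPf iA /negPf iB].
apply: (@trace_anticomm i).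
have := parity_majorana i => /(congr1 -%R); rewrite opprK => E.
rewrite mulmxA -E mulNmx -!mulmxA; congr (- (_ *m _)).
rewrite [LHS]mulmxA majorana_Gam // iA scale1r -mulmxA.
by rewrite majorana_Gam // iB scale1r.
Qed.

Definition sector_sign (tau : sector) : C :=
  match tau with Full => 0 | Plus => 1 | Minus => -1 end.

(* [ntrace tau] extends [sector_trace] from operators that commute with the parity
   to a functional that is linear on all operators. *)
Definition sector_weight (tau : sector) : 'M[C]_D := 1%:M + sector_sign tau *: parity R N.

Definition ntrace (tau : sector) X : C := \tr (sector_weight tau *m X) / D%:R.

Lemma ntraceD tau X Y : ntrace tau (X + Y) = ntrace tau X + ntrace tau Y.
Proof. by rewrite /ntrace mulmxDr mxtraceD mulrDl. Qed.

Lemma ntraceZ tau c X : ntrace tau (c *: X) = c * ntrace tau X.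
Proof. by rewrite /ntrace -scalemxAr mxtraceZ mulrA. Qed.

Lemma ntrace_sum tau (I : Type) (r : seq I) (P : pred I) (F : I -> 'M[C]_D) :
  ntrace tau (\sum_(i <- r | P i) F i) = \sum_(i <- r | P i) ntrace tau (F i).
Proof.
by rewrite /ntrace mulmx_sumr raddf_sum /= mulr_suml.
Qed.

Lemma D_neq0 : D%:R != 0 :> C.
Proof. by rewrite pnatr_eq0 expn_eq0. Qed.

(** [Q] acts as the projection onto the row space of [V], and [pinvmx b *m b] fixes that row space
    for any basis [b]; cyclicity then removes the basis. It is applied with Q = (1 + e P^T)/2. *)
Lemma trace_restrictmx (Q V X : 'M[C]_D) :
  (Q <= V)%MS -> V *m Q = V -> comm_mx Q X -> stablemx V X ->
  \tr (restrictmx V X) = \tr (X *m Q).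
Proof.
move=> QV VQ QX VX.
set b := row_base V; set S := pinvmx b *m b.
have bV : (b :=: V)%MS by exact: eq_row_base.
have Sid m (W : 'M[C]_(m, D)) : (W <= V)%MS -> W *m S = W.
  by move=> WV; rewrite /S mulmxA mulmxKpV // bV.
have bQ : b *m Q = b.
  have /submxP[Z ->] : (b <= V)%MS by rewrite bV.
  by rewrite -mulmxA VQ.
have SQ : S *m Q = S by rewrite /S -mulmxA bQ.
rewrite /conjmx mxtrace_mulC mulmxA -/S.
rewrite mxtrace_mulC -SQ mulmxA mxtrace_mulC mulmxA QX -mulmxA Sid //.
Qed.

Lemma sector_traceE tau X : comm_mx (parity R N) X ->
  sector_trace tau X = ntrace tau X.
Proof.
move=> PX; rewrite /ntrace.
have PXT : comm_mx (parity R N)^T X^T by rewrite /comm_mx -!trmx_mul PX.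
have PPT : (parity R N)^T *m (parity R N)^T = 1%:M by rewrite -trmx_mul parity_sq trmx1.
have two0 : 2 != 0 :> C by rewrite pnatr_eq0.
have aux (e : C) : e * e = 1 ->
  \tr (restrictmx (eigenspace (parity R N)^T e) X^T) / (D%:R / 2) =
  \tr ((1%:M + e *: parity R N) *m X) / D%:R.
  move=> ee; set V := eigenspace _ _.
  rewrite (@trace_restrictmx (2^-1 *: (1%:M + e *: (parity R N)^T))); first last.
  - exact: comm_mx_stable_eigenspace.
  - rewrite /comm_mx -scalemxAl -scalemxAr; congr (_ *: _).
    by rewrite mulmxDl mulmxDr mul1mx mulmx1 -scalemxAl -scalemxAr PXT.
  - have VP : V *m (parity R N)^T = e *: V by apply/eigenspaceP.
    rewrite -scalemxAr mulmxDr mulmx1 -scalemxAr VP scalerA ee scale1r.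
    by rewrite -{1 2}[V]scale1r -scalerDl scalerA mulVf ?scale1r.
  - apply/eigenspaceP; rewrite -scalemxAl scalerA mulrC -scalerA; congr (_ *: _).
    by rewrite mulmxDl mul1mx -scalemxAl PPT scalerDr scalerA ee scale1r addrC.
  rewrite -scalemxAr mxtraceZ -mxtrace_tr trmx_mul trmxK linearD /= linearZ /= trmxK trmx1.
  have n0 := D_neq0; set t := \tr _; field; exact: n0.
case: tau => /=; first by rewrite /sector_weight /= scale0r addr0 mul1mx.
- by rewrite aux ?mulr1.
- by rewrite aux ?mulrNN ?mulr1.
Qed.

Lemma sector_weight_comm tau X : comm_mx (parity R N) X ->
  comm_mx (sector_weight tau) X.
Proof.
by move=> PX; rewrite /comm_mx mulmxDl mulmxDr mul1mx mulmx1 -scalemxAl -scalemxAr PX.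
Qed.

(** In a half sector the weight 1 + e P is twice a projection, hence the square of the Hermitian
    matrix (1 + e P)/sqrt 2. This makes [ntrace] a positive functional. *)
Lemma sector_weight_pos tau : exists B : 'M[C]_D, sector_weight tau = adjmx B *m B.
Proof.
have aux (e : R) : e * e = 1 -> exists B : 'M[C]_D,
    1%:M + e%:C *: parity R N = adjmx B *m B.
  move=> ee; exists ((Num.sqrt 2^-1)%:C *: (1%:M + e%:C *: parity R N)).
  have adjr (r : R) : conjc r%:C = r%:C by rewrite /= oppr0.
  rewrite adjmxZ adjmxD adjmx1 adjmxZ adj_parity !adjr -scalemxAl -scalemxAr scalerA.
  rewrite -rmorphM /= -expr2 sqr_sqrtr ?invr_ge0 //.
  rewrite mulmxDl mul1mx mulmxDr mulmx1 -scalemxAl -scalemxAr parity_sq scalerA.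
  rewrite -[e%:C * e%:C]rmorphM /= ee [1%:C]rmorph1 scale1r (addrC (_ *: parity R N) 1%:M).
  by rewrite -mulr2n -[X in _ = _ *: X]scaler_nat scalerA fmorphV rmorph_nat mulVf ?pnatr_eq0 // scale1r.
case: tau.
- by exists 1%:M; rewrite /sector_weight scale0r addr0 adjmx1 mul1mx.
- by apply: (aux 1); rewrite mulr1.
- have [|B hB] := aux (-1); first by rewrite mulrNN mulr1.
  by exists B; rewrite -hB /sector_weight /= rmorphN rmorph1.
Qed.

Lemma ntrace_adj_mul_ge0 tau X : 0 <= ntrace tau (adjmx X *m X).
Proof.
have [B hB] := sector_weight_pos tau.
rewrite divr_ge0 ?ler0n // hB -mulmxA mxtrace_mulC -!mulmxA mulmxA.
have -> : B *m adjmx X = adjmx (X *m adjmx B) by rewrite adjmxM adjmxK.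
exact: mxtrace_adj_mul_ge0.
Qed.

Lemma adj_sector_weight tau : adjmx (sector_weight tau) = sector_weight tau.
Proof. by have [B ->] := sector_weight_pos tau; rewrite adjmxM adjmxK. Qed.

Lemma ntrace_adj tau X : comm_mx (parity R N) X ->
  ntrace tau (adjmx X) = conjc (ntrace tau X).
Proof.
move=> PX; rewrite /ntrace rmorphM /= -mxtrace_adj fmorphV rmorph_nat.
by rewrite (sector_weight_comm tau PX) adjmxM adj_sector_weight.
Qed.

Lemma ntrace1 tau : (0 < N)%N -> ntrace tau 1%:M = 1.
Proof.
move=> N0; rewrite /ntrace mulmx1 mxtraceD mxtraceZ trace_parity // mulr0 addr0 mxtrace1.
by rewrite divff // D_neq0.
Qed.

Lemma ntrace_Gam2 tau q A B : (2 * q < N)%N -> ~~ odd q -> #|A| = q -> #|B| = q ->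
  ntrace tau (Gam R A *m Gam R B) = (A == B)%:R.
Proof.
move=> qN oq qA qB; have N0 : (0 < N)%N by apply: leq_trans qN.
have [->|AB] := eqVneq A B; first by rewrite Gam_sq ntrace1.
rewrite /ntrace mulmxDl mul1mx -scalemxAl mxtraceD mxtraceZ.
rewrite trace_Gam2 ?qA ?qB // trace_parity_Gam2 ?qA ?qB //; last by rewrite addnn -mul2n.
by rewrite mulr0 addr0 mul0r.
Qed.

(** Positivity of [ntrace] is applied to the difference of [X] and its projection [S] on the span of
    the Gamma_A. That [X] commutes with the parity lets its coefficients be conjugated. *)
Lemma ntrace_bessel tau q X : (2 * q < N)%N -> ~~ odd q -> comm_mx (parity R N) X ->
  \sum_(A in qsubsets N q) `|ntrace tau (Gam R A *m X)| ^+ 2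
    <= ntrace tau (adjmx X *m X).
Proof.
move=> qN oq PX.
pose c A := ntrace tau (Gam R A *m X).
pose S := \sum_(A in qsubsets N q) c A *: Gam R A.
have qq A : A \in qsubsets N q -> #|A| = q by rewrite inE => /eqP.
have := ntrace_adj_mul_ge0 tau (X - S).
have cA A : A \in qsubsets N q -> ntrace tau (adjmx X *m Gam R A) = conjc (c A).
  move=> /qq qA; rewrite -ntrace_adj ?adjmxM ?Gam_adj //.
  by apply: comm_mxM => //; apply: parity_Gam; rewrite qA.
have adjS : adjmx S = \sum_(A in qsubsets N q) conjc (c A) *: Gam R A.
  by rewrite adjmx_sum; apply: eq_bigr => A _; rewrite adjmxZ Gam_adj.
have SX : ntrace tau (adjmx S *m X) = \sum_(A in qsubsets N q) `|c A| ^+ 2.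
  rewrite adjS mulmx_suml ntrace_sum; apply: eq_bigr => A _.
  by rewrite -scalemxAl ntraceZ mulrC sqr_normc.
have XS : ntrace tau (adjmx X *m S) = \sum_(A in qsubsets N q) `|c A| ^+ 2.
  rewrite mulmx_sumr ntrace_sum; apply: eq_bigr => A hA.
  by rewrite -scalemxAr ntraceZ cA // sqr_normc.
have SS : ntrace tau (adjmx S *m S) = \sum_(A in qsubsets N q) `|c A| ^+ 2.
  rewrite adjS mulmx_suml ntrace_sum; apply: eq_bigr => A hA.
  rewrite -scalemxAl ntraceZ mulmx_sumr ntrace_sum (bigD1 A) //= big1 => [|B /andP[hB BA]].
    rewrite addr0 -scalemxAr ntraceZ (ntrace_Gam2 _ qN oq) ?qq // eqxx mulr1 mulrC.
    by rewrite sqr_normc.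
  rewrite -scalemxAr ntraceZ (ntrace_Gam2 _ qN oq) ?qq //.
  by rewrite eq_sym (negPf BA) mulr0.
rewrite -[X - S](addrC) adjmxD mulmxDl !mulmxDr !ntraceD.
have adjN Y : adjmx (- Y) = - adjmx Y by rewrite -scaleN1r adjmxZ rmorphN rmorph1 scaleN1r.
have ntrN Y : ntrace tau (- Y) = - ntrace tau Y by rewrite -scaleN1r ntraceZ mulN1r.
rewrite adjN !mulNmx !mulmxN opprK !ntrN SX XS SS subrr add0r addrC subr_ge0.
by [].
Qed.

End MajoranaAlgebra.

(** * Gaussian integrals on the line *)

Section GaussianIntegral.
Variable R : realType.
Implicit Types (g h : R -> R) (x t : R).
Local Notation mu := (@lebesgue_measure R).

(* At most exponential growth: the class of test functions against [rhoG]. *)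
Definition tame g := measurable_fun setT g /\
  exists C c : R, [/\ 0 <= C, 0 <= c & forall x, `|g x| <= C * expR (c * `|x|)].

Lemma tame_bounded g C : measurable_fun setT g -> (forall x, `|g x| <= C) -> tame g.
Proof.
move=> mg gC; split=> //; exists C, 0; split=> // [|x].
  exact: le_trans (gC 0).
by rewrite mul0r expR0 mulr1.
Qed.

Lemma tame_cst c : tame (fun=> c).
Proof. by apply: (@tame_bounded _ `|c|) => //; exact: measurable_cst. Qed.

Lemma tame_id : tame id.
Proof.
split; first exact: measurable_id.
exists 1, 1; split=> // x; rewrite !mul1r.
by apply: le_trans (expR_ge1Dx _); rewrite lerDr.
Qed.

Lemma tameD g h : tame g -> tame h -> tame (fun x => g x + h x).
Proof.
move=> [mg [C [c [C0 c0 gC]]]] [mh [D [d [D0 d0 hD]]]]; split.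
  exact: measurable_funD.
exists (C + D), (c + d); split; rewrite ?addr_ge0 // => x.
apply: le_trans (ler_normD _ _) _; rewrite mulrDl; apply: lerD.
  apply: le_trans (gC x) _; rewrite ler_wpM2l // ler_expR ler_wpM2r //.
  by rewrite lerDl.
apply: le_trans (hD x) _; rewrite ler_wpM2l // ler_expR ler_wpM2r //.
by rewrite lerDr.
Qed.

Lemma tameM g h : tame g -> tame h -> tame (fun x => g x * h x).
Proof.
move=> [mg [C [c [C0 c0 gC]]]] [mh [D [d [D0 d0 hD]]]]; split.
  exact: measurable_funM.
exists (C * D), (c + d); split; rewrite ?addr_ge0 ?mulr_ge0 // => x.
rewrite normrM mulrDl expRD mulrACA; apply: ler_pM => //.
Qed.

Lemma tameZ c g : tame g -> tame (fun x => c * g x).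
Proof. by apply: tameM; exact: tame_cst. Qed.

Lemma tameN g : tame g -> tame (fun x => - g x).
Proof.
by move=> tg; rewrite (_ : (fun x => - g x) = (fun x => -1 * g x));
  [exact: tameZ | apply/funext => x; rewrite mulN1r].
Qed.

Lemma tameB g h : tame g -> tame h -> tame (fun x => g x - h x).
Proof. by move=> tg /tameN; exact: tameD. Qed.

Lemma tameX n : tame (fun x => x ^+ n).
Proof.
elim: n => [|n IH]; first by under eq_fun do rewrite expr0; exact: tame_cst.
by under eq_fun do rewrite exprS; exact: (tameM tame_id).
Qed.

Lemma tame_poly (p : {poly R}) : tame (fun x => p.[x]).
Proof.
elim/poly_ind: p => [|p c IH].
  by under eq_fun do rewrite horner0; exact: tame_cst.
under eq_fun do rewrite !hornerE.
by apply: tameD (tame_cst c); exact: (tameM IH tame_id).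
Qed.

Lemma rhoGE x : rhoG x = normal_pdf 0 1 x.
Proof.
rewrite normal_pdfE ?oner_neq0 // /normal_peak /normal_fun /rhoG !expr1n mul1r subr0.
by rewrite mulNr mulr_natl.
Qed.

Lemma rhoG_ge0 x : 0 <= rhoG x.
Proof. by rewrite rhoGE normal_pdf_ge0. Qed.

Lemma continuous_rhoG : continuous (@rhoG R).
Proof.
rewrite (_ : @rhoG R = normal_pdf 0 1); last by apply/funext => x; exact: rhoGE.
by apply: continuous_normal_pdf; rewrite oner_neq0.
Qed.

Lemma measurable_rhoG : measurable_fun setT (@rhoG R).
Proof. by apply: continuous_measurable_fun; exact: continuous_rhoG. Qed.

Lemma rhoG_tame_le g : tame g ->
  exists2 K, 0 <= K & forall x, `|rhoG x * g x| <= K * expR (- (x ^+ 2 / 4)).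
Proof.
move=> [_ [C [c [C0 c0 gC]]]].
exists ((Num.sqrt (2 * pi))^-1 * (C * expR (c ^+ 2))).
  by rewrite !mulr_ge0 ?invr_ge0 ?expR_ge0.
move=> x; rewrite normrM (ger0_norm (rhoG_ge0 x)) /rhoG -!mulrA ler_wpM2l ?invr_ge0 //.
apply: le_trans (ler_wpM2l (expR_ge0 _) (gC x)) _.
rewrite mulrCA ler_wpM2l // -!expRD ler_expR.
(* Completing the square: c|x| - x^2/2 <= c^2 - x^2/4. *)
have := sqr_ge0 (c - `|x| / 2); have := real_normK (num_real x); rewrite !expr2.
set y := `|x|; lra.
Qed.

Lemma gauss_integrable g : tame g ->
  mu.-integrable setT (EFin \o (fun x => rhoG x * g x)).
Proof.
move=> tg; have [K K0 hK] := rhoG_tame_le tg.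
have mg : measurable_fun setT (fun x => rhoG x * g x).
  by apply: measurable_funM; [exact: measurable_rhoG | exact: tg.1].
(* The majorant exp(-x^2/4) is a multiple of the Gaussian density of variance 2. *)
set s : R := Num.sqrt 2; have s0 : s != 0 by rewrite sqrtr_eq0 -ltNge.
have int : mu.-integrable setT (EFin \o (fun x => (K / normal_peak s) * normal_pdf 0 s x)).
  have := integrableZl measurableT (K / normal_peak s) (integrable_normal_pdf 0 s).
  by apply: eq_integrable.
apply: (le_integrable _ _ _ int) => //; first exact/measurable_EFinP.
move=> x _ /=; rewrite lee_fin; apply: le_trans (hK x) _.
apply: le_trans (ler_norm _); rewrite normal_pdfE // -mulrA ler_wpM2l // mulKf.
  rewrite ler_expR subr0 mulNr lerN2 sqr_sqrtr // -mulr_natr.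
  by rewrite -natrM.
by rewrite gt_eqF // normal_peak_gt0.
Qed.

Definition gint g : R := \int[mu]_x (rhoG x * g x).

Lemma eq_gint g h : g =1 h -> gint g = gint h.
Proof. by move=> /funext ->. Qed.

Lemma gintD g h : tame g -> tame h -> gint (fun x => g x + h x) = gint g + gint h.
Proof.
move=> tg th; rewrite /gint; under eq_Rintegral do rewrite mulrDr.
by rewrite RintegralD //; exact: gauss_integrable.
Qed.

Lemma gintZ c g : tame g -> gint (fun x => c * g x) = c * gint g.
Proof.
move=> tg; rewrite /gint; under eq_Rintegral do rewrite mulrCA.
by rewrite RintegralZl //; exact: gauss_integrable.
Qed.

Lemma gintN g : tame g -> gint (fun x => - g x) = - gint g.
Proof. by move=> tg; rewrite -mulN1r -gintZ //; apply: eq_gint => x; rewrite mulN1r. Qed.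

Lemma gintB g h : tame g -> tame h -> gint (fun x => g x - h x) = gint g - gint h.
Proof. by move=> tg th; rewrite gintD ?gintN //; exact: tameN. Qed.

Lemma gint_le g h : tame g -> tame h -> (forall x, g x <= h x) -> gint g <= gint h.
Proof.
move=> tg th gh; apply: le_Rintegral => //; try exact: gauss_integrable.
by move=> x _; rewrite ler_wpM2l ?rhoG_ge0.
Qed.

Lemma gint1 : gint (fun=> 1) = 1.
Proof.
rewrite /gint /Rintegral.
under eq_integral => x _ do rewrite mulr1 rhoGE.
by rewrite integral_normal_pdf.
Qed.

Lemma gint_cst c : gint (fun=> c) = c.
Proof.
rewrite -[RHS]mulr1 -gint1 -gintZ; last exact: tame_cst.
by apply: eq_gint => x; rewrite mulr1.
Qed.

Lemma gint_norm_le g C : tame g -> (forall x, `|g x| <= C) -> `|gint g| <= C.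
Proof.
move=> tg gC; rewrite ler_norml -{1}(gint_cst C) -gintN; last exact: tame_cst.
rewrite -{2}(gint_cst C) !gint_le //; try exact: tame_cst;
  try (by apply: tameN; exact: tame_cst);
  by move=> x; have := gC x; rewrite ler_norml => /andP[].
Qed.

Lemma is_derive_exprS n x : is_derive x (1 : R) (fun y : R => y ^+ n.+1) (n.+1%:R * x ^+ n).
Proof.
rewrite (_ : (fun y => y ^+ n.+1) = id ^+ n.+1); last by rewrite exprfctE.
by apply: is_derive_eq; rewrite /GRing.scale /= mulr1.
Qed.

Lemma is_derive_rhoG x : is_derive x 1 (@rhoG R) (- x * rhoG x).
Proof.
rewrite /rhoG; apply: is_derive_eq; rewrite /GRing.scale /=.
by move: (Num.sqrt _)^-1 (expR _) => c e; field.
Qed.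

(** The integral over [-n-1, n+1] is a difference of boundary values, which tends to 0 by the decay
    of [F]; dominated convergence identifies the limit. *)
Lemma integral_derive_eq0 (F f : R -> R) (K : R) :
  (forall x, is_derive x 1 F (f x)) -> continuous f ->
  mu.-integrable setT (EFin \o f) ->
  (forall x, `|F x| <= K * expR (- (x ^+ 2 / 4))) ->
  \int[mu]_x f x = 0.
Proof.
move=> dF cf intf FK.
have ftc (n : nat) : (\int[mu]_(x in `[(- n.+1%:R)%R, n.+1%:R]) (f x)%:E)%E
    = (F n.+1%:R - F (- n.+1%:R))%:E.
  have cF : continuous F by move=> x; apply/differentiable_continuous/derivable1_diffP; exact: (@ex_derive _ _ _ _ _ _ _ (dF x)).
  rewrite EFinB; apply: continuous_FTC2.
  - by rewrite (@lt_le_trans _ _ 0) // oppr_lt0.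
  - by apply: continuous_subspaceT => x; exact: cf.
  - split.
    + by move=> x _; exact: (@ex_derive _ _ _ _ _ _ _ (dF x)).
    + by apply: cvg_at_right_filter; exact: cF.
    + by apply: cvg_at_left_filter; exact: cF.
  - by move=> x _; rewrite derive1E; exact: (@derive_val _ _ _ _ _ _ _ (dF x)).
have lim0 : (F n.+1%:R - F (- n.+1%:R))%:E @[n --> \oo] --> (0 : \bar R)%E.
  apply: cvg_EFin; first by apply: nearW.
  apply/norm_cvg0P; apply: (@squeeze_cvgr _ _ _ _ (fun=> 0) (fun n => 8 * K * n.+1%:R^-1)).
  - apply: nearW => n; rewrite normr_ge0 /=.
    have e4 : expR (- (n.+1%:R ^+ 2 / 4)) <= 4 * n.+1%:R^-1 :> R.
      rewrite expRN -[leRHS]invrK invfM invrK lef_pV2 ?posrE ?expR_gt0 //.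
      apply: le_trans (expR_ge1Dx _).
      have n1 : 1 <= n.+1%:R :> R by rewrite ler1n.
      by rewrite expr2; nra.
    have K0 : 0 <= K.
      by have := le_trans (normr_ge0 _) (FK 0); rewrite pmulr_lge0 // expR_gt0.
    apply: le_trans (ler_normB _ _) _.
    apply: le_trans (lerD (FK _) (FK _)) _; rewrite sqrrN.
    by have := ler_wpM2l K0 e4; move: (expR _) => e; set y := n.+1%:R^-1; lra.
  - exact: cvg_cst.
  - rewrite -[X in _ --> X](mulr0 (8 * K)); apply: cvgMr.
    exact: cvg_harmonic.
have lim1 : (\int[mu]_x ((EFin \o f) \_ (`[(- n.+1%:R)%R, n.+1%:R])) x)%E @[n --> \oo]
    --> (\int[mu]_x (f x)%:E)%E.
  have [] := @dominated_convergence _ _ _ mu setT measurableT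
    (fun n => (EFin \o f) \_ (`[(- n.+1%:R)%R, n.+1%:R]))
    (EFin \o f) (fun x => `|(f x)%:E|%E); last by [].
  - move=> n; apply/(measurable_restrictT _ _).1 => //.
    apply: measurable_funTS; exact: measurable_int intf.
  - exact: measurable_int intf.
  - apply/aeW => x _; apply: cvg_near_cst.
    have := nbhs_infty_ger `|x|; apply: filterS => n xn.
    by rewrite patchE ifT // inE /= in_itv /= -ler_norml (le_trans xn) // ler_nat.
  - exact: integrable_abse.
  - apply/aeW => x n _; rewrite patchE; case: ifPn => // _.
    by rewrite -[point]/(0%E : \bar R) abse0 abse_ge0.
have : (\int[mu]_x (f x)%:E)%E = 0%E.
  apply: (cvg_unique _ lim1); first exact: ereal_hausdorff.
  apply: cvg_trans lim0; apply: near_eq_cvg; apply: nearW => n.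
  by rewrite -ftc integral_mkcond.
by rewrite /Rintegral => ->.
Qed.

(** Stein's identity: (g' - x g) rhoG is the derivative of g rhoG and has integral 0. *)
Lemma gint_ibp g g' : (forall x, is_derive x 1 g (g' x)) -> continuous g' ->
  tame g -> tame g' -> gint (fun x => x * g x) = gint g'.
Proof.
move=> dg cg' tg tg'.
have txg : tame (fun x => x * g x) by exact: tameM tame_id _.
have [K K0 hK] := rhoG_tame_le tg.
have cg x : {for x, continuous g}.
  by apply/differentiable_continuous/derivable1_diffP; exact: (@ex_derive _ _ _ _ _ _ _ (dg x)).
apply/eqP; rewrite eq_sym -subr_eq0 -gintB //; apply/eqP.
apply: (@integral_derive_eq0 (fun x => rhoG x * g x) _ K) => //.
- move=> x; have dr := is_derive_rhoG x; have dgx := dg x.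
  by apply: is_derive_eq; rewrite /GRing.scale /=; ring.
- move=> x; apply: cvgM; first exact: continuous_rhoG.
  apply: cvgB; first exact: cg'.
  by apply: cvgM; [exact: cvg_id | exact: cg].
- by apply: gauss_integrable; exact: tameB.
Qed.

Lemma gint_odd_moment : gint id = 0.
Proof.
have E : gint (fun x => x * 1) = gint (fun=> 0).
  apply: (@gint_ibp (fun=> 1) (fun=> 0)); try exact: tame_cst.
  by move=> x; exact: cvg_cst.
by rewrite (gint_cst 0) in E; rewrite -E; apply: eq_gint => x; rewrite mulr1.
Qed.

Lemma gint_expX n : gint (fun x => x ^+ n.+2) = n.+1%:R * gint (fun x => x ^+ n).
Proof.
rewrite -gintZ; last exact: tameX.
have E : gint (fun x => x * x ^+ n.+1) = gint (fun x => n.+1%:R * x ^+ n).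
  apply: (@gint_ibp (fun x => x ^+ n.+1)); last 2 first.
  - exact: tameX.
  - by apply: tameZ; exact: tameX.
  - by move=> x; exact: is_derive_exprS.
  - move=> x; apply: cvgMr; exact: exprn_continuous.
by rewrite -E; apply: eq_gint => x; rewrite -exprS.
Qed.

End GaussianIntegral.

(** * The Stieltjes transform of the Gaussian *)

Section ComplexDerivative.
Variable K : numFieldType.
Implicit Types (f g : K -> K) (z d C r : K) (U : set K).

Lemma linear_derive f z d :
  (forall e, 0 < e -> exists2 r, 0 < r & forall h, `|h| < r ->
    `|f (h + z) - f z - h * d| <= e * `|h|) ->
  derivable f z 1 /\ nderive 1 f z = d.
Proof.
move=> H.
have L : h^-1 *: ((f \o shift z) (h *: 1) - f z) @[h --> 0^'] --> d.
  apply/cvgrPdist_le => e e0; rewrite near_withinE; apply/nbhs_normP.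
  have [r r0 Hr] := H e e0; exists r => // h; rewrite /ball_ /= sub0r normrN => hr h0.
  rewrite /shift /= /GRing.scale /= mulr1.
  have -> : d - h^-1 * (f (h + z) - f z) = - h^-1 * (f (h + z) - f z - h * d).
    by field.
  by rewrite normrM normrN normfV mulrC ler_pdivrMr ?normr_gt0 // Hr.
split; first by apply/cvg_ex; exists d.
by rewrite /nderive derive1n1 derive1E; apply/cvg_lim.
Qed.

Lemma quadratic_derive f z d C r : 0 < r -> 0 <= C ->
  (forall h, `|h| < r -> `|f (h + z) - f z - h * d| <= C * `|h| ^+ 2) ->
  derivable f z 1 /\ nderive 1 f z = d.
Proof.
move=> r0 C0 H; apply: linear_derive => e e0.
have C1 : 0 < C + 1 by rewrite ltr_wpDl.
pose s := if e / (C + 1) <= r then e / (C + 1) else r.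
have sr : s <= r by rewrite /s; case: ifP.
have se : s <= e / (C + 1).
  rewrite /s; case: ifP => // /negbT.
  by rewrite -real_ltNge ?gtr0_real ?divr_gt0 // => /ltW.
have s0 : 0 < s by rewrite /s; case: ifP; rewrite ?divr_gt0.
exists s => // h hs; apply: le_trans (H h (lt_le_trans hs sr)) _.
rewrite expr2 mulrA ler_wpM2r //.
apply: le_trans (ler_wpM2l C0 (le_trans (ltW hs) se)) _.
by rewrite mulrCA ler_piMr ?(ltW e0) // ler_pdivrMr // mul1r lerDl.
Qed.

Lemma derivable_linear f z : derivable f z 1 -> forall e, 0 < e ->
  exists2 r, 0 < r & forall h, `|h| < r ->
    `|f (h + z) - f z - h * nderive 1 f z| <= e * `|h|.
Proof.
move=> df e e0.
have L : h^-1 *: ((f \o shift z) (h *: 1) - f z) @[h --> 0^'] --> nderive 1 f z.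
  rewrite /nderive derive1n1 derive1E; exact: df.
move/cvgrPdist_le: L => /(_ e e0); rewrite near_withinE => /nbhs_normP[r /= r0 H].
exists r => // h hr; have [->|h0] := eqVneq h 0.
  by rewrite add0r subrr mul0r subr0 normr0 mulr0.
have := H h; rewrite /ball_ /= sub0r normrN => /(_ hr h0).
rewrite /shift /= /GRing.scale /= mulr1.
have -> : nderive 1 f z - h^-1 * (f (h + z) - f z) =
    - h^-1 * (f (h + z) - f z - h * nderive 1 f z) by field.
by rewrite normrM normrN normfV mulrC ler_pdivrMr ?normr_gt0.
Qed.

Definition norm_open U := forall z, U z ->
  exists2 r, 0 < r & forall h, `|h| < r -> U (h + z).

(** No differentiability is assumed: [nderive] is the value of a limit operator, which only sees the
    function near the point. *)
Lemma eq_nderive k f g U : norm_open U -> (forall z, U z -> f z = g z) ->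
  forall z, U z -> nderive k f z = nderive k g z.
Proof.
move=> oU fg; elim: k => //= k IH z Uz.
rewrite -![(_^`()%classic) z]/(lim _); congr (lim _).
have [r r0 H] := oU z Uz.
apply/seteqP; split; apply: near_eq_cvg; rewrite near_withinE;
  apply/nbhs_normP; exists r => // h hr _.
  all: have {}hr : `|h| < r by move: hr; rewrite /ball_ /= sub0r normrN.
  - by congr (_ *: (_ - _)); [exact: IH (H _ hr) | exact: IH].
  - by congr (_ *: (_ - _)); apply: esym; [exact: IH (H _ hr) | exact: IH].
Qed.

Lemma eq_derivable f g U : norm_open U -> (forall z, U z -> f z = g z) ->
  forall z, U z -> derivable f z 1 -> derivable g z 1.
Proof.
move=> oU fg z Uz df; have [r r0 H] := oU z Uz.
suff [] : derivable g z 1 /\ nderive 1 g z = nderive 1 f z by [].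
apply: linear_derive => e e0.
have [r' r'0 H'] := derivable_linear df e0.
pose s := if r <= r' then r else r'.
have s0 : 0 < s by rewrite /s; case: ifP.
have sr : s <= r' by rewrite /s; case: ifP.
have sr' : s <= r.
  by rewrite /s; case: ifP => // /negbT; rewrite -real_ltNge ?gtr0_real // => /ltW.
exists s => // h hs; rewrite -!fg //; last exact: H (lt_le_trans hs sr').
exact: H' (lt_le_trans hs sr).
Qed.

Definition has_derivative f z d := derivable f z 1 /\ nderive 1 f z = d.

Lemma has_derivativeP f z d : has_derivative f z d <-> is_derive z (1 : K) f d.
Proof.
rewrite /has_derivative /nderive derive1n1 derive1E.
by split => [[df dE]|[df dE]]; [split | split].
Qed.

Lemma has_derivativeD f g z a b : has_derivative f z a -> has_derivative g z b ->
  has_derivative (fun w => f w + g w) z (a + b).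
Proof. by move=> /has_derivativeP df /has_derivativeP dg; apply/has_derivativeP; apply: is_derive_eq. Qed.

Lemma has_derivativeM f g z a b : has_derivative f z a -> has_derivative g z b ->
  has_derivative (fun w => f w * g w) z (f z * b + g z * a).
Proof. by move=> /has_derivativeP df /has_derivativeP dg; apply/has_derivativeP; apply: is_derive_eq. Qed.

Lemma has_derivative_cst c z : has_derivative (fun=> c) z 0.
Proof. by apply/has_derivativeP; apply: is_derive_eq. Qed.

Lemma has_derivative_id z : has_derivative id z 1.
Proof. by apply/has_derivativeP; apply: is_derive_eq. Qed.

Lemma has_derivativeZ c f z a : has_derivative f z a ->
  has_derivative (fun w => c * f w) z (c * a).
Proof.
move=> df; have := has_derivativeM (has_derivative_cst c z) df.
by rewrite mulr0 addr0.
Qed.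

Lemma has_derivative_sum n (F : nat -> K -> K) (D : nat -> K) z :
  (forall k, has_derivative (F k) z (D k)) ->
  has_derivative (fun w => \sum_(k < n) F k w) z (\sum_(k < n) D k).
Proof.
move=> FD; elim: n => [|n IH].
  rewrite big_ord0; under eq_fun do rewrite big_ord0.
  exact: has_derivative_cst.
rewrite big_ord_recr /=; under eq_fun do rewrite big_ord_recr /=.
exact: has_derivativeD.
Qed.

Lemma eq_has_derivative f g U z d : norm_open U -> (forall z, U z -> f z = g z) ->
  U z -> has_derivative f z d -> has_derivative g z d.
Proof.
move=> oU fg Uz [df <-]; split; first exact: eq_derivable oU fg z Uz df.
by apply: esym; apply: eq_nderive oU fg z Uz.
Qed.

Lemma nderiveSr k f z : nderive k.+1 f z = nderive 1 (nderive k f) z.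
Proof. by []. Qed.

(** The linear functional on polynomials that sends X^k to [mu k]. With the derivatives of m as [mu]
    it applies a differential operator to m; with moments it takes an expectation. *)
Definition pairing (mu : nat -> K) (p : {poly K}) : K := \sum_(k < size p) p`_k * mu k.

Lemma pairingE n mu (p : {poly K}) : (size p <= n)%N ->
  pairing mu p = \sum_(k < n) p`_k * mu k.
Proof.
move=> pn; rewrite /pairing (big_ord_widen _ (fun k => p`_k * mu k) pn) big_mkcond.
apply: eq_bigr => k _; case: ifPn => //; rewrite -leqNgt => pk.
by rewrite nth_default // mul0r.
Qed.

Lemma pairingD mu (p q : {poly K}) : pairing mu (p + q) = pairing mu p + pairing mu q.
Proof.
set n := maxn (size p) (size q).
rewrite !(@pairingE n) ?leq_maxl ?leq_maxr ?size_polyD // -big_split /=.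
by apply: eq_bigr => k _; rewrite coefD mulrDl.
Qed.

Lemma pairingZ mu c (p : {poly K}) : pairing mu (c *: p) = c * pairing mu p.
Proof.
rewrite !(@pairingE (size p)) ?size_scale_leq // mulr_sumr.
by apply: eq_bigr => k _; rewrite coefZ mulrA.
Qed.

Lemma pairing0 mu : pairing mu 0 = 0.
Proof. by rewrite /pairing size_poly0 big_ord0. Qed.

Lemma pairing_sum mu (I : Type) (r : seq I) (F : I -> {poly K}) :
  pairing mu (\sum_(i <- r) F i) = \sum_(i <- r) pairing mu (F i).
Proof. exact: (big_morph _ (pairingD mu) (pairing0 mu)). Qed.

Lemma pairingXn mu n : pairing mu 'X^n = mu n.
Proof.
rewrite (@pairingE n.+1) ?size_polyXn // big_ord_recr /= coefXn eqxx mul1r big1 ?add0r //.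
by move=> i _; rewrite coefXn ltn_eqF ?mul0r.
Qed.

Lemma poly_sum_coef (p : {poly K}) : p = \sum_(k < size p) p`_k *: 'X^k.
Proof. by rewrite -poly_def coefK. Qed.

Lemma pairingMXn mu n (p : {poly K}) : pairing mu ('X^n * p) = pairing (fun k => mu (n + k)%N) p.
Proof.
rewrite {1}(poly_sum_coef p) mulr_sumr pairing_sum [RHS]/pairing; apply: eq_bigr => k _.
by rewrite -(scalerAr _ 'X^n) pairingZ -exprD pairingXn.
Qed.

Lemma pairingMX mu (p : {poly K}) : pairing mu ('X * p) = pairing (fun k => mu k.+1) p.
Proof. by have := pairingMXn mu 1 p; rewrite expr1. Qed.

End ComplexDerivative.

(** * Integrals of powers of the resolvent against the Gaussian *)

Section Stieltjes.
Local Open Scope complex_scope.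
Local Open Scope ring_scope.
Variable R : realType.
Local Notation C := R[i].
Local Notation Re := complex.Re.
Local Notation Im := complex.Im.
Implicit Types (g h : R -> C) (z : C) (x : R).

Lemma normc_le_ReIm (z : C) : `|z| <= (`|Re z| + `|Im z|)%:C.
Proof.
rewrite normc_def lecR -[leRHS]ger0_norm ?addr_ge0 // -sqrtr_sqr ler_wsqrtr //.
rewrite sqrrD !real_normK ?num_real // -addrA [X in _ <= _ + X]addrC addrA lerDl.
by rewrite mulrn_wge0 // mulr_ge0.
Qed.

Lemma normc_ge_Im (z : C) : `|Im z|%:C <= `|z|.
Proof. by rewrite normc_def lecR -sqrtr_sqr ler_wsqrtr // lerDr sqr_ge0. Qed.

Definition ctame g := tame (fun x => Re (g x)) /\ tame (fun x => Im (g x)).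

Definition cgint g : C := Cintegral (fun x => (rhoG x)%:C * g x).

Lemma cgintE g : cgint g = (gint (fun x => Re (g x))) +i* (gint (fun x => Im (g x))).
Proof.
rewrite /cgint /Cintegral /gint; congr (_ +i* _); apply: eq_Rintegral => x _;
  by case: (g x) => a b /=; rewrite !mul0r ?subr0 ?addr0.
Qed.

Lemma eq_cgint g h : g =1 h -> cgint g = cgint h.
Proof. by move=> /funext ->. Qed.

Lemma ctameD g h : ctame g -> ctame h -> ctame (fun x => g x + h x).
Proof.
by move=> [g1 g2] [h1 h2]; split; [have := tameD g1 h1 | have := tameD g2 h2];
  congr tame; apply/funext => x; case: (g x) (h x) => ? ? [].
Qed.

Lemma ctameM g h : ctame g -> ctame h -> ctame (fun x => g x * h x).
Proof.
move=> [g1 g2] [h1 h2]; split.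
  have := tameB (tameM g1 h1) (tameM g2 h2).
  by congr tame; apply/funext => x; case: (g x) (h x) => ? ? [].
have := tameD (tameM g1 h2) (tameM g2 h1).
by congr tame; apply/funext => x; case: (g x) (h x) => ? ? [].
Qed.

Lemma ctame_cst (c : C) : ctame (fun=> c).
Proof. by split; exact: tame_cst. Qed.

Lemma ctameZ c g : ctame g -> ctame (fun x => c * g x).
Proof. by apply: ctameM; exact: ctame_cst. Qed.

Lemma ctameB g h : ctame g -> ctame h -> ctame (fun x => g x - h x).
Proof.
move=> tg th; rewrite (_ : (fun x => _) = (fun x => g x + -1 * h x)).
  by apply: ctameD => //; exact: ctameZ.
by apply/funext => x; rewrite mulN1r.
Qed.

Lemma ctameX g n : ctame g -> ctame (fun x => g x ^+ n).
Proof.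
move=> tg; elim: n => [|n IH]; first by under eq_fun do rewrite expr0; exact: ctame_cst.
by under eq_fun do rewrite exprS; exact: ctameM.
Qed.

Lemma cgintD g h : ctame g -> ctame h -> cgint (fun x => g x + h x) = cgint g + cgint h.
Proof.
move=> [g1 g2] [h1 h2]; rewrite !cgintE; apply/eqP; rewrite eq_complex /=.
rewrite -!gintD //; apply/andP; split; apply/eqP; apply: eq_gint => x;
  by case: (g x) (h x) => ? ? [].
Qed.

Lemma cgintZ c g : ctame g -> cgint (fun x => c * g x) = c * cgint g.
Proof.
move=> [g1 g2]; rewrite !cgintE; case: c => a b; apply/eqP; rewrite eq_complex /=.
rewrite -!gintZ // -?gintB -?gintD //; try exact: tameZ.
by apply/andP; split; apply/eqP; apply: eq_gint => x; case: (g x).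
Qed.

Lemma cgintB g h : ctame g -> ctame h -> cgint (fun x => g x - h x) = cgint g - cgint h.
Proof.
move=> tg th; rewrite -mulN1r -cgintZ // -cgintD //.
  by apply: eq_cgint => x; rewrite mulN1r.
exact: ctameM (ctame_cst _) _.
Qed.

Lemma cgint1 : cgint (fun=> 1) = 1.
Proof. by rewrite cgintE /= gint1 gint_cst. Qed.

(** The factor 2 comes from bounding the real and the imaginary part separately. *)
Lemma cgint_norm_le g (B : R) : ctame g -> (forall x, `|g x| <= B%:C) ->
  `|cgint g| <= (2 * B)%:C.
Proof.
move=> [g1 g2] gB; apply: le_trans (normc_le_ReIm _) _; rewrite cgintE /=.
rewrite lecR mulr_natl mulr2n lerD // gint_norm_le // => x; rewrite -lecR.
  exact: le_trans (normc_ge_Re _) (gB x).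
exact: le_trans (normc_ge_Im _) (gB x).
Qed.

Definition resolvent z x : C := (x%:C - z)^-1.

Lemma resolvent_neq0 z x : upper_half z -> x%:C - z != 0.
Proof.
case: z => a b z0; rewrite eq_complex /= negb_and; apply/orP; right.
by rewrite sub0r oppr_eq0 gt_eqF.
Qed.

Lemma resolvent_norm_le z x : upper_half z -> `|resolvent z x| <= ((Im z)^-1)%:C.
Proof.
move=> z0; rewrite /resolvent normfV fmorphV /= lef_pV2 ?posrE ?normr_gt0 ?resolvent_neq0 //.
  apply: le_trans (normc_ge_Im _); rewrite lecR; case: z z0 => a b /= z0.
  by rewrite sub0r normrN ler_norm.
by rewrite ltcR.
Qed.

Definition resolvent_den z x : R := (x - Re z) ^+ 2 + Im z ^+ 2.

Lemma resolvent_den_neq0 z x : upper_half z -> resolvent_den z x != 0.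
Proof. by move=> z0; rewrite gt_eqF // ltr_wpDl ?sqr_ge0 // exprn_gt0. Qed.

Lemma resolventE z x :
  resolvent z x = ((x - Re z) / resolvent_den z x) +i* (Im z / resolvent_den z x).
Proof.
rewrite /resolvent /resolvent_den; case: z => a b /=.
by rewrite /GRing.inv /= sub0r sqrrN mulNr opprK.
Qed.

Lemma is_derive_Re_resolvent z x : upper_half z ->
  is_derive x (1 : R) (fun y => Re (resolvent z y)) (- Re (resolvent z x ^+ 2)).
Proof.
move=> z0; have n0 := resolvent_den_neq0 x z0.
under eq_fun do rewrite resolventE /=.
rewrite resolventE /resolvent_den /=; apply: is_derive_eq.
rewrite /GRing.scale /=; move: n0; rewrite /resolvent_den => n0.
by field.
Qed.

Lemma is_derive_Im_resolvent z x : upper_half z ->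
  is_derive x (1 : R) (fun y => Im (resolvent z y)) (- Im (resolvent z x ^+ 2)).
Proof.
move=> z0; have n0 := resolvent_den_neq0 x z0.
under eq_fun do rewrite resolventE /=.
rewrite resolventE /resolvent_den /=; apply: is_derive_eq.
rewrite /GRing.scale /=; move: n0; rewrite /resolvent_den => n0.
by field.
Qed.

Lemma tame_Re_resolvent z : upper_half z -> ctame (resolvent z).
Proof.
move=> z0.
have cont (f f' : R -> R) : (forall x, is_derive x (1 : R) f (f' x)) -> measurable_fun setT f.
  move=> df; apply: continuous_measurable_fun => x.
  by apply/differentiable_continuous/derivable1_diffP; exact: (@ex_derive _ _ _ _ _ _ _ (df x)).
split; apply: (@tame_bounded _ _ (Im z)^-1).
- by apply: cont => x; exact: is_derive_Re_resolvent.
- by move=> x; rewrite -lecR; exact: le_trans (normc_ge_Re _) (resolvent_norm_le _ _).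
- by apply: cont => x; exact: is_derive_Im_resolvent.
- by move=> x; rewrite -lecR; exact: le_trans (normc_ge_Im _) (resolvent_norm_le _ _).
Qed.

Definition stieltjes_pow k z : C := cgint (fun x => resolvent z x ^+ k.+1).

Lemma stieltjes_pow0 z : stieltjes_rhoG z = stieltjes_pow 0 z.
Proof. by rewrite /stieltjes_pow; under eq_cgint do rewrite expr1. Qed.

(** The equation m' + z m = -1. Stein's identity turns the integral of x/(x - z) into minus that of
    1/(x - z)^2, and x/(x - z) = 1 + z/(x - z). *)
Lemma stieltjes_ode z : upper_half z ->
  stieltjes_pow 1 z + z * stieltjes_pow 0 z = -1.
Proof.
move=> z0; have tr := tame_Re_resolvent z0; have tr2 := ctameX 2 tr.
have tx : ctame (fun x => x%:C) by split; [exact: tame_id | exact: tame_cst].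
have cont (h : R -> C) (h' : R -> C) : (forall x, is_derive x (1 : R) (fun y => Re (h y)) (Re (h' x))) ->
    (forall x, is_derive x (1 : R) (fun y => Im (h y)) (Im (h' x))) -> 
    continuous (fun x => Re (h x)) /\ continuous (fun x => Im (h x)).
  by move=> d1 d2; split => x; apply/differentiable_continuous/derivable1_diffP;
    [exact: (@ex_derive _ _ _ _ _ _ _ (d1 x)) | exact: (@ex_derive _ _ _ _ _ _ _ (d2 x))].
have [c1 c2] : continuous (fun x => Re (resolvent z x)) /\ continuous (fun x => Im (resolvent z x)).
  apply: (cont _ (fun x => - resolvent z x ^+ 2)) => x.
    by have := is_derive_Re_resolvent x z0; case: (_ ^+ 2).
  by have := is_derive_Im_resolvent x z0; case: (_ ^+ 2).
have E : cgint (fun x => x%:C * resolvent z x) = - cgint (fun x => resolvent z x ^+ 2).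
  have [tr21 tr22] := tr2; rewrite !cgintE; apply/eqP; rewrite eq_complex /= -!gintN //.
  apply/andP; split; apply/eqP.
    transitivity (gint (fun x => x * Re (resolvent z x))).
      by apply: eq_gint => x; case: (resolvent z x) => a b /=; rewrite mul0r subr0.
    apply: gint_ibp.
    - by move=> x; exact: is_derive_Re_resolvent.
    - move=> x; rewrite (_ : (fun y => _) = (fun y => - (Re (resolvent z y) * Re (resolvent z y) -
        Im (resolvent z y) * Im (resolvent z y)))); last first.
        by apply/funext => y; case: (resolvent z y).
      by apply: cvgN; apply: cvgB; apply: cvgM; [exact: c1|exact: c1|exact: c2|exact: c2].
    - exact: tr.1.
    - by apply: tameN; exact: tr2.1.
  transitivity (gint (fun x => x * Im (resolvent z x))).
    by apply: eq_gint => x; case: (resolvent z x) => a b /=; rewrite mul0r addr0.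
  apply: gint_ibp.
  - by move=> x; exact: is_derive_Im_resolvent.
  - move=> x; rewrite (_ : (fun y => _) = (fun y => - (Re (resolvent z y) * Im (resolvent z y) +
      Im (resolvent z y) * Re (resolvent z y)))); last first.
      by apply/funext => y; case: (resolvent z y).
    by apply: cvgN; apply: cvgD; apply: cvgM; [exact: c1|exact: c2|exact: c2|exact: c1].
  - exact: tr.2.
  - by apply: tameN; exact: tr2.2.
rewrite /stieltjes_pow -[X in X + _]opprK -E -cgintZ.
  rewrite addrC -cgintB; last exact: ctameM; last first.
    exact: ctameM (ctame_cst _) (ctameX 1 tr).
  transitivity (cgint (fun=> -1 * 1)); last first.
    by rewrite cgintZ ?cgint1 ?mulr1 //; exact: ctame_cst.
  apply: eq_cgint => x; have n0 := resolvent_neq0 x z0.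
  by rewrite expr1 mulr1 /resolvent; field.
exact: ctameX.
Qed.

Lemma stieltjes_pow_norm_le k z : upper_half z ->
  `|stieltjes_pow k z| <= (2 * (Im z)^-1 ^+ k.+1)%:C.
Proof.
move=> z0; apply: cgint_norm_le; first by apply: ctameX; exact: tame_Re_resolvent.
by move=> x; rewrite normrX rmorphXn lerXn2r ?nnegrE ?normr_ge0 ?resolvent_norm_le //
  lecR invr_ge0 ltW.
Qed.

Lemma ball_upper_half z : upper_half z -> forall h : C, `|h| < (Im z / 2)%:C ->
  Im z / 2 <= Im (h + z).
Proof.
move=> z0 h hz; have : `|Im h|%:C < (Im z / 2)%:C by apply: le_lt_trans (normc_ge_Im _) hz.
by rewrite ltcR ltr_norml raddfD /= => /andP[? _]; lra.
Qed.

Lemma norm_open_upper_half : norm_open (@upper_half R).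
Proof.
move=> z z0; have z0' : 0 < Im z by [].
exists (Im z / 2)%:C; first by rewrite ltcR divr_gt0.
move=> h hz; apply: lt_le_trans (ball_upper_half z0 hz).
by rewrite divr_gt0.
Qed.

(** Here [s] and [r] are the resolvents at z + h and z, and the hypothesis is the resolvent
    identity. The constant k^2 is crude but inductive: k^2 + k + 1 <= (k + 1)^2. *)
Lemma resolvent_pow_taylor (r s h : C) (B : C) k : s - r = h * r * s ->
  `|r| <= B -> `|s| <= B ->
  `|s ^+ k - r ^+ k - h * (k%:R * r ^+ k.+1)| <= (k ^ 2)%:R * B ^+ k.+2 * `|h| ^+ 2.
Proof.
move=> sr rB sB; have B0 : 0 <= B by apply: le_trans rB.
elim: k => [|k IH].
  by rewrite !expr0 mul0r mulr0 subrr subr0 normr0 !mul0r.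
have -> : s ^+ k.+1 - r ^+ k.+1 - h * (k.+1%:R * r ^+ k.+2) =
   s * (s ^+ k - r ^+ k - h * (k%:R * r ^+ k.+1)) +
   (h ^+ 2 * (r ^+ k.+2 * s) + k%:R * (h ^+ 2 * (r ^+ k.+2 * s))).
  rewrite -natr1 !exprS; move: (s ^+ k) (r ^+ k) (k%:R) => sk rk c.
  apply/eqP; rewrite -subr_eq0; apply/eqP.
  transitivity ((rk * (1 + h * r) + c * h * r * rk) * (s - r - h * r * s)); first by ring.
  by rewrite sr subrr mulr0.
apply: le_trans (ler_normD _ _) _; rewrite normrM.
have P : `|h ^+ 2 * (r ^+ k.+2 * s)| <= B ^+ k.+3 * `|h| ^+ 2.
  rewrite normrM [`|_ * s|]normrM !normrX mulrC ler_wpM2r ?exprn_ge0 // [B ^+ k.+3]exprSr ler_pM ?exprn_ge0 //.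
  by rewrite lerXn2r ?nnegrE.
apply: le_trans (lerD (ler_pM _ _ sB IH) (ler_normD _ _)) _ => //.
rewrite [X in _ + (_ + X)]normrM normr_nat.
apply: le_trans (lerD (lexx _) (lerD P (ler_wpM2l (ler0n _ k) P))) _.
have H : (k ^ 2)%:R + (1 + k%:R) <= (k.+1 ^ 2)%:R :> C.
  by rewrite -[1]/(1%:R) -!natrD ler_nat -!mulnn; nia.
rewrite -[leRHS]mulrA; apply: le_trans (ler_wpM2r _ H).
  by rewrite le_eqVlt; apply/orP; left; apply/eqP; rewrite (exprS B k.+2); ring.
by rewrite mulr_ge0 ?exprn_ge0.
Qed.

Lemma normcR z : exists2 b : R, 0 <= b & `|z| = b%:C.
Proof. by rewrite normc_def; eexists; last reflexivity; exact: sqrtr_ge0. Qed.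

Definition gauss_stieltjes k z : C := k`!%:R * stieltjes_pow k z.

(** For |h| < Im z / 2 both resolvents are at most 2 / Im z, uniformly in x, so the quadratic
    remainder can be integrated and no interchange of limits is needed. *)
Lemma has_derivative_stieltjes k z : upper_half z ->
  has_derivative (gauss_stieltjes k) z (gauss_stieltjes k.+1 z).
Proof.
move=> z0; have z0' : 0 < Im z by [].
rewrite /gauss_stieltjes factS natrM -mulrA mulrCA; apply: has_derivativeZ.
pose B := 2 / Im z; have B0 : 0 <= B by rewrite divr_ge0 // ltW.
apply: (@quadratic_derive _ _ _ _ ((2 * ((k.+1 ^ 2)%:R * B ^+ k.+3))%:C) (Im z / 2)%:C).
- by rewrite ltcR divr_gt0.
- have : 0 <= 2 * ((k.+1 ^ 2)%:R * B ^+ k.+3) by rewrite mulr_ge0 // mulr_ge0 // exprn_ge0.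
  by rewrite -lecR.
move=> h hz; have hz2 := ball_upper_half z0 hz.
have hz0 : upper_half (h + z) by apply: lt_le_trans hz2; rewrite divr_gt0.
have t1 := ctameX k.+1 (tame_Re_resolvent hz0).
have t2 := ctameX k.+1 (tame_Re_resolvent z0).
have t3 := ctameX k.+2 (tame_Re_resolvent z0).
have [b b0 hb] := normcR h.
have -> : stieltjes_pow k (h + z) - stieltjes_pow k z - h * (k.+1%:R * stieltjes_pow k.+1 z) =
    cgint (fun x => resolvent (h + z) x ^+ k.+1 - resolvent z x ^+ k.+1
             - h * (k.+1%:R * resolvent z x ^+ k.+2)).
  rewrite cgintB; [|exact: ctameB|by do 2 apply: ctameZ].
  by rewrite cgintB // cgintZ; [rewrite cgintZ|exact: ctameZ].
rewrite hb -rmorphXn -rmorphM /= -mulrA; apply: cgint_norm_le.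
  by apply: ctameB; [exact: ctameB | do 2 apply: ctameZ].
move=> x; have n1 := resolvent_neq0 x z0; have n2 := resolvent_neq0 x hz0.
rewrite rmorphM rmorphXn rmorphM rmorph_nat rmorphXn /= -hb; apply: resolvent_pow_taylor.
- rewrite /resolvent; field; rewrite ?n1 ?n2 //.
- apply: le_trans (resolvent_norm_le _ z0) _; rewrite lecR /B -[leLHS]mul1r.
  by rewrite ler_wpM2r ?ler1n // invr_ge0 ltW.
- apply: le_trans (resolvent_norm_le _ hz0) _; rewrite lecR /B.
  by rewrite -[leRHS]invrK invf_div lef_pV2 ?posrE // divr_gt0.
Qed.

Lemma nderive_stieltjes k z : upper_half z ->
  nderive k (@stieltjes_rhoG R) z = gauss_stieltjes k z.
Proof.
elim: k z => [|k IH] z z0.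
  by rewrite /nderive /= stieltjes_pow0 /gauss_stieltjes fact0 mul1r.
rewrite nderiveSr; have [_ <-] := has_derivative_stieltjes k z0.
exact: eq_nderive norm_open_upper_half IH _ z0.
Qed.

(** This is m' + z m = -1 differentiated k times. *)
Lemma gauss_stieltjes_rec k z : upper_half z ->
  gauss_stieltjes k.+1 z + z * gauss_stieltjes k z + k%:R * gauss_stieltjes k.-1 z
    = - (k == 0%N)%:R.
Proof.
elim: k z => [|k IH] z z0.
  by rewrite mul0r addr0 /gauss_stieltjes !mul1r; exact: stieltjes_ode.
(* At k = 0 the last summand has coefficient 0, and since [0.-1] is 0 its derivative is
   [gauss_stieltjes 1]; hence the case distinction. *)
have d1 := has_derivativeD (has_derivativeD (has_derivative_stieltjes k.+1 z0)
  (has_derivativeM (has_derivative_id z) (has_derivative_stieltjes k z0)))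
  (has_derivativeZ k%:R (_ : has_derivative (gauss_stieltjes k.-1) z (if k is _.+1 then gauss_stieltjes k z else gauss_stieltjes 1 z))).
have /d1 {d1} [_ d1] : has_derivative (gauss_stieltjes k.-1) z
    (if k is _.+1 then gauss_stieltjes k z else gauss_stieltjes 1 z).
  by case: (k) => [|m]; exact: has_derivative_stieltjes.
have := eq_nderive 1 norm_open_upper_half IH z0; rewrite d1.
have [_ ->] := has_derivative_cst (- (k == 0%N)%:R) z.
rewrite /= oppr0 mulr1 => <-; rewrite -natr1.
by case: (k) => [|m]; ring.
Qed.

Definition stieltjes_poly (p : {poly C}) z : C := pairing (gauss_stieltjes^~ z) p.

Lemma has_derivative_stieltjes_poly (p : {poly C}) z : upper_half z ->
  has_derivative (stieltjes_poly p) z (stieltjes_poly ('X * p) z).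
Proof.
move=> z0.
have -> : stieltjes_poly ('X * p) z = pairing (fun k => gauss_stieltjes k.+1 z) p.
  exact: pairingMX.
apply: (@has_derivative_sum _ (size p) (fun k w => p`_k * gauss_stieltjes k w)
  (fun k => p`_k * gauss_stieltjes k.+1 z)) => k.
by apply: has_derivativeZ; exact: has_derivative_stieltjes.
Qed.

Lemma nderive_stieltjes_poly k (p : {poly C}) z : upper_half z ->
  nderive k (stieltjes_poly p) z = stieltjes_poly ('X^k * p) z.
Proof.
elim: k z => [|k IH] z z0; first by rewrite expr0 mul1r.
rewrite nderiveSr (eq_nderive 1 norm_open_upper_half IH z0).
have [_ ->] := has_derivative_stieltjes_poly ('X^k * p) z0.
by rewrite mulrA -exprS.
Qed.

(** The commutator of p(d/dz) with multiplication by z is p'(d/dz); the constant p_0 is what the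
    right side -1 of the equation of m contributes. *)
Lemma stieltjes_poly_ode (p : {poly C}) z : upper_half z ->
  stieltjes_poly ('X * p) z + z * stieltjes_poly p z = - stieltjes_poly p^`() z - p`_0.
Proof.
move=> z0.
have -> : stieltjes_poly ('X * p) z = pairing (fun k => gauss_stieltjes k.+1 z) p.
  exact: pairingMX.
rewrite /stieltjes_poly !(@pairingE _ (size p).+1) ?leqnSn //; last first.
  by apply: leq_trans (leq_trans (size_poly _ _) (leq_pred _)) _.
rewrite mulr_sumr -big_split /=.
under eq_bigr => k _.
  have := gauss_stieltjes_rec k z0 => /(canRL (addrK _)) E.
  rewrite (mulrCA z) -mulrDr E mulrDr.
  over.
rewrite big_split /= addrC; congr (_ + _).
  rewrite -sumrN big_ord_recl /= mul0r oppr0 mulr0 add0r [RHS]big_ord_recr /=.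
  rewrite coef_deriv nth_default // mul0rn mul0r oppr0 addr0.
  apply: eq_bigr => k _; rewrite coef_deriv /bump /= add1n add0n.
  by rewrite mulrN mulrA -[X in _ = - (X * _)]mulr_natr.
rewrite big_ord_recl /= mulrN1 big1 ?addr0 // => k _.
by rewrite oppr0 mulr0.
Qed.

(** If p(d/dz) m = 0, the differential equation gives p'(d/dz) m + p_0 = 0, and one more derivative
    annihilates X p'. Degree reduction then forces [p] to be a monomial, and finally 0. This makes
    the operator D_s unique. *)
Lemma stieltjes_poly_inj (p : {poly C}) :
  (forall z, upper_half z -> stieltjes_poly p z = 0) -> p = 0.
Proof.
have [n] := ubnP (size p); elim: n p => // n IH p; rewrite ltnS => pn p0.
have i0 : upper_half ('i : C) by rewrite /upper_half /= ltr01.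
have d0 (f : C -> C) z d : (forall w, upper_half w -> f w = 0) -> upper_half z ->
    has_derivative f z d -> d = 0.
  move=> f0 z0 [_ <-]; rewrite (eq_nderive 1 norm_open_upper_half f0 z0).
  by have [] := has_derivative_cst (0 : C) z.
have dp z : upper_half z -> stieltjes_poly p^`() z + p`_0 = 0.
  move=> z0; have := stieltjes_poly_ode p z0.
  rewrite p0 // mulr0 (d0 _ _ _ p0 z0 (has_derivative_stieltjes_poly p z0)) addr0.
  by move/eqP; rewrite eq_sym -opprD oppr_eq0 => /eqP.
have xdp z : upper_half z -> stieltjes_poly ('X * p^`()) z = 0.
  move=> z0; apply: (d0 _ z _ dp z0); rewrite -[X in has_derivative _ _ X]addr0.
  by apply: has_derivativeD; [exact: has_derivative_stieltjes_poly | exact: has_derivative_cst].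
case: n => [|n] in IH pn *.
  by apply/eqP; rewrite -size_poly_leq0.
(* The Euler operator cancels the coefficient of X^n, so the induction hypothesis applies to [r]; r
   = 0 leaves only that monomial in [p]. *)
pose r : {poly C} := n%:R *: p - 'X * p^`().
have /IH E : (size r < n.+1)%N.
  rewrite ltnS; apply/leq_sizeP => j nj; rewrite coefB coefZ coefXM coef_deriv.
  have [j0|j0] := eqVneq j 0%N.
    by move: nj; rewrite j0 leqn0 => /eqP ->; rewrite mul0r subrr.
  rewrite prednK ?lt0n //; move: nj; rewrite leq_eqVlt => /predU1P[<-|nj].
    by rewrite mulr_natl subrr.
  by rewrite nth_default ?(leq_trans pn) // mulr0 mul0rn subrr.
have {E} pE : n%:R *: p = 'X * p^`().
  apply/eqP; rewrite -subr_eq0; apply/eqP; apply: E => z z0.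
  rewrite /r /stieltjes_poly -scaleN1r pairingD !pairingZ.
  by rewrite -!/(stieltjes_poly _ _) p0 // xdp // !mulr0 addr0.
have ck j : j != n -> p`_j = 0.
  move=> jn; have : (n%:R - j%:R) * p`_j = 0.
    have := congr1 (fun q : {poly C} => q`_j) pE.
    rewrite coefZ coefXM coef_deriv; case: j jn => [|j] jn /=.
      by rewrite subr0.
    by rewrite mulrBl => ->; rewrite mulr_natl subrr.
  move/eqP; rewrite mulf_eq0 => /orP[|/eqP //].
  by rewrite subr_eq0 eqr_nat eq_sym (negPf jn).
have pX : p = p`_n *: 'X^n.
  apply/polyP => j; rewrite coefZ coefXn; have [->|jn] := eqVneq j n.
    by rewrite mulr1.
  by rewrite mulr0 ck.
have pn0 : p`_n = 0.
  clear r; case: n => [|n] in IH pn pE ck pX *.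
    have := dp _ i0; rewrite pX derivZ derivXn scaler0 /stieltjes_poly pairing0 add0r.
    by rewrite coefZ coefXn mulr1.
  have /IH : (size p^`() < n.+2)%N 
    by apply: leq_ltn_trans (size_poly _ _) _; case: (size p) pn.
  move=> H; have {H}p'0 : p^`() = 0.
    by apply: H => z z0; have := dp z z0; rewrite [p`_0]ck // addr0.
  have := congr1 (fun q : {poly C} => q`_n) p'0; rewrite coef_deriv coef0.
  by move/eqP; rewrite mulrn_eq0 /= => /eqP.
by rewrite pX pn0 scale0r.
Qed.

End Stieltjes.

(** * Existence and uniqueness of the functions Theta_s and of their operators *)

Section ThetaFamily.
Local Open Scope complex_scope.
Local Open Scope ring_scope.
Variables (R : realType) (c : nat -> R).
Local Notation C := R[i].
Local Notation Re := complex.Re.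
Local Notation Im := complex.Im.
Local Notation rc := (map_poly (real_complex R)).
Implicit Types (z : C) (p : {poly R}).

Definition primitive p : {poly R} :=
  \poly_(i < (size p).+1) (if i is j.+1 then p`_j / i%:R else 0).

Lemma coef_primitive p i : (primitive p)`_i = if i is j.+1 then p`_j / i%:R else 0.
Proof.
rewrite coef_poly; case: ifPn => //; rewrite -leqNgt => pi.
by case: i pi => // i; rewrite ltnS => pi; rewrite nth_default // mul0r.
Qed.

Lemma deriv_primitive p : (primitive p)^`() = p.
Proof.
by apply/polyP => i; rewrite coef_deriv coef_primitive -[LHS]mulr_natr divfK ?pnatr_eq0.
Qed.

(* D_0, ..., D_n as polynomials in the derivation: the equation of Theta_s reads
   D_s' = - sum_r c_r / (2 r + 1)! X^(2 r + 1) D_(s - r). *)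
Fixpoint theta_polys (n : nat) : seq {poly R} :=
  if n is n'.+1 then
    let ps := theta_polys n' in
    rcons ps (- primitive (\sum_(1 <= r < n.+1)
      (c r / (2 * r).+1`!%:R) *: ('X^((2 * r).+1) * ps`_(n - r))))
  else [:: 1].

Definition theta_poly n := (theta_polys n)`_n.

Lemma size_theta_polys n : size (theta_polys n) = n.+1.
Proof. by elim: n => //= n IH; rewrite size_rcons IH. Qed.

Lemma nth_theta_polys n m : (m <= n)%N -> (theta_polys n)`_m = theta_poly m.
Proof.
elim: n m => [|n IH] m; first by rewrite leqn0 => /eqP ->.
rewrite leq_eqVlt => /predU1P[-> //|mn].
by rewrite /= nth_rcons size_theta_polys mn IH.
Qed.

Lemma theta_poly0 : theta_poly 0 = 1. Proof. by []. Qed.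

Lemma theta_polyS n : theta_poly n.+1 = - primitive (\sum_(1 <= r < n.+2)
  (c r / (2 * r).+1`!%:R) *: ('X^((2 * r).+1) * theta_poly (n.+1 - r))).
Proof.
rewrite /theta_poly /= nth_rcons size_theta_polys ltnn eqxx; congr (- primitive _).
rewrite [LHS]big_nat [RHS]big_nat; apply: eq_bigr => r /andP[r0 _].
by rewrite nth_theta_polys // -ltnS ltn_subrL r0.
Qed.

(** The r-th term raises the orders present in D_(s-r) by 2r + 2. The lower end 2s + 2 comes from r
    = s, and the upper end 4s from r >= 1. *)
Lemma theta_poly_support s k : (0 < s)%N -> (theta_poly s)`_k != 0 ->
  ~~ odd k && (2 * s + 2 <= k <= 4 * s)%N.
Proof.
elim/ltn_ind: s k => -[//|s] IH k _.
rewrite theta_polyS coefN oppr_eq0 coef_primitive; case: k => [|k]; first by rewrite eqxx.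
rewrite mulf_eq0 negb_or invr_eq0 => /andP[+ _]; rewrite coef_sum.
apply: contraNT => H; rewrite big_nat big1 // => r /andP[r0 rs].
rewrite coefZ coefXnM; case: ltnP => kr; first by rewrite mulr0.
apply/eqP; rewrite mulf_eq0; apply/orP; right; apply: contraNT H => H.
have [sr|sr] := eqVneq (s.+1 - r)%N 0%N.
  move: H; rewrite sr theta_poly0 coef1 pnatr_eq0 eqb0 negbK => /eqP H.
  by have {}H : (k - (2 * r).+1 = 0)%N := H; apply/andP; split; lia.
have lt_sr : (s.+1 - r < s.+1)%N by rewrite ltn_subrL r0.
have /and3P[h1 h2 h3] : [&& ~~ odd (k - (2 * r).+1), (2 * (s.+1 - r) + 2 <= k - (2 * r).+1)%N
    & (k - (2 * r).+1 <= 4 * (s.+1 - r))%N].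
  by apply: IH H => //; rewrite lt0n.
by apply/and3P; split; lia.
Qed.

Local Notation m := (@stieltjes_rhoG R).

Lemma diffop_stieltjes p z : upper_half z -> diffop (rc p) m z = stieltjes_poly (rc p) z.
Proof. by move=> z0; apply: eq_bigr => k _; rewrite nderive_stieltjes. Qed.

Lemma stieltjes_poly_norm_le p :
  exists2 A : R, 0 <= A & forall z, 1 <= Im z -> `|stieltjes_poly (rc p) z| <= (A / Im z)%:C.
Proof.
exists (\sum_(k < size (rc p)) `|p`_k| * (k`!%:R * 2)).
  by apply: sumr_ge0 => k _; rewrite !mulr_ge0.
move=> z z1; have z0 : 0 < Im z by apply: lt_le_trans z1.
apply: le_trans (ler_norm_sum _ _ _) _; rewrite mulr_suml rmorph_sum /=.
apply: ler_sum => k _; rewrite coef_map /= normrM.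
have -> : `|(p`_k)%:C| = `|p`_k|%:C :> C by rewrite normc_def /= expr0n addr0 sqrtr_sqr.
rewrite -mulrA [X in _ <= X]rmorphM /= ler_wpM2l //; first by rewrite -[0]/(0%:C) lecR.
rewrite /gauss_stieltjes normrM normr_nat -mulrA rmorphM rmorph_nat ler_wpM2l ?ler0n //.
apply: le_trans (stieltjes_pow_norm_le k z0) _; rewrite lecR ler_wpM2l //.
rewrite exprS ler_piMr ?invr_ge0 ?(ltW z0) // exprn_ile1 ?invr_ge0 ?(ltW z0) //.
by rewrite invf_le1.
Qed.

Lemma theta_family_exists :
  is_theta_family c (fun s z => diffop (rc (theta_poly s)) m z).
Proof.
split=> [z z0|s s0].
  by rewrite /diffop theta_poly0 rmorph1 size_poly1 big_ord1 coef1 mul1r.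
have opU := @norm_open_upper_half R.
have eqs p z : upper_half z -> stieltjes_poly (rc p) z = diffop (rc p) m z.
  by move=> z0; rewrite diffop_stieltjes.
have dif p z (z0 : upper_half z) := eq_has_derivative opU (eqs p) z0
  (has_derivative_stieltjes_poly (rc p) z0).
split.
- by move=> z z0; have [] := dif (theta_poly s) z z0.
- move=> e e0; have [A A0 HA] := stieltjes_poly_norm_le (theta_poly s).
  exists (1 + A / e) => z hz.
  have z1 : 1 <= Im z by apply: le_trans (ltW hz); rewrite lerDl divr_ge0 // ltW.
  have z0 : upper_half z by apply: lt_le_trans z1.
  rewrite diffop_stieltjes // /sqnormc -ltcR add_Re2_Im2 rmorphXn /=.
  rewrite ltrXn2r // (le_lt_trans (HA z z1)) // ltcR ltr_pdivrMr //.
  rewrite mulrC -ltr_pdivrMr //; apply: le_lt_trans hz; by rewrite lerDr.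
- move=> z z0; have [_ ->] := dif (theta_poly s) z z0.
  rewrite diffop_stieltjes // stieltjes_poly_ode //.
  case: s s0 => // s _; rewrite coef_map theta_polyS coefN coef_primitive oppr0 subr0.
  set S := (\sum_(_ <= r < _) _); have -> : (rc (- primitive S))^`() = (-1) *: rc S.
    by rewrite deriv_map derivN deriv_primitive rmorphN scaleN1r.
  rewrite /stieltjes_poly pairingZ mulN1r opprK /S rmorph_sum pairing_sum; apply: eq_bigr => r _.
  transitivity (pairing ((@gauss_stieltjes R)^~ z) ((c r / (2 * r).+1`!%:R)%:C *:
    rc ('X^((2 * r).+1) * theta_poly (s.+1 - r)))).
    by congr pairing; exact: map_polyZ.
  have -> : rc ('X^((2 * r).+1) * theta_poly (s.+1 - r)) = 'X^((2 * r).+1) * rc (theta_poly (s.+1 - r)).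
    by rewrite rmorphM /= map_polyXn.
  rewrite pairingZ; congr (_ * _).
  by rewrite -(eq_nderive _ opU (eqs (theta_poly (s.+1 - r))) z0) nderive_stieltjes_poly.
Qed.

Lemma mono_of_derive (k k' : R -> R) (a : R) : 0 < a ->
  (forall y : R, 0 < y -> is_derive y (1 : R) k (k' y)) -> (forall y, 0 < y -> 0 <= k' y) ->
  forall b, a <= b -> k a <= k b.
Proof.
move=> a0 dk k0 b; rewrite le_eqVlt => /predU1P[-> //|ab].
have dk' y : y \in `]a, b[ -> is_derive y (1 : R) k (k' y).
  by rewrite in_itv /= => /andP[ay _]; apply: dk; apply: lt_trans ay.
have [|y /[dup] yab + E] := MVT ab dk'.
  apply: derivable_within_continuous => y; rewrite in_itv /= => /andP[ay _].
  by apply: (@ex_derive _ _ _ _ _ _ _ (dk _ _)); apply: lt_le_trans ay.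
rewrite in_itv /= => /andP[ay _]; rewrite -subr_ge0 E mulr_ge0 ?subr_ge0 ?(ltW ab) //.
by apply: k0; apply: lt_trans ay.
Qed.

(* On a vertical line z = u + i y the equation f' = - z f gives (|f|^2)' = 2 y |f|^2, so
   |f|^2 is nondecreasing in y while it tends to 0. *)
Lemma gauss_ode_unique (f : C -> C) :
  (forall z, upper_half z -> has_derivative f z (- (z * f z))) ->
  vanishes_at_i_infty f -> forall z, upper_half z -> f z = 0.
Proof.
move=> df vf z z0.
pose w (y : R) : C := Re z +i* y.
have wu (y : R) : 0 < y -> upper_half (w y) by [].
(* [phi] stands for [Re] and [Im]: a real-linear functional bounded by the modulus carries the
   complex derivative over to the real derivative along the vertical line, where a step h moves z by
   i h. *)
have dReIm (phi : C -> R) : (forall a b, phi (a + b) = phi a + phi b) ->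
    (forall a, phi (- a) = - phi a) ->
    (forall (r : R) a, phi (r%:C * a) = r * phi a) -> (forall a, `|phi a|%:C <= `|a|) ->
    forall y : R, 0 < y -> is_derive y (1 : R) (fun y : R => phi (f (w y)))
      (phi ('i * - (w y * f (w y)))).
  move=> phiD phiN phiZ phile y y0; apply/has_derivativeP; apply: linear_derive => e e0.
  have [d dE] := df _ (wu y y0).
  have e0' : 0 < e%:C by rewrite ltcR.
  have [r r0 H] := derivable_linear d e0'.
  have [r1 r10 rE] : exists2 r1 : R, 0 < r1 & r = r1%:C.
    case: r r0 {H} => r1 r2; rewrite lt_def /= lecE /= => /andP[rn /andP[/eqP ri rr]].
    exists r1; last by rewrite /real_complex_def ri.
    rewrite lt_def rr andbT; apply: contra rn => /eqP ->.
    by rewrite eq_complex /= ri !eqxx.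
  exists r1 => // h hr.
  have nh : `|'i * h%:C : C| = `|h|%:C.
    by rewrite normrM normc_def /= expr0n expr1n add0r sqrtr1 mul1r normc_def /= expr0n addr0 sqrtr_sqr.
  have := H ('i * h%:C); rewrite nh rE ltcR => /(_ hr).
  have -> : 'i * h%:C + w y = w (h + y).
    by apply/eqP; rewrite eq_complex /=; apply/andP; split; apply/eqP; ring.
  rewrite dE -rmorphM /= -lecR => L.
  apply: le_trans L; apply: le_trans (phile _).
  rewrite -!phiN -phiD -phiZ -phiN -phiD lecR le_eqVlt; apply/orP; left; apply/eqP.
  by congr `|phi _|; ring.
pose k (y : R) := sqnormc (f (w y)).
have dk (y : R) : 0 < y -> is_derive y (1 : R) k (2 * y * k y).
  move=> y0.
  have d1 := dReIm (@Re R) (fun a b => raddfD _ a b) (fun a => raddfN _ a)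
    (ltac:(by move=> r [a b] /=; ring)) (@normc_ge_Re R) y y0.
  have d2 := dReIm (@Im R) (fun a b => raddfD _ a b) (fun a => raddfN _ a)
    (ltac:(by move=> r [a b] /=; ring)) (@normc_ge_Im R) y y0.
  rewrite /k /sqnormc; apply: is_derive_eq; rewrite /GRing.scale /= /w.
  by case: (f _) => a b /=; ring.
have k0 y : 0 <= k y by rewrite addr_ge0 ?sqr_ge0.
have kz : k (Im z) = sqnormc (f z) by rewrite /k /w; case: (z).
have mono := mono_of_derive z0 dk (fun y y0 => mulr_ge0 (mulr_ge0 (ler0n _ _) (ltW y0)) (k0 y)).
have : k (Im z) <= 0.
  apply/ler_addgt0Pl => e e0; rewrite addr0.
  have se : 0 < Num.sqrt e by rewrite sqrtr_gt0.
  have [Y HY] := vf _ se.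
  apply: le_trans (mono (Num.max (Y + 1) (Im z)) _) _; first by rewrite le_max lexx orbT.
  have := HY (w (Num.max (Y + 1) (Im z))); rewrite sqr_sqrtr ?(ltW e0) //= => H.
  by apply: ltW; apply: H; rewrite lt_max ltrDl ltr01.
rewrite kz /sqnormc => H.
have /eqP : Re (f z) ^+ 2 + Im (f z) ^+ 2 == 0 by rewrite eq_le H addr_ge0 ?sqr_ge0.
move/eqP; rewrite paddr_eq0 ?sqr_ge0 // !sqrf_eq0 => /andP[/eqP a /eqP b].
by apply/eqP; rewrite eq_complex a b !eqxx.
Qed.

(** By induction the right sides of the two equations agree, so the difference with the explicit
    family solves f' = -z f and vanishes at infinity. *)
Lemma theta_family_unique F : is_theta_family c F ->
  forall s z, upper_half z -> F s z = diffop (rc (theta_poly s)) m z.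
Proof.
move=> [F0 FS] s; have [G0 GS] := theta_family_exists.
have opU := @norm_open_upper_half R.
elim/ltn_ind: s => -[_ z z0|s IH z z0]; first by rewrite F0 // G0.
have [holF vanF eqF] := FS s.+1 isT; have [holG vanG eqG] := GS s.+1 isT.
set G := (fun z => diffop (rc (theta_poly s.+1)) m z) in holG vanG eqG *.
apply/eqP; rewrite -subr_eq0 -/(G z) -mulN1r; apply/eqP.
move: z z0; apply: gauss_ode_unique => [z z0|e e0].
  have dF : has_derivative (F s.+1) z (nderive 1 (F s.+1) z) by split=> //; exact: holF.
  have dG : has_derivative G z (nderive 1 G z) by split=> //; exact: holG.
  have := has_derivativeD dF (has_derivativeZ (-1) dG); congr has_derivative.
  have EF : nderive 1 (F s.+1) z = nderive 1 G z + z * G z - z * F s.+1 z.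
    have -> : nderive 1 G z + z * G z = nderive 1 (F s.+1) z + z * F s.+1 z; last by rewrite addrK.
    have EG := eqG z z0; have EF := eqF z z0.
    apply: etrans EG (esym (etrans EF _)); apply: eq_big_nat => r /andP[r0 _].
    have lt_sr : (s.+1 - r < s.+1)%N by rewrite ltn_subrL r0.
    have -> := eq_nderive (2 * r).+1 opU (IH _ lt_sr) z0.
    by [].
  by rewrite EF; ring.
(* Half of [e] suffices, since |u - v|^2 <= 2 |u|^2 + 2 |v|^2. *)
have e2 : 0 < e / 2 by rewrite divr_gt0.
have [Y1 H1] := vanF _ e2; have [Y2 H2] := vanG _ e2.
exists (Num.max Y1 Y2) => z; rewrite gt_max => /andP[/H1 z1 /H2 z2].
move: z1 z2; rewrite /sqnormc; case: (F _ z) (G z) => [a b] [a' b'] /=.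
have := sqr_ge0 (a + a'); have := sqr_ge0 (b + b'); nra.
Qed.

Lemma thetaE s z : upper_half z -> theta c s z = diffop (rc (theta_poly s)) m z.
Proof.
apply: theta_family_unique; rewrite /theta; case: xgetP => // /(_ _ theta_family_exists).
by [].
Qed.

Lemma theta_opE s : (0 < s)%N -> theta_op c s = theta_poly s.
Proof.
move=> s0; have ex : is_theta_op c s (theta_poly s).
  by split=> [k|z z0]; [exact: theta_poly_support | exact: thetaE].
rewrite /theta_op; case: xgetP => [p pE [_ Hp]|/(_ _ ex) //].
apply: (map_poly_inj (real_complex R)); apply/eqP; rewrite -subr_eq0; apply/eqP.
apply: stieltjes_poly_inj => z z0.
rewrite /stieltjes_poly -scaleN1r pairingD pairingZ -!/(stieltjes_poly _ _).
by rewrite -!diffop_stieltjes // -Hp // -thetaE // mulN1r subrr.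
Qed.

End ThetaFamily.

(** * The Fourier transform of the profile *)

Section Fourier.
Variable R : realType.
Implicit Types (f g : R -> R) (t x : R) (p : {poly R}).

Lemma bounded_derive_lipschitz f f' (a b C : R) :
  (forall x, is_derive x (1 : R) f (f' x)) ->
  (forall x, `|x - a| <= `|b - a| -> `|f' x| <= C) -> `|f b - f a| <= C * `|b - a|.
Proof.
move=> df f'C.
have cont u v : {within `[u, v], continuous f}.
  apply: derivable_within_continuous => x _; exact: (@ex_derive _ _ _ _ _ _ _ (df x)).
have [ab|ba|->] := ltgtP a b; last by rewrite !subrr normr0 mulr0.
- have [x + ->] := MVT ab (fun x _ => df x) (cont a b).
  rewrite in_itv /= => /andP[ax xb]; rewrite normrM ler_wpM2r //; apply: f'C.
  by rewrite !ger0_norm ?subr_ge0 ?(ltW ab) ?(ltW ax) // lerD2r ltW.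
- have [x + E] := MVT ba (fun x _ => df x) (cont b a).
  rewrite in_itv /= => /andP[bx xa]; rewrite distrC [X in _ <= _ * X]distrC E.
  rewrite normrM ler_wpM2r //; apply: f'C.
  by rewrite distrC [X in _ <= X]distrC !ger0_norm ?subr_ge0 ?(ltW ba) ?(ltW xa) // lerB // ltW.
Qed.

Lemma taylor2_le f f' f'' (a h C : R) :
  (forall x, is_derive x (1 : R) f (f' x)) -> (forall x, is_derive x (1 : R) f' (f'' x)) ->
  (forall x, `|f'' x| <= C) -> `|f (a + h) - f a - h * f' a| <= C * h ^+ 2.
Proof.
move=> df df' f''C; pose g x := f (a + x) - f a - x * f' a.
have dg x : is_derive x (1 : R) g (f' (a + x) - f' a).
  have d1 : is_derive x (1 : R) (fun y => f (a + y)) (f' (a + x)).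
    have da : is_derive x (1 : R) (fun y : R => a + y) 1.
      by apply: (@is_derive_eq _ _ _ (cst a + id)); rewrite add0r.
    by have := is_derive1_comp (df (a + x)) da; rewrite /GRing.scale /= mulr1.
  by rewrite /g; apply: is_derive_eq; rewrite /GRing.scale /= mulr0 mulr1 add0r subr0.
have := @bounded_derive_lipschitz g _ 0 h (C * `|h|) dg.
rewrite /g !addr0 mul0r subrr !subr0 expr2 -[h in C * (h * _)]/h.
have -> : C * (h * h) = C * `|h| * `|h| by rewrite -mulrA; congr (_ * _); rewrite -!expr2 real_normK ?num_real.
apply=> x; rewrite subr0 => xh.
have C0 : 0 <= C by apply: le_trans (f''C 0).
have := @bounded_derive_lipschitz f' f'' a (a + x) C df' (fun y _ => f''C y).
have -> : a + x - a = x by ring.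
by move=> H; apply: le_trans H _; rewrite ler_wpM2l.
Qed.

Lemma cos_taylor (a h : R) : `|cos (a + h) - cos a - h * - sin a| <= h ^+ 2.
Proof.
rewrite -[leRHS]mul1r; apply: (@taylor2_le _ (fun x => - sin x) (fun x => - cos x)) => x.
by rewrite normrN ler_norml cos_geN1 cos_le1.
Qed.

Lemma sin_taylor (a h : R) : `|sin (a + h) - sin a - h * cos a| <= h ^+ 2.
Proof.
rewrite -[leRHS]mul1r; apply: (@taylor2_le _ (fun x => cos x) (fun x => - sin x)) => x.
by rewrite normrN ler_norml sin_geN1 sin_le1.
Qed.

Lemma measurable_cosM t : measurable_fun setT (fun x : R => cos (t * x)).
Proof.
apply: continuous_measurable_fun => x; apply: continuous_comp; last exact: continuous_cos.
exact: (@mulrl_continuous _ t x).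
Qed.

Lemma measurable_sinM t : measurable_fun setT (fun x : R => sin (t * x)).
Proof.
apply: continuous_measurable_fun => x; apply: continuous_comp; last exact: continuous_sin.
exact: (@mulrl_continuous _ t x).
Qed.

Lemma tame_cosM t : tame (fun x : R => cos (t * x)).
Proof.
apply: (@tame_bounded _ _ 1); first exact: measurable_cosM.
by move=> x; rewrite ler_norml cos_geN1 cos_le1.
Qed.

Lemma tame_sinM t : tame (fun x : R => sin (t * x)).
Proof.
apply: (@tame_bounded _ _ 1); first exact: measurable_sinM.
by move=> x; rewrite ler_norml sin_geN1 sin_le1.
Qed.

Lemma is_derive_cosM t x : is_derive x (1 : R) (fun y => cos (t * y)) (- (t * sin (t * x))).
Proof. by apply: is_derive_eq; rewrite /GRing.scale /=; ring. Qed.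

Lemma is_derive_sinM t x : is_derive x (1 : R) (fun y => sin (t * y)) (t * cos (t * x)).
Proof. by apply: is_derive_eq; rewrite /GRing.scale /=; ring. Qed.

Lemma is_derive_continuous f f' : (forall x, is_derive x (1 : R) f (f' x)) -> continuous f.
Proof.
by move=> df x; apply/differentiable_continuous/derivable1_diffP;
  exact: (@ex_derive _ _ _ _ _ _ _ (df x)).
Qed.

(** (p' - X p) rhoG is the derivative of p rhoG, so this is a single integration by parts. *)
Lemma gint_poly_cos p t : gint (fun x => (p^`() - 'X * p).[x] * cos (t * x)) =
  t * gint (fun x => p.[x] * sin (t * x)).
Proof.
pose g' x := p^`().[x] * cos (t * x) + - (t * (p.[x] * sin (t * x))).
have tp' := tameM (tame_poly p^`()) (tame_cosM t).
have tp := tameM (tame_poly p) (tame_cosM t).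
have ts := tameM (tame_poly p) (tame_sinM t).
have E : gint (fun x => x * (p.[x] * cos (t * x))) = gint g'.
  apply: gint_ibp => //.
  - move=> x; have d1 := is_derive_cosM t x.
    by apply: is_derive_eq; rewrite /GRing.scale /= /g'; ring.
  - apply: (@is_derive_continuous _ (fun x => p^`()^`().[x] * cos (t * x) - p^`().[x] * (t * sin (t * x))
      - (t * (p^`().[x] * sin (t * x) + p.[x] * (t * cos (t * x)))))) => x.
    have d1 := is_derive_cosM t x; have d2 := is_derive_sinM t x.
    by rewrite /g'; apply: is_derive_eq; rewrite /GRing.scale /=; ring.
  - by apply: tameD => //; apply: tameN; exact: tameZ.
transitivity (gint (fun x => p^`().[x] * cos (t * x)) - gint (fun x => x * (p.[x] * cos (t * x)))).
  rewrite -gintB //; last exact: (tameM (@tame_id R) tp).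
  by apply: eq_gint => x; rewrite hornerD hornerN hornerM hornerX; ring.
rewrite E gintD // ?gintN ?gintZ //; first ring.
- exact: tameZ.
- by apply: tameN; exact: tameZ.
Qed.

Lemma gint_poly_sin p t : gint (fun x => (p^`() - 'X * p).[x] * sin (t * x)) =
  - (t * gint (fun x => p.[x] * cos (t * x))).
Proof.
pose g' x := p^`().[x] * sin (t * x) + t * (p.[x] * cos (t * x)).
have tp' := tameM (tame_poly p^`()) (tame_sinM t).
have tp := tameM (tame_poly p) (tame_sinM t).
have ts := tameM (tame_poly p) (tame_cosM t).
have E : gint (fun x => x * (p.[x] * sin (t * x))) = gint g'.
  apply: gint_ibp => //.
  - move=> x; have d1 := is_derive_sinM t x.
    by apply: is_derive_eq; rewrite /GRing.scale /= /g'; ring.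
  - apply: (@is_derive_continuous _ (fun x => p^`()^`().[x] * sin (t * x) + p^`().[x] * (t * cos (t * x))
      + (t * (p^`().[x] * cos (t * x) - p.[x] * (t * sin (t * x)))))) => x.
    have d1 := is_derive_cosM t x; have d2 := is_derive_sinM t x.
    by rewrite /g'; apply: is_derive_eq; rewrite /GRing.scale /=; ring.
  - by apply: tameD => //; exact: tameZ.
transitivity (gint (fun x => p^`().[x] * sin (t * x)) - gint (fun x => x * (p.[x] * sin (t * x)))).
  rewrite -gintB //; last exact: (tameM (@tame_id R) tp).
  by apply: eq_gint => x; rewrite hornerD hornerN hornerM hornerX; ring.
rewrite E gintD // ?gintZ //; first ring.
exact: tameZ.
Qed.

(** A remainder quadratic in h with a Gaussian-integrable coefficient lets the derivative pass under
    the integral. *)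
Lemma gint_derive f (F G : R -> R -> R) :
  (forall t, tame (F t)) -> (forall t, tame (G t)) ->
  (forall t h x, `|F (t + h) x - F t x - h * G t x| <= h ^+ 2 * x ^+ 2) ->
  forall t, is_derive t (1 : R) (fun t => gint (F t)) (gint (G t)).
Proof.
move=> tF tG H t; apply/has_derivativeP.
have c0 : 0 <= gint (fun x : R => x ^+ 2).
  by rewrite -(gint_cst 0); apply: gint_le; [exact: tame_cst|exact: tameX|move=> x; exact: sqr_ge0].
apply: (quadratic_derive ltr01 c0) => h _.
rewrite [h + t]addrC -gintZ // -gintB // -gintB //; last 2 first.
- by apply: tameB.
- exact: tameZ.
rewrite real_normK ?num_real // mulrC -gintZ; last exact: tameX.
have t1 : tame (fun x => F (t + h) x - F t x - h * G t x) by apply: tameB; [exact: tameB|exact: tameZ].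
have t2 : tame (fun x : R => h ^+ 2 * x ^+ 2) by apply: tameZ; exact: tameX.
rewrite ler_norml -gintN // !gint_le //; try exact: tameN.
  by move=> x; have := H t h x; rewrite ler_norml => /andP[].
by move=> x; have := H t h x; rewrite ler_norml => /andP[].
Qed.

Lemma gaussian_ode (k : R -> R) : (forall t, is_derive t (1 : R) k (- (t * k t))) ->
  forall t, k t = k 0 * expR (- (t ^+ 2 / 2)).
Proof.
move=> dk t; pose g t := k t * expR (t ^+ 2 / 2).
have dg x : is_derive x (1 : R) g 0.
  rewrite /g; apply: is_derive_eq; rewrite /GRing.scale /=.
  by move: (expR _) => e; field.
have : `|g t - g 0| <= 0 * `|t - 0|.
  by apply: (bounded_derive_lipschitz dg) => x _; rewrite normr0.
rewrite mul0r normr_le0 subr_eq0 => /eqP; rewrite /g expr0n mul0r expR0 mulr1 => <-.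
by rewrite -mulrA -expRD addrN expR0 mulr1.
Qed.

Lemma gint_cosM t : gint (fun x => cos (t * x)) = expR (- (t ^+ 2 / 2)).
Proof.
apply: etrans (@gaussian_ode (fun t => gint (fun x => cos (t * x))) _ t) _; last first.
  under eq_gint do rewrite mul0r cos0.
  by rewrite gint1 mul1r.
move=> {}t; have := gint_poly_sin 1 t; rewrite derivC sub0r mulr1.
under [in RHS]eq_gint do rewrite hornerC mul1r.
move=> <-.
apply: (@gint_derive id (fun t x => cos (t * x)) (fun t x => (- 'X).[x] * sin (t * x))) => s.
- exact: tame_cosM.
- by apply: tameM; [exact: tame_poly | exact: tame_sinM].
- move=> h x; rewrite -exprMn hornerN hornerX.
  have := cos_taylor (s * x) (h * x).
  by rewrite mulrDl; congr (_ <= _); congr (`| _ |); ring.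
Qed.

Lemma gint_sinM t : gint (fun x => sin (t * x)) = 0.
Proof.
apply: etrans (@gaussian_ode (fun t => gint (fun x => sin (t * x))) _ t) _; last first.
  under eq_gint do rewrite mul0r sin0.
  by rewrite gint_cst mul0r.
move=> {}t; have := gint_poly_cos (-1) t; rewrite derivN derivC oppr0 sub0r mulrN1 opprK.
under [in RHS]eq_gint do rewrite hornerN hornerC mulN1r.
rewrite gintN; last exact: tame_sinM.
rewrite mulrN => <-.
apply: (@gint_derive id (fun t x => sin (t * x)) (fun t x => ('X).[x] * cos (t * x))) => s.
- exact: tame_sinM.
- by apply: tameM; [exact: tame_poly | exact: tame_cosM].
- move=> h x; rewrite -exprMn hornerX.
  have := sin_taylor (s * x) (h * x).
  by rewrite mulrDl; congr (_ <= _); congr (`| _ |); ring.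
Qed.

(** With this sign it is (-1)^k times the probabilists' Hermite polynomial, so that the k-th
    derivative of rhoG carries no sign. *)
Fixpoint hermite k : {poly R} :=
  if k is k'.+1 then (hermite k')^`() - 'X * hermite k' else 1.

Lemma nderive_rhoG k x : nderive k (@rhoG R) x = (hermite k).[x] * rhoG x.
Proof.
elim: k x => [|k IH] x; first by rewrite /nderive /= hornerC mul1r.
rewrite nderiveSr (_ : nderive k _ = fun x => (hermite k).[x] * rhoG x); last exact/funext.
have dr := is_derive_rhoG x.
rewrite /nderive derive1n1 derive1E; apply: derive_val; apply: is_derive_eq.
by rewrite /GRing.scale /= hornerD hornerN hornerM hornerX; ring.
Qed.

(* The real part of i ^ k. *)
Definition sgn_half k : R := if odd k then 0 else (-1) ^+ k./2.

Lemma sgn_halfD m k : sgn_half (2 * m + k) = (-1) ^+ m * sgn_half k.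
Proof.
rewrite /sgn_half oddD oddM /=; case: ifP => _; first by rewrite mulr0.
by rewrite -exprD; congr (_ ^+ _); lia.
Qed.

(** Together these say that the k-th derivative of rhoG has Fourier transform (it)^k exp(-t^2/2);
    the index k + 1 in the sine integral appears because Re i^(k+1) = -Im i^k. *)
Lemma gint_hermite k t :
  gint (fun x => (hermite k).[x] * cos (t * x)) = expR (- (t ^+ 2 / 2)) * (sgn_half k * t ^+ k) /\
  gint (fun x => (hermite k).[x] * sin (t * x)) = expR (- (t ^+ 2 / 2)) * (sgn_half k.+1 * t ^+ k).
Proof.
elim: k => [|k [IHc IHs]] /=.
  under eq_gint do rewrite hornerC mul1r.
  under [X in _ /\ X = _]eq_gint do rewrite hornerC mul1r.
  by rewrite gint_cosM gint_sinM /sgn_half /= !expr0 !mulr1 ?mul0r ?mulr0.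
have -> : sgn_half k.+2 = - sgn_half k by rewrite -[k.+2]/(2 * 1 + k)%N sgn_halfD expr1 mulN1r.
by rewrite gint_poly_cos gint_poly_sin IHc IHs [t ^+ k.+1]exprS; split; ring.
Qed.

(* Substitutes [i t] for the variable of an even polynomial. *)
Definition wick p : {poly R} := \poly_(k < size p) (sgn_half k * p`_k).

Lemma coef_wick p k : (wick p)`_k = sgn_half k * p`_k.
Proof.
rewrite coef_poly; case: ifPn => //; rewrite -leqNgt => pk.
by rewrite nth_default // mulr0.
Qed.

Lemma gint_wick p t : (forall k, p`_k != 0 -> ~~ odd k) ->
  let Q := \sum_(k < size p) p`_k *: hermite k in
  gint (fun x => Q.[x] * cos (t * x)) = expR (- (t ^+ 2 / 2)) * (wick p).[t] /\
  gint (fun x => Q.[x] * sin (t * x)) = 0.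
Proof.
move=> pe /=; set e := expR _; rewrite /wick horner_poly.
elim: (size p) => [|n [IHc IHs]].
  rewrite [X in _ * X]big_ord0 mulr0; split; under eq_gint do rewrite big_ord0 horner0 mul0r;
    exact: gint_cst.
have tp q := tameM (tame_poly q) (tame_cosM t).
have ts q := tameM (tame_poly q) (tame_sinM t).
split.
  rewrite [X in _ * X]big_ord_recr /= mulrDr -IHc -mulrA [sgn_half n * _]mulrCA -[_ * (p`_n * _)]mulrCA.
  have [<- _] := gint_hermite n t; rewrite -gintZ // -gintD //; last exact: tameZ.
  by apply: eq_gint => x; rewrite big_ord_recr /= hornerD hornerZ; ring.
transitivity (gint (fun x => (\sum_(k < n) p`_k *: hermite k).[x] * sin (t * x)) +
  p`_n * gint (fun x => (hermite n).[x] * sin (t * x))); last first.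
  have [_ ->] := gint_hermite n t; rewrite IHs add0r.
  have [->|/pe on] := eqVneq p`_n 0; first by rewrite mul0r.
  by rewrite /sgn_half /= on mul0r !mulr0.
rewrite -gintZ // -gintD //; last exact: tameZ.
by apply: eq_gint => x; rewrite big_ord_recr /= hornerD hornerZ; ring.
Qed.

End Fourier.

(** * The polynomial factor of the transformed profile *)

Section FourierProfile.
Local Open Scope complex_scope.
Local Open Scope ring_scope.
Variables (R : realType) (c : nat -> R).
Implicit Types (t x : R).

Lemma diffop_rhoG (p : {poly R}) x :
  diffop p (@rhoG R) x = (\sum_(k < size p) p`_k *: hermite R k).[x] * rhoG x.
Proof.
rewrite horner_sum mulr_suml; apply: eq_bigr => k _.
by rewrite nderive_rhoG hornerZ mulrA.
Qed.

Definition profile_poly (a : R) L : {poly R} :=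
  1 + \sum_(1 <= s < L.+1) a ^+ s *: wick (theta_poly c s).

Lemma fourier_varrho a L t :
  fourier (varrho a c L) t = (expR (- (t ^+ 2 / 2)) * (profile_poly a L).[t])%:C.
Proof.
pose H s := \sum_(k < size (theta_poly c s)) (theta_poly c s)`_k *: hermite R k.
pose Q : {poly R} := 1 + \sum_(1 <= s < L.+1) a ^+ s *: H s.
have vE x : varrho a c L x = rhoG x * Q.[x].
  rewrite /varrho hornerD hornerC mulrDr mulr1 horner_sum mulr_sumr; congr (_ + _).
  apply: eq_big_nat => s /andP[s0 _].
  by rewrite theta_opE // diffop_rhoG hornerZ; ring.
have supp s : (0 < s)%N -> forall k, (theta_poly c s)`_k != 0 -> ~~ odd k.
  by move=> s0 k /(theta_poly_support s0) /andP[].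
have tc q := tameM (tame_poly q) (tame_cosM t).
have ts q := tameM (tame_poly q) (tame_sinM t).
have sumE (f : R -> R) (tf : forall q, tame (fun x => q.[x] * f x)) :
    gint (fun x => Q.[x] * f x) = gint f + \sum_(1 <= s < L.+1) a ^+ s * gint (fun x => (H s).[x] * f x).
  rewrite /Q; elim: L {Q vE} => [|L IH].
    by rewrite !big_nil addr0 addr0; apply: eq_gint => x; rewrite hornerC mul1r.
  rewrite !(@big_nat_recr _ _ _ L.+1) //= [RHS]addrA -IH -gintZ // -gintD //.
    by apply: eq_gint => x; rewrite [1 + _]addrA hornerD hornerZ; ring.
  by apply: tameM; [exact: tame_cst | exact: tf].
rewrite /fourier /Cintegral; apply/eqP; rewrite eq_complex /=; apply/andP; split; apply/eqP.
  transitivity (gint (fun x => Q.[x] * cos (t * x))).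
    by apply: eq_Rintegral => x _; rewrite vE mulr0 subr0; ring.
  rewrite sumE // gint_cosM /profile_poly hornerD hornerC mulrDr mulr1 horner_sum mulr_sumr.
  congr (_ + _); apply: eq_big_nat => s /andP[s0 _].
  by have [-> _] := gint_wick t (supp s s0); rewrite hornerZ; ring.
transitivity (- gint (fun x => Q.[x] * sin (t * x))).
  rewrite -gintN //; apply: eq_Rintegral => x _; rewrite vE mulr0 add0r; ring.
rewrite sumE // gint_sinM big_nat big1 ?addr0 ?oppr0 // => s /andP[s0 _].
by have [_ ->] := gint_wick t (supp s s0); rewrite mulr0.
Qed.

Lemma wick0 : wick (theta_poly c 0) = 1.
Proof.
apply/polyP => k; rewrite coef_wick theta_poly0 !coef1.
by case: k => [|k]; rewrite ?mulr0 // mulr1.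
Qed.

(** The equation of D_s after the substitution of it: the integration and the shift by 2r + 1
    together contribute i^(2r+2), which turns the minus sign of the recursion into (-1)^r. *)
Lemma wick_theta_deriv s : (wick (theta_poly c s))^`() =
  \sum_(1 <= r < s.+1) ((-1) ^+ r * (c r / (2 * r).+1`!%:R)) *:
    ('X^((2 * r).+1) * wick (theta_poly c (s - r))).
Proof.
case: s => [|s]; first by rewrite wick0 derivC big_nil.
apply/polyP => k; rewrite coef_deriv coef_wick theta_polyS coefN coef_primitive.
rewrite -[LHS]mulr_natr -mulrA mulNr divfK ?pnatr_eq0 //.
rewrite !coef_sum mulrN mulr_sumr -sumrN; apply: eq_big_nat => r /andP[r0 rs].
rewrite !coefZ !coefXnM; case: ltnP => kr; first by rewrite !mulr0 oppr0.
rewrite coef_wick (_ : k.+1 = (2 * r.+1 + (k - (2 * r).+1))%N); last lia.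
by rewrite sgn_halfD exprS; ring.
Qed.

End FourierProfile.

(** * Gaussian expectations of polynomials in the couplings *)

Section Density.
Context d d' (T : measurableType d) (Y : measurableType d') (R : realType)
  (mu : {measure set T -> \bar R}) (nu : {measure set Y -> \bar R}).
Variables (D : set T) (X : T -> Y) (W : T -> R).
Hypotheses (mD : measurable D) (mX : measurable_fun setT X) (mW : measurable_fun setT W).
Hypothesis W0 : forall w, 0 <= W w.
Hypothesis density : forall B : set Y, measurable B ->
  (\int[mu]_(w in D `&` X @^-1` B) (W w)%:E)%E = nu B.

Lemma measurable_preim (B : set Y) : measurable B -> measurable (X @^-1` B).
Proof. by move=> mB; rewrite -[X in measurable X]setTI; exact: mX. Qed.

Let integral_density_indic (B : set Y) : measurable B ->
  (\int[mu]_(w in D) (\1_B (X w) * W w)%:E = \int[nu]_x (\1_B x)%:E)%E.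
Proof.
move=> mB; have mXB := measurable_preim mB.
rewrite integral_indic // setIT -density // integral_mkcondr; apply: eq_integral => w _.
rewrite patchE indicE (_ : (X w \in B) = (w \in X @^-1` B)); last first.
  by apply/idP/idP; rewrite !inE.
by case: ifPn => _; rewrite ?mul1r ?mul0r.
Qed.

Import HBNNSimple.

Let integral_density_nnsfun (f : {nnsfun Y >-> R}) :
  (\int[mu]_(w in D) (f (X w) * W w)%:E = \int[nu]_x (f x)%:E)%E.
Proof.
have mind y : measurable_fun setT (fun x => \1_(f @^-1` [set y]) x : R).
  exact/measurable_indic/measurable_sfunP.
have mindX y : measurable_fun setT (fun w => \1_(f @^-1` [set y]) (X w) : R).
  exact: measurableT_comp (mind y) mX.
have y0 y x : 0 <= y * \1_(f @^-1` [set y]) x.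
  have := @nnfun_muleindic_ge0 _ _ R f y x.
  by rewrite -EFinM lee_fin.
pose rs : seq R := finmap.enum_fset (fset_set (range f)).
have fE x : f x = \sum_(y <- rs) y * \1_(f @^-1` [set y]) x.
  by rewrite fimfunE fsbig_finite.
transitivity (\sum_(y <- rs) (\int[nu]_x (y * \1_(f @^-1` [set y]) x)%:E))%E; last first.
  rewrite -ge0_integral_sum //.
  - by apply: eq_integral => x _; rewrite fE -sumEFin.
  - by move=> y; apply/measurable_EFinP; apply: measurable_funM.
  - by move=> y x _; rewrite lee_fin.
transitivity (\int[mu]_(w in D) (\sum_(y <- rs) (y * \1_(f @^-1` [set y]) (X w) * W w)%:E))%E.
  by apply: eq_integral => w _; rewrite fE mulr_suml -sumEFin.
rewrite ge0_integral_sum //.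
- apply: eq_big_seq => y /=; rewrite in_fset_set // inE => -[x _ <-].
  under eq_integral do rewrite -mulrA EFinM.
  under [RHS]eq_integral do rewrite EFinM.
  have mB := @measurable_sfunP _ _ _ _ f _ (measurable_set1 (f x)).
  rewrite !ge0_integralZl_EFin //.
  + by rewrite integral_density_indic.
  + exact/measurable_EFinP.
  + by move=> w _; rewrite lee_fin mulr_ge0.
  + apply/measurable_EFinP; apply: measurable_funM; apply: measurable_funTS => //; exact: mindX.
- move=> y; apply/measurable_EFinP; apply: measurable_funTS.
  by apply: measurable_funM => //; apply: measurable_funM => //; exact: mindX.
- by move=> y w _; rewrite lee_fin mulr_ge0.
Qed.

(** The weighted measure W mu on D is pushed by X to nu. The weight lets independent variables be
    integrated out one at a time, as it carries the product of the others. *)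
Lemma integral_density (g : Y -> R) : measurable_fun setT g -> (forall x, 0 <= g x) ->
  (\int[mu]_(w in D) (g (X w) * W w)%:E = \int[nu]_x (g x)%:E)%E.
Proof.
move=> mg g0; have mgE : measurable_fun setT (EFin \o g) by exact/measurable_EFinP.
pose f_ := nnsfun_approx measurableT mgE.
have gE0 x : [set: Y] x -> (0 <= (EFin \o g) x)%E by move=> _; rewrite /= lee_fin.
have cf x : (f_ n x)%:E @[n --> \oo] --> (g x)%:E.
  exact: (@cvg_nnsfun_approx _ _ _ setT measurableT _ mgE gE0 x).
have nf x : nondecreasing_seq (fun n => f_ n x).
  by move=> m n mn; have /lefP := nd_nnsfun_approx measurableT mgE mn; exact.
have mfX n : measurable_fun setT (fun w => f_ n (X w)).
  by apply: measurableT_comp mX.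
transitivity (limn (fun n => \int[mu]_(w in D) (f_ n (X w) * W w)%:E))%E.
  rewrite -monotone_convergence //.
  - apply: eq_integral => w _; apply/esym/cvg_lim => //.
    under eq_fun do rewrite EFinM.
    by rewrite EFinM; apply: cvgeZr.
  - by move=> n; apply/measurable_EFinP; apply: measurable_funTS; apply: measurable_funM.
  - by move=> n w _; rewrite lee_fin mulr_ge0.
  - by move=> w _ m n mn; rewrite lee_fin ler_wpM2r // nf.
under eq_fun do rewrite integral_density_nnsfun.
rewrite -monotone_convergence //.
- by apply: eq_integral => x _; apply/cvg_lim.
- by move=> n; exact/measurable_EFinP.
- by move=> n x _; rewrite lee_fin.
- by move=> x _ m n mn; rewrite lee_fin nf.
Qed.

End Density.

Lemma integral_normal_prob (R : realType) (g : R -> R) : tame g -> (forall x, 0 <= g x) ->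
  (\int[normal_prob 0 1]_x (g x)%:E = (gint g)%:E)%E.
Proof.
move=> tg g0; have [mg _] := tg.
rewrite -(@integral_density _ _ _ _ _ (@lebesgue_measure R) _ setT id (@rhoG R)) //.
- rewrite /gint /Rintegral fineK; last first.
    by apply: integrable_fin_num => //; exact: gauss_integrable.
  by apply: eq_integral => x _; rewrite mulrC.
- exact: measurable_rhoG.
- exact: rhoG_ge0.
- move=> B mB; rewrite setTI preimage_id /normal_prob.
  by apply: eq_integral => x _; rewrite rhoGE.
Qed.

(** * Expectations of products of functions of independent couplings *)

Section Independence.
Context d (Omega : measurableType d) (R : realType) (P : probability Omega R).
Variables (I : finType) (D : {set I}) (J : I -> {RV P >-> R}).
Hypothesis iid : iid_std_normal D J.

Let gamma : probability _ R := normal_prob (0 : R) 1.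

Lemma gint_ge0 (g : R -> R) : tame g -> (forall x, 0 <= g x) -> 0 <= gint g.
Proof. by move=> tg g0; rewrite -(@gint_cst R 0) gint_le //; exact: tame_cst. Qed.

Lemma measurable_prod_fun (A : {set I}) (g : I -> R -> R) :
  (forall i, measurable_fun setT (g i)) ->
  measurable_fun setT (fun w => \prod_(i in A) g i (J i w)).
Proof.
move=> mg; rewrite (_ : (fun w => _) = fun w => \prod_(i <- enum A) g i (J i w)); last first.
  by apply/funext => w; rewrite big_enum.
apply: measurable_prod => i _; apply: measurableT_comp (mg i) _; exact: measurable_funPT.
Qed.

(** Independence is given for events only, so events are traded for functions one index at a time.
    Keeping a cylinder as domain of integration makes the induction hypothesis say that the law of
    [J i], weighted by the other factors, is a multiple of the Gaussian; then [integral_density]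
    applies. *)
Lemma integral_prod_cylinder (A B : {set I}) (g : I -> R -> R) (E : I -> set R) :
  (A \subset D)%SET -> (B \subset D)%SET -> A :&: B = finset.set0 ->
  (forall i, tame (g i)) -> (forall i x, 0 <= g i x) -> (forall i, measurable (E i)) ->
  (\int[P]_(w in \bigcap_(i in [set` B]) (J i @^-1` E i)) (\prod_(i in A) g i (J i w))%:E =
   (\prod_(i in A) gint (g i))%:E * \prod_(i in B) gamma (E i))%E.
Proof.
have [n] := ubnP #|A|; elim: n A B E => // n IH A B E; rewrite ltnS => An AD BD dAB tg g0 mE.
have mcap (B' : {set I}) (E' : I -> set R) : (forall i, measurable (E' i)) ->
    measurable (\bigcap_(i in [set` B']) (J i @^-1` E' i)).
  move=> mE'; apply: fin_bigcap_measurable => // i _; exact: measurable_preim.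
have [A0|[i iA]] := set_0Vmem A.
  rewrite A0 big_set0 mul1e; under eq_integral do rewrite big_set0.
  rewrite integral_cst ?mul1e; last exact: mcap.
  apply: etrans (iid.1 B E BD mE) _; apply: eq_bigr => i iB.
  by rewrite iid.2 //; exact: (fintype.subsetP BD).
have iB : i \notin B.
  by apply/negP => iB; have := finset.in_set0 i; rewrite -dAB inE iA iB.
pose W w := \prod_(j in A :\ i) g j (J j w).
pose kappa := \prod_(j in A :\ i) gint (g j) * \prod_(j in B) fine (gamma (E j)).
have kappa0 : 0 <= kappa.
  by rewrite mulr_ge0 // prodr_ge0 // => j _; [exact: gint_ge0 | exact: fine_ge0].
have gammaE (B' : {set I}) (E' : I -> set R) : (forall j, measurable (E' j)) ->
    (\prod_(j in B') gamma (E' j))%E = (\prod_(j in B') fine (gamma (E' j)))%:E.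
  move=> mE'; rewrite -prodEFin; apply: eq_bigr => j _.
  by rewrite fineK //; apply: fin_num_measure; exact: mE'.
have dens (F : set (measurableTypeR R)) : measurable F ->
    (\int[P]_(w in \bigcap_(j in [set` B]) (J j @^-1` E j) `&` J i @^-1` F) (W w)%:E =
     mscale (NngNum kappa0) gamma F)%E.
  move=> mF; pose E' j : set R := if j == i then F else E j.
  have mE' j : measurable (E' j) by rewrite /E'; case: ifP => _; [exact: mF | exact: mE].
  have -> : \bigcap_(j in [set` B]) (J j @^-1` E j) `&` J i @^-1` F =
      \bigcap_(j in [set` (i |: B)%SET]) (J j @^-1` E' j).
    apply/seteqP; split => w /=.
      move=> [H1 H2] j /=; rewrite /E' in_setU1; case: eqP => [-> _ //|_ /= jB]; exact: H1.
    move=> H; split=> [j /= jB|].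
      have := H j; rewrite /= /E' in_setU1 jB orbT => /(_ isT); case: eqP => // ji.
      by rewrite -ji jB in iB.
    by have := H i; rewrite /= /E' in_setU1 eqxx => /(_ isT).
  rewrite IH //.
  - rewrite gammaE // -EFinM /mscale /= -[gamma F]fineK; last exact: fin_num_measure.
    rewrite -EFinM.
    congr EFin; rewrite big_setU1 //= /E' eqxx /kappa mulrAC mulrA.
    congr (_ * _); apply: eq_bigr => j jB; case: eqP => // ji.
    by rewrite -ji jB in iB.
  - by move: An; rewrite (cardsD1 i) iA.
  - by apply: fintype.subset_trans AD; exact: finset.subsetDl.
  - by rewrite finset.subUset finset.sub1set (fintype.subsetP AD _ iA) BD.
  - apply/finset.setP => j; rewrite !inE; case: eqP => //= _.
    by have := finset.in_set0 j; rewrite -dAB inE => ->.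
rewrite (big_setD1 i) //=; under eq_integral do rewrite (big_setD1 i) //=.
rewrite (@integral_density _ _ _ (measurableTypeR R) _ P _ _ (J i) W _ _ _ _ dens); last first.
- exact: g0.
- by case: (tg i).
- by move=> w; apply: prodr_ge0.
- by apply: measurable_prod_fun => j; case: (tg j).
- exact: (@measurable_funPT _ _ _ _ (J i)).
- exact: mcap.
rewrite ge0_integral_mscale //; last 2 first.
  by apply/measurable_EFinP; case: (tg i).
  by move=> x _; rewrite lee_fin.
rewrite integral_normal_prob // gammaE // -!EFinM /=; congr EFin; rewrite /kappa; ring.
Qed.

Lemma integral_prod_ge0 (A : {set I}) (g : I -> R -> R) : (A \subset D)%SET ->
  (forall i, tame (g i)) -> (forall i x, 0 <= g i x) ->
  (\int[P]_w (\prod_(i in A) g i (J i w))%:E = (\prod_(i in A) gint (g i))%:E)%E.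
Proof.
move=> AD tg g0.
have := @integral_prod_cylinder A finset.set0 g (fun=> setT) AD (finset.sub0set _) (finset.setI0 _) tg g0.
rewrite big_set0 mule1 => <- //; rewrite (_ : \bigcap_(i in _) _ = setT) //.
by apply/seteqP; split => // w _ i /=; rewrite finset.in_set0.
Qed.

Lemma tame_norm (g : R -> R) : tame g -> tame (fun x => `|g x|).
Proof.
move=> [mg [C [c [C0 c0 gC]]]]; split; first exact: measurableT_comp.
by exists C, c; split=> // x; rewrite normr_id.
Qed.

Lemma integrable_prod (A : {set I}) (g : I -> R -> R) : (A \subset D)%SET ->
  (forall i, tame (g i)) ->
  P.-integrable setT (EFin \o (fun w => \prod_(i in A) g i (J i w))).
Proof.
move=> AD tg; apply/integrableP; split.
  by apply/measurable_EFinP/measurable_prod_fun => i; case: (tg i).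
under eq_integral do rewrite /= normr_prod.
rewrite (@integral_prod_ge0 A (fun i x => `|g i x|)) ?ltry // => i.
exact: tame_norm.
Qed.

Lemma expect_prod (A : {set I}) (g : I -> R -> R) : (A \subset D)%SET ->
  (forall i, tame (g i)) ->
  \int[P]_w (\prod_(i in A) g i (J i w)) = \prod_(i in A) gint (g i).
Proof.
(* The induction is on the number of factors that take negative values; each is replaced by its
   positive and its negative part. *)
move=> AD; have [n] := ubnP #|[set i in A | ~~ `[< forall x, 0 <= g i x >]]|%SET.
elim: n g => // n IH g; rewrite ltnS => gn tg.
set C := [set i in A | _]%SET in gn.
have [C0|[i iC]] := set_0Vmem C.
  have g0 i x : i \in A -> 0 <= g i x.
    move=> iA; have := finset.in_set0 i; rewrite -C0 inE iA /= => /negbFE /asboolP; exact.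
  have E (f : I -> R -> R) : (forall i x, i \in A -> f i x = `|g i x|) ->
      \prod_(i in A) gint (f i) = \prod_(i in A) gint (fun x => `|g i x|).
    by move=> fE; apply: eq_bigr => i iA; apply: eq_gint => x; exact: fE.
  rewrite (E g) => [|i x iA]; last by rewrite ger0_norm ?g0.
  have := @integral_prod_ge0 A (fun i x => `|g i x|) AD (fun i => tame_norm (tg i)) (fun i x => normr_ge0 _).
  rewrite /Rintegral => /(congr1 fine) /= <-; congr fine; apply: eq_integral => w _.
  by congr EFin; apply: eq_bigr => i iA; rewrite ger0_norm ?g0.
move: iC; rewrite inE => /andP[iA /asboolPn gi].
pose pos (x : R) : R := (`|g i x| + g i x) / 2; pose neg (x : R) : R := (`|g i x| - g i x) / 2.
pose gp j := if j == i then pos else g j; pose gm j := if j == i then neg else g j.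
have tpos : tame pos.
  by rewrite /pos; under eq_fun do rewrite mulrC; apply: tameZ; apply: tameD => //; exact: tame_norm.
have tneg : tame neg.
  by rewrite /neg; under eq_fun do rewrite mulrC; apply: tameZ; apply: tameB => //; exact: tame_norm.
have tgp j : tame (gp j) by rewrite /gp; case: ifP.
have tgm j : tame (gm j) by rewrite /gm; case: ifP.
have lt_card (h : R -> R) : (forall x, 0 <= h x) ->
    (#|[set j in A | ~~ `[< forall x, (0 <= (if j == i then h else g j) x)%R >]]%SET| < n)%N.
  move=> h0; apply: leq_trans gn; rewrite (cardsD1 i C) inE iA /= (introF (asboolP _)) //= add1n ltnS.
  apply: subset_leq_card; apply/fintype.subsetP => j; rewrite !inE; case: eqP => [->|//].
  by rewrite (introT (asboolP _)) // andbF.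
have pos0 x : 0 <= pos x by rewrite divr_ge0 // -lerBlDr sub0r -normrN ler_norm.
have neg0 x : 0 <= neg x by rewrite divr_ge0 // subr_ge0 ler_norm.
have split_prod w : \prod_(j in A) g j (J j w) =
    \prod_(j in A) gp j (J j w) - \prod_(j in A) gm j (J j w).
  rewrite !(big_setD1 i iA) /= /gp /gm eqxx.
  have E h : \prod_(j in A :\ i) (if j == i then h else g j) (J j w) = \prod_(j in A :\ i) g j (J j w).
    by apply: eq_bigr => j; rewrite !inE => /andP[/negPf ->].
  rewrite !E -mulrBl; congr (_ * _); rewrite /pos /neg; by field.
under eq_Rintegral do rewrite split_prod.
rewrite RintegralB //; try exact: integrable_prod.
rewrite !IH //; try exact: lt_card.
rewrite !(big_setD1 i iA) /= /gp /gm eqxx.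
have E h : \prod_(j in A :\ i) gint (if j == i then h else g j) = \prod_(j in A :\ i) gint (g j).
  by apply: eq_bigr => j; rewrite !inE => /andP[/negPf ->].
rewrite !E -mulrBl -gintB //; congr (_ * _); apply: eq_gint => x; rewrite /pos /neg; by field.
Qed.

End Independence.

Lemma meval_sum (n : nat) (K : comNzRingType) (x : 'I_n -> K) (T : Type) (r : seq T) (Q : pred T)
    (F : T -> mpoly n K) :
  meval x (\sum_(k <- r | Q k) F k) = \sum_(k <- r | Q k) meval x (F k).
Proof. by apply: big_morph; [exact: mevalD | exact: meval0]. Qed.

Lemma mderiv_sum (n : nat) (K : nzRingType) (i : 'I_n) (T : Type) (r : seq T) (Q : pred T)
    (F : T -> mpoly n K) :
  mderiv i (\sum_(k <- r | Q k) F k) = \sum_(k <- r | Q k) mderiv i (F k).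
Proof. by apply: big_morph; [exact: mderivD | exact: mderiv0]. Qed.

(** * The Poincare inequality from integration by parts alone *)

Section GaussPoincare.
Local Open Scope complex_scope.
Local Open Scope ring_scope.
Variables (R : realType) (n : nat).
Local Notation C := R[i].
Local Notation poly := (mpoly n C).
Local Notation X i := (@mpolyX n C (mnm1 i)).
Local Notation conjp := (@map_mpoly n C C (@conjc R)).
Implicit Types (p q : poly) (i j : 'I_n).

Lemma mderivXU i j : mderiv j (X i) = (i == j)%:R.
Proof.
rewrite mderivX mnm1E; case: eqVneq => [->|_]; last by rewrite scale0r.
rewrite scale1r (_ : mnm_sub _ _ = mnm0) ?mpolyX0 //.
by apply/mnmP => k; rewrite mnmBE mnm0E subnn.
Qed.

(** Integration by parts replaces multiplication by a variable by the derivative, so the step needs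
    the claim for a monomial and for its derivative. *)
Lemma mpoly_deriv_ind (Q : poly -> Prop) : Q 1 ->
  (forall p q, Q p -> Q q -> Q (p + q)) -> (forall c p, Q p -> Q (c *: p)) ->
  (forall i m, Q (mpolyX C m) -> Q (mderiv i (mpolyX C m)) -> Q (X i * mpolyX C m)) ->
  forall p, Q p.
Proof.
move=> Q1 QD QZ QX; have Q0 : Q 0 by rewrite -(scale0r (1 : poly)); exact: QZ.
suff Qm m : Q (mpolyX C m).
  by move=> p; rewrite (mpolyE p); apply: (big_ind Q) => // m _; exact: QZ.
have [k] := ubnP (mdeg m); elim: k m => // k IH m; rewrite ltnS => mk.
have [->|m0] := eqVneq m mnm0; first by rewrite mpolyX0.
have [i mi] : exists i, m i != 0%N.
  apply/existsP; apply: contraNT m0; rewrite negb_exists => /forallP H.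
  by apply/eqP/mnmP => i; rewrite mnm0E; apply/eqP/negPn.
have dm : mdeg (mnm_sub m (mnm1 i)) = (mdeg m).-1.
  have E : mnm_add (mnm1 i) (mnm_sub m (mnm1 i)) = m.
    by apply/mnmP => j; rewrite mnmDE mnmBE mnm1E; case: eqVneq => [<-|_]; lia.
  by rewrite -{2}E mdegD mdeg1.
have E : mnm_add (mnm1 i) (mnm_sub m (mnm1 i)) = m.
  by apply/mnmP => j; rewrite mnmDE mnmBE mnm1E; case: eqVneq => [<-|_]; lia.
have lt_m : (mdeg (mnm_sub m (mnm1 i)) < k)%N.
  rewrite dm; apply: leq_trans mk; rewrite prednK //.
  by rewrite lt0n mdeg_eq0.
rewrite -E mpolyXD; apply: QX; first exact: IH.
rewrite mderivX; apply: QZ; apply: IH; apply: leq_ltn_trans lt_m.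
exact: mdegB.
Qed.

Variable E : {linear poly -> C | *%R}.
Hypotheses (E1 : E 1 = 1) (Eibp : forall i p, E (X i * p) = E (mderiv i p))
  (Econj : forall p, E (conjp p) = (E p)^*%C).

(** The contraction of the expected k-th gradients of [p] and [q]; divided by k! it is the bilinear
    pairing of their components in the k-th Wiener chaos. *)
Fixpoint corr k p q : C :=
  if k is k'.+1 then \sum_i corr k' (mderiv i p) (mderiv i q) else E p * E q.

Lemma corrDl k p p' q : corr k (p + p') q = corr k p q + corr k p' q.
Proof.
elim: k p p' q => [|k IH] p p' q /=; first by rewrite raddfD mulrDl.
by rewrite -big_split; apply: eq_bigr => i _; rewrite mderivD IH.
Qed.

Lemma corrZl k c p q : corr k (c *: p) q = c * corr k p q.
Proof.
elim: k p q => [|k IH] p q /=; first by rewrite linearZ mulrA.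
by rewrite mulr_sumr; apply: eq_bigr => i _; rewrite mderivZ IH.
Qed.

Lemma corr0l k q : corr k 0 q = 0.
Proof. by rewrite -(scale0r (0 : poly)) corrZl mul0r. Qed.

Lemma corr_1l k q : corr k 1 q = (k == 0%N)%:R * E q.
Proof.
case: k => [|k] /=; first by rewrite E1.
by rewrite mul0r big1 // => i _; rewrite -mpolyC1 mderivC corr0l.
Qed.

Lemma corr_mulX k i p q : corr k.+1 (X i * p) q =
  k.+1%:R * corr k p (mderiv i q) + corr k.+1 (mderiv i p) q.
Proof.
have pick f : \sum_j (i == j)%:R * f j = f i :> C.
  rewrite (bigD1 i) //= eqxx mul1r big1 ?addr0 // => j ji.
  by rewrite eq_sym (negPf ji) mul0r.
elim: k p q => [|k IH] p q.
  rewrite mul1r /= -(pick (fun j => E p * E (mderiv j q))) -big_split.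
  apply: eq_bigr => j _; rewrite mderivM mderivXU raddfD /= Eibp mderiv_comm mulrDl; congr (_ + _).
  by case: (i == j); rewrite ?mul1r // !mul0r raddf0 mul0r.
rewrite -natr1 mulrDl mul1r.
transitivity (\sum_j corr k.+1 (mderiv j (X i * p)) (mderiv j q)); first by [].
transitivity (\sum_j ((i == j)%:R * corr k.+1 p (mderiv j q) +
    (k.+1%:R * corr k (mderiv j p) (mderiv i (mderiv j q)) +
     corr k.+1 (mderiv i (mderiv j p)) (mderiv j q)))).
  apply: eq_bigr => j _; rewrite mderivM mderivXU corrDl IH; congr (_ + _).
  by case: (i == j); rewrite ?mul1r // !mul0r corr0l.
rewrite big_split pick big_split -mulr_sumr.
have -> : \sum_j corr k (mderiv j p) (mderiv i (mderiv j q)) = corr k.+1 p (mderiv i q).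
  by apply: eq_bigr => j _; rewrite mderiv_comm.
apply: etrans (addrA _ _ _) _; congr (_ + _); first exact: addrC.
by apply: eq_bigr => j _; rewrite mderiv_comm.
Qed.

Definition corr_sum K p q := \sum_(k < K) corr k p q / k`!%:R.

(** The chaos expansion of E(pq). Only finitely many derivatives of a polynomial are nonzero, so
    every long enough truncation is exact, with a length that does not depend on [q]. *)
Lemma expect_mul_corr p :
  exists K0, forall K, (K0 <= K)%N -> forall q, E (p * q) = corr_sum K p q.
Proof.
elim/mpoly_deriv_ind: p.
- exists 1%N => -[//|K] _ q; rewrite mul1r /corr_sum big_ord_recl big1 ?addr0.
    by rewrite /= E1 mul1r fact0 divr1.
  by move=> k _; rewrite corr_1l mul0r mul0r.
- move=> p p' [K1 H1] [K2 H2]; exists (maxn K1 K2) => K; rewrite geq_max => /andP[k1 k2] q.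
  rewrite mulrDl raddfD /= (H1 K) // (H2 K) // -big_split; apply: eq_bigr => k _.
  by rewrite corrDl mulrDl.
- move=> c p [K0 H]; exists K0 => K KK q; rewrite -scalerAl linearZ /= (H K) // mulr_sumr.
  by apply: eq_bigr => k _; rewrite corrZl mulrA.
- move=> i m; move: (mpolyX C m) => p [K1 H1] [K2 H2].
  exists (maxn K1 K2).+1 => -[//|K]; rewrite ltnS geq_max => /andP[k1 k2] q.
  rewrite -mulrA Eibp mderivM raddfD /= (H2 K.+1) ?(leq_trans k2) // (H1 K) //.
  have c0 : corr 0 (X i * p) q = E (mderiv i p) * E q by rewrite /= Eibp.
  rewrite /corr_sum 2!big_ord_recl [Y in _ = Y / _ + _]c0 -addrA; congr (_ + _).
  rewrite -big_split; apply: eq_bigr => k _; rewrite !lift0 corr_mulX mulrDl addrC.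
  congr (_ + _); rewrite factS natrM invfM mulrACA divff ?mul1r // pnatr_eq0.
Qed.

Lemma mderiv_conj i p : mderiv i (conjp p) = conjp (mderiv i p).
Proof.
apply/mpolyP => m; rewrite mcoeff_map_mpoly !mcoeff_deriv mcoeff_map_mpoly.
by rewrite raddfMn.
Qed.

Lemma corr_ge0 k p : 0 <= corr k p (conjp p).
Proof.
elim: k p => [|k IH] p /=; first by rewrite Econj -sqr_normc exprn_ge0.
by apply: sumr_ge0 => i _; rewrite mderiv_conj.
Qed.

Lemma gauss_variance_ge0 p : 0 <= E (p * conjp p) - `|E p| ^+ 2.
Proof.
have [K H] := expect_mul_corr p.
have rw (a x c : C) : a = x + c -> 0 <= c -> 0 <= a - x.
  by move=> -> c0; rewrite addrAC subrr add0r.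
apply: (rw _ _ (\sum_(k < K) corr k.+1 p (conjp p) / k.+1`!%:R)).
  apply: etrans (H K.+1 (leqnSn _) (conjp p)) _.
  by rewrite /corr_sum big_ord_recl fact0 divr1 sqr_normc -Econj.
by apply: sumr_ge0 => k _; rewrite divr_ge0 ?corr_ge0 ?ler0n.
Qed.

(** Both sides have chaos expansions with the same nonnegative terms [corr k.+1]; the variance
    weighs them by 1/(k+1)! and the gradient by 1/k!. *)
Theorem gauss_poincare p :
  E (p * conjp p) - `|E p| ^+ 2 <= \sum_i E (mderiv i p * conjp (mderiv i p)).
Proof.
have [K H] := expect_mul_corr p.
have [K' H'] : exists K', forall i, forall K, (K' <= K)%N -> forall q,
    E (mderiv i p * q) = corr_sum K (mderiv i p) q.
  have /choice[f Hf] : forall i, exists K0, forall K, (K0 <= K)%N -> forall q,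
    E (mderiv i p * q) = corr_sum K (mderiv i p) q by move=> i; exact: expect_mul_corr.
  exists (\max_i f i)%N => i K0 fK; apply: Hf; apply: leq_trans fK.
  exact: leq_bigmax.
set L := maxn K K'.
have lhsE : E (p * conjp p) = `|E p| ^+ 2 +
    \sum_(k < L) corr k.+1 p (conjp p) / k.+1`!%:R.
  apply: etrans (H L.+1 (leqW (leq_maxl _ _)) (conjp p)) _.
  by rewrite /corr_sum big_ord_recl fact0 divr1 sqr_normc -Econj.
have rhsE : \sum_i E (mderiv i p * conjp (mderiv i p)) =
    \sum_(k < L) \sum_i corr k (mderiv i p) (conjp (mderiv i p)) / k`!%:R.
  apply: etrans (exchange_big _ _ _ _ _ _); apply: eq_bigr => i _.
  exact: (H' i L (leq_maxr _ _)).
have rw (a b c d x : C) : a = x + c -> b = d -> c <= d -> a - x <= b.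
  by move=> -> -> cd; rewrite addrAC subrr add0r.
apply: (rw _ _ _ _ _ lhsE rhsE); apply: ler_sum => k _.
have -> : corr k.+1 p (conjp p) = \sum_i corr k (mderiv i p) (conjp (mderiv i p)).
  by apply: eq_bigr => i _; rewrite mderiv_conj.
rewrite mulr_suml; apply: ler_sum => i _; rewrite ler_wpM2l ?corr_ge0 //.
by rewrite lef_pV2 ?posrE ?ltr0n ?fact_gt0 // ler_nat factS leq_pmull.
Qed.

End GaussPoincare.

(** * The expectation of polynomials in the couplings *)

Section Expectation.
Local Open Scope complex_scope.
Local Open Scope ring_scope.
Context d (Omega : measurableType d) (R : realType) (P : probability Omega R).
Variables (I : finType) (D : {set I}) (J : I -> {RV P >-> R}).
Hypothesis iid : iid_std_normal D J.
Local Notation C := R[i].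
Local Notation Re := complex.Re.
Local Notation Im := complex.Im.
Local Notation poly := (mpoly #|D| C).
Local Notation X i := (@mpolyX #|D| C (mnm1 i)).
Local Notation conjp := (@map_mpoly #|D| C C (@conjc R)).
Implicit Types (p q : poly) (m : multinom #|D|) (f g : Omega -> R).

Definition rintegrable f := P.-integrable setT (EFin \o f).

Lemma rintegrableD f g : rintegrable f -> rintegrable g -> rintegrable (fun w => f w + g w).
Proof. by move=> fi gi; have := integrableD measurableT fi gi; apply: eq_integrable. Qed.

Lemma rintegrableZ (c : R) f : rintegrable f -> rintegrable (fun w => c * f w).
Proof. by move=> fi; have := integrableZl measurableT c fi; apply: eq_integrable. Qed.

Lemma rintegrableB f g : rintegrable f -> rintegrable g -> rintegrable (fun w => f w - g w).
Proof. by move=> fi gi; have := integrableB measurableT fi gi; apply: eq_integrable. Qed.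

Definition cexpect (F : Omega -> C) : C := (\int[P]_w Re (F w)) +i* (\int[P]_w Im (F w)).

Definition cintegrable (F : Omega -> C) :=
  rintegrable (fun w => Re (F w)) /\ rintegrable (fun w => Im (F w)).

Lemma eq_cexpect (F G : Omega -> C) : F =1 G -> cexpect F = cexpect G.
Proof. by move=> /funext ->. Qed.

Lemma cintegrableD (F G : Omega -> C) : cintegrable F -> cintegrable G ->
  cintegrable (fun w => F w + G w).
Proof.
move=> [F1 F2] [G1 G2]; split; [have := rintegrableD F1 G1 | have := rintegrableD F2 G2];
  by apply: eq_integrable => // w _ /=; case: (F w) (G w) => ? ? [].
Qed.

Lemma cintegrableZ (c : C) (F : Omega -> C) : cintegrable F -> cintegrable (fun w => c * F w).
Proof.
move=> [F1 F2]; split.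
  have := rintegrableB (rintegrableZ (Re c) F1) (rintegrableZ (Im c) F2).
  by apply: eq_integrable => // w _ /=; case: c (F w) => ? ? [].
have := rintegrableD (rintegrableZ (Re c) F2) (rintegrableZ (Im c) F1).
by apply: eq_integrable => // w _ /=; case: c (F w) => ? ? [].
Qed.

Lemma cexpectD (F G : Omega -> C) : cintegrable F -> cintegrable G ->
  cexpect (fun w => F w + G w) = cexpect F + cexpect G.
Proof.
move=> [F1 F2] [G1 G2]; apply/eqP; rewrite eq_complex /= -!RintegralD //.
by apply/andP; split; apply/eqP; apply: eq_Rintegral => w _; case: (F w) (G w) => ? ? [].
Qed.

Lemma cexpectZ (c : C) (F : Omega -> C) : cintegrable F ->
  cexpect (fun w => c * F w) = c * cexpect F.
Proof.
move=> [F1 F2]; case: c => a b; apply/eqP; rewrite eq_complex /= -!RintegralZl //.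
rewrite -RintegralB -?RintegralD //; try exact: rintegrableZ.
by apply/andP; split; apply/eqP; apply: eq_Rintegral => w _; case: (F w).
Qed.

Definition coupling w (i : 'I_#|D|) : C := (J (enum_val i) w)%:C.

Definition coupling_mono m w : R := \prod_(i < #|D|) J (enum_val i) w ^+ m i.

(** The variables of the polynomials are ranks in [D], while [expect_prod] indexes by labels. The
    sum in the exponent has one term if [A] is in [D] and none otherwise. *)
Definition mono_fun m (A : I) (x : R) : R := x ^+ (\sum_(i < #|D| | enum_val i == A) m i).

Lemma mono_fun_enum m i : mono_fun m (enum_val i) = fun x => x ^+ m i.
Proof.
apply/funext => x; rewrite /mono_fun (eq_bigl (pred1 i)) ?big_pred1_eq // => j /=.
by rewrite (inj_eq enum_val_inj).
Qed.

Lemma coupling_monoE m w : coupling_mono m w = \prod_(A in D) mono_fun m A (J A w).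
Proof. by rewrite [RHS]big_enum_val; apply: eq_bigr => i _; rewrite mono_fun_enum. Qed.

Lemma meval_coupling_mono m w : meval (coupling w) (mpolyX C m) = (coupling_mono m w)%:C.
Proof. by rewrite mevalX rmorph_prod; apply: eq_bigr => i _; rewrite rmorphXn. Qed.

Lemma tame_mono_fun m A : tame (mono_fun m A). Proof. exact: tameX. Qed.

Lemma rintegrable0 : rintegrable (fun=> 0).
Proof. exact: integrable0. Qed.

Lemma cintegrable_meval p : cintegrable (fun w => meval (coupling w) p).
Proof.
rewrite (mpolyE p); set Q := fun q : poly => cintegrable (fun w => meval (coupling w) q).
apply: (big_ind Q) => [|q q' Hq Hq'|m _]; rewrite /Q.
- by under eq_fun do rewrite meval0; split; exact: rintegrable0.
- by under eq_fun do rewrite mevalD; exact: cintegrableD.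
- under eq_fun do rewrite mevalZ meval_coupling_mono; apply: cintegrableZ.
  split; last exact: rintegrable0.
  by under eq_fun do rewrite coupling_monoE; apply: (integrable_prod iid) => // A; exact: tame_mono_fun.
Qed.

Definition pexpect p : C := cexpect (fun w => meval (coupling w) p).

Lemma pexpect_is_additive : additive pexpect.
Proof.
move=> p q; rewrite /pexpect -[- cexpect _]mulN1r -cexpectZ -?cexpectD; try exact: cintegrable_meval.
  by apply: eq_cexpect => w; rewrite mevalB mulN1r.
by apply: cintegrableZ; exact: cintegrable_meval.
Qed.

Lemma pexpect_is_scalable : scalable_for *%R pexpect.
Proof.
move=> c p; rewrite /pexpect -cexpectZ; last exact: cintegrable_meval.
by apply: eq_cexpect => w; rewrite mevalZ.
Qed.

HB.instance Definition _ := GRing.isAdditive.Build poly C pexpect pexpect_is_additive.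
HB.instance Definition _ := GRing.isScalable.Build C poly C *%R pexpect pexpect_is_scalable.

Lemma pexpect_mono m : pexpect (mpolyX C m) = (\prod_(i < #|D|) gint (fun x : R => x ^+ m i))%:C.
Proof.
rewrite /pexpect (eq_cexpect (meval_coupling_mono m)) /cexpect /=.
rewrite Rintegral_cst // mul0r; congr (_ +i* 0).
under eq_Rintegral do rewrite coupling_monoE.
rewrite (expect_prod iid) //; last by move=> A; exact: tame_mono_fun.
by rewrite big_enum_val; apply: eq_bigr => i _; rewrite mono_fun_enum.
Qed.

Lemma pexpect1 : pexpect 1 = 1.
Proof.
rewrite -mpolyX0 pexpect_mono big1 // => i _; rewrite -[RHS](gint_cst 1).
by apply: eq_gint => x; rewrite mnm0E expr0.
Qed.

Lemma pexpect_ibp i p : pexpect (X i * p) = pexpect (mderiv i p).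
Proof.
rewrite (mpolyE p); set Q := fun q : poly => pexpect (X i * q) = pexpect (mderiv i q).
apply: (big_ind Q) => [|q q' Hq Hq'|m _]; rewrite /Q.
- by rewrite mulr0 mderiv0.
- by rewrite mulrDr mderivD !raddfD /= Hq Hq'.
rewrite -scalerAr mderivZ [LHS]pexpect_is_scalable [RHS]pexpect_is_scalable.
apply: (congr1 (GRing.mul _)).
rewrite -mpolyXD mderivX [RHS]pexpect_is_scalable !pexpect_mono.
rewrite (bigD1 i) // [\prod_(j < #|D|) gint (fun x : R => x ^+ mnm_sub m (mnm1 i) j)](bigD1 i) //= mnmDE mnmBE mnm1E eqxx add1n subn1.
have -> : \prod_(j < #|D| | j != i) gint (fun x : R => x ^+ mnm_add (mnm1 i) m j) =
    \prod_(j < #|D| | j != i) gint (fun x : R => x ^+ mnm_sub m (mnm1 i) j).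
  by apply: eq_bigr => j ji; rewrite mnmDE mnmBE mnm1E eq_sym (negPf ji) subn0.
rewrite !rmorphM mulrA; congr (_ * _).
(* For exponent 0 both sides vanish, one by the odd moment and the other by the factor [m i];
   exponent 1 and exponents at least 2 use the moment recursion. *)
case: (m i) => [|[|k]] /=.
- by rewrite mul0r (_ : gint _ = 0) //; exact: gint_odd_moment.
- by rewrite mul1r gint_expX mul1r.
- by rewrite gint_expX rmorphM rmorph_nat.
Qed.

Lemma meval_conj w p : meval (coupling w) (conjp p) = (meval (coupling w) p)^*%C.
Proof.
set Q := fun q : poly => meval (coupling w) (conjp q) = (meval (coupling w) q)^*%C.
rewrite (mpolyE p); apply: (big_ind Q) => [|q q' Hq Hq'|m _]; rewrite /Q.
- have -> : conjp 0 = 0 by exact: raddf0.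
  by rewrite meval0 conjc0.
- have -> : conjp (q + q') = conjp q + conjp q' by exact: raddfD.
  apply: etrans (mevalD _ _ _) _; apply: etrans (congr2 +%R Hq Hq') _.
  by apply: etrans (esym (raddfD (@conjc R) _ _)) _; congr conjc; exact/esym/mevalD.
- rewrite map_mpolyZ map_mpolyX !mevalZ meval_coupling_mono.
  by rewrite -[Y in _ * Y]conjc_real; exact/esym/(rmorphM (@conjc R)).
Qed.

Lemma pexpect_conj p : pexpect (conjp p) = (pexpect p)^*%C.
Proof.
rewrite /pexpect (eq_cexpect (fun w => meval_conj w p)) /cexpect; apply/eqP; rewrite eq_complex /=.
have [_ ip] := cintegrable_meval p.
apply/andP; split; apply/eqP; first by apply: eq_Rintegral => w _; case: (meval _ _).
rewrite -mulN1r -RintegralZl //; apply: eq_Rintegral => w _; case: (meval _ _) => a b /=.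
by rewrite mulN1r.
Qed.

Definition gauss_expect : {linear poly -> C | *%R} := pexpect.

Lemma coupling_poincare p : pexpect (p * conjp p) - `|pexpect p| ^+ 2 <=
  \sum_i pexpect (mderiv i p * conjp (mderiv i p)).
Proof.
by have := @gauss_poincare R #|D| gauss_expect pexpect1 pexpect_ibp pexpect_conj p.
Qed.

Lemma coupling_variance_ge0 p : 0 <= pexpect (p * conjp p) - `|pexpect p| ^+ 2.
Proof.
by have := @gauss_variance_ge0 R #|D| gauss_expect pexpect1 pexpect_ibp pexpect_conj p.
Qed.

Lemma pexpect_le p q : (forall w, meval (coupling w) p <= meval (coupling w) q) ->
  pexpect p <= pexpect q.
Proof.
move=> pq; rewrite /pexpect /cexpect lecE /=; apply/andP; split.
  by apply/eqP; apply: eq_Rintegral => w _; have := pq w; rewrite lecE => /andP[/eqP ->].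
have [p1 _] := cintegrable_meval p; have [q1 _] := cintegrable_meval q.
apply: le_Rintegral => // w _.
by have := pq w; rewrite lecE => /andP[].
Qed.

End Expectation.

(** * Wick expansion of the moments *)

Section Wick.
Local Open Scope complex_scope.
Local Open Scope ring_scope.
Variables (R : realType) (N q : nat).
Hypotheses (oN : ~~ odd N) (oq : ~~ odd q) (N_gt0 : (0 < N)%N).
Local Notation C := R[i].
Local Notation D := (2 ^ N./2)%N.
Local Notation M := #|qsubsets N q|.
Local Notation poly := (mpoly M C).
Local Notation X i := (@mpolyX M C (mnm1 i)).
Local Notation cmx := (map_mx (@mpolyC M C)).
Implicit Types (i j : 'I_M) (tau : sector) (L : nat -> option 'I_M) (s u : seq nat).

Definition coef : C := ((Num.sqrt 'C(N, q)%:R)^-1)%:C.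

Definition GamI i : 'M[C]_D := Gam R (enum_val i).

(** The Hamiltonian with the couplings as indeterminates, so that derivatives in the couplings are
    formal and expectations act on polynomials. *)
Definition formal_syk : 'M[poly]_D := \sum_i (mpolyC M coef * X i) *: cmx (GamI i).

(** [Some i] marks a position that already carries Gamma_i, and [None] one still occupied by H. A
    Wick contraction sets two positions to the same label. *)
Definition letter L p : 'M[poly]_D := if L p is Some i then cmx (GamI i) else formal_syk.

Definition word L s : 'M[poly]_D := \prod_(p <- s) letter L p.

Definition upd L x i : nat -> option 'I_M := fun p => if p == x then Some i else L p.

Definition ptrace tau (Y : 'M[poly]_D) : poly :=
  mpolyC M (D%:R^-1) * \tr (cmx (sector_weight R N tau) *m Y).

Definition dmx i (Y : 'M[poly]_D) : 'M[poly]_D := map_mx (mderiv i) Y.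

Lemma card_enum_val i : #|enum_val i| = q.
Proof. by have := enum_valP i; rewrite inE => /eqP. Qed.

Lemma odd_enum_val i : ~~ odd #|enum_val i|.
Proof. by rewrite card_enum_val. Qed.

Lemma dmxM i (Y Z : 'M[poly]_D) : dmx i (Y * Z) = dmx i Y * Z + Y * dmx i Z.
Proof.
apply/matrixP => a b; rewrite !mxE raddf_sum -big_split; apply: eq_bigr => c _.
by rewrite [LHS]mderivM !mxE.
Qed.

Lemma dmx_cmx i (A : 'M[C]_D) : dmx i (cmx A) = 0.
Proof. by apply/matrixP => a b; rewrite !mxE mderivC. Qed.

Lemma dmx_formal_syk i : dmx i formal_syk = mpolyC M coef *: cmx (GamI i).
Proof.
rewrite /formal_syk; apply/matrixP => a b; rewrite !mxE summxE raddf_sum (bigD1 i) //= big1 ?addr0.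
  by rewrite !mxE !mderivM !mderivC mderivXU eqxx mul0r add0r mulr0 addr0 mulr1.
move=> j ji; rewrite !mxE !mderivM !mderivC mderivXU eq_sym.
by rewrite eq_sym (negPf ji) !mul0r !mulr0 !addr0 mul0r.
Qed.

Lemma ptraceD tau Y Z : ptrace tau (Y + Z) = ptrace tau Y + ptrace tau Z.
Proof. by rewrite /ptrace mulmxDr mxtraceD mulrDr. Qed.

Lemma ptraceZ tau c Y : ptrace tau (c *: Y) = c * ptrace tau Y.
Proof. by rewrite /ptrace -scalemxAr mxtraceZ mulrCA. Qed.

Lemma ptrace0 tau : ptrace tau 0 = 0.
Proof. by rewrite /ptrace mulmx0 mxtrace0 mulr0. Qed.

Lemma ptrace_sum tau (J : Type) (r : seq J) (P : pred J) (F : J -> 'M[poly]_D) :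
  ptrace tau (\sum_(k <- r | P k) F k) = \sum_(k <- r | P k) ptrace tau (F k).
Proof. exact: (big_morph _ (ptraceD tau) (ptrace0 tau)). Qed.

Lemma mderiv_ptrace tau i Y : mderiv i (ptrace tau Y) = ptrace tau (dmx i Y).
Proof.
rewrite /ptrace mderiv_mulC; congr (_ * _).
rewrite /mxtrace raddf_sum; apply: eq_bigr => a _.
rewrite !mxE raddf_sum; apply: eq_bigr => b _.
by rewrite !mxE; exact: mderiv_mulC.
Qed.

Lemma meval_ptrace tau (v : 'I_M -> C) Y :
  meval v (ptrace tau Y) = ntrace tau (map_mx (meval v) Y).
Proof.
rewrite /ptrace mevalM mevalC /ntrace mulrC; congr (_ / _).
rewrite /mxtrace [LHS]raddf_sum; apply: eq_bigr => a _.
rewrite !mxE [LHS]raddf_sum; apply: eq_bigr => b _.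
by rewrite !mxE /= mevalM mevalC.
Qed.

Lemma ptrace_cmx tau (A : 'M[C]_D) : ptrace tau (cmx A) = mpolyC M (ntrace tau A).
Proof.
rewrite /ptrace /ntrace -map_mxM trace_map_mx mulrC.
exact/esym/(rmorphM (@mpolyC M C)).
Qed.

Lemma eq_word L L' s : {in s, L =1 L'} -> word L s = word L' s.
Proof. by move=> E; apply: eq_big_seq => p ps; rewrite /letter E. Qed.

Lemma word_cons L p s : word L (p :: s) = letter L p * word L s.
Proof. exact: big_cons. Qed.

Lemma mxscaleAl (c : poly) (A B : 'M[poly]_D) : c *: A * B = c *: (A * B).
Proof. exact/esym/scalemxAl. Qed.

Lemma mxscaleAr (c : poly) (A B : 'M[poly]_D) : A * (c *: B) = c *: (A * B).
Proof. exact/esym/scalemxAr. Qed.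

Lemma upd_neq L x i s : x \notin s -> word (upd L x i) s = word L s.
Proof.
move=> xs; apply: eq_word => p ps; rewrite /upd; case: eqP => // px.
by rewrite -px ps in xs.
Qed.

Lemma word_expand L s x : uniq s -> x \in s -> L x = None ->
  word L s = \sum_i (mpolyC M coef * X i) *: word (upd L x i) s.
Proof.
move=> + + Lx; elim: s => // p s IH /= /andP[ps us]; rewrite inE.
have [xp _|px /= xs] := eqVneq x p.
  subst p; have lp : letter L x = \sum_i (mpolyC M coef * X i) *: cmx (GamI i).
    by rewrite /letter Lx.
  rewrite word_cons lp mulr_suml; apply: eq_bigr => i _.
  have lx : letter (upd L x i) x = cmx (GamI i) by rewrite /letter /upd eqxx.
  by rewrite mxscaleAl [word (upd L x i) (x :: s)]word_cons lx upd_neq.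
rewrite word_cons IH // mulr_sumr; apply: eq_bigr => i _.
have lp : letter (upd L x i) p = letter L p by rewrite /letter /upd eq_sym (negPf px).
by rewrite [word (upd L x i) (p :: s)]word_cons lp mxscaleAr.
Qed.

Lemma dmx_word i L s : uniq s ->
  dmx i (word L s) = \sum_(y <- s | L y == None) mpolyC M coef *: word (upd L y i) s.
Proof.
elim: s => [_|p s IH /= /andP[ps us]].
  rewrite big_nil /word big_nil (_ : 1 = cmx 1%:M) ?dmx_cmx //.
  by apply/matrixP => a b; rewrite !mxE; case: eqP => _; rewrite ?mpolyC1 // mpolyC0.
have tl : letter L p * (\sum_(y <- s | L y == None) mpolyC M coef *: word (upd L y i) s) =
    \sum_(y <- s | L y == None) mpolyC M coef *: word (upd L y i) (p :: s).
  rewrite mulr_sumr [LHS]big_seq_cond [RHS]big_seq_cond; apply: eq_bigr => y /andP[ys _].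
  have lp : letter (upd L y i) p = letter L p.
    by rewrite /letter /upd; case: eqP => // py; rewrite py ys in ps.
  by rewrite mxscaleAr word_cons lp.
rewrite word_cons dmxM IH // tl big_cons; case: eqP => Lp.
  rewrite {1}/letter Lp dmx_formal_syk mxscaleAl; congr (_ *: _ + _).
  have lx : letter (upd L p i) p = cmx (GamI i) by rewrite /letter /upd eqxx.
  by rewrite [word (upd L p i) (p :: s)]word_cons lx upd_neq.
case E : (L p) => [j|]; last by case: Lp.
by rewrite {1}/letter E dmx_cmx mul0r add0r.
Qed.

Definition gword L s : 'M[C]_D := \prod_(p <- s) (if L p is Some i then GamI i else 1).

Definition antiI i j : bool := odd #|enum_val i :&: enum_val j|.

Definition antiL L i p : bool := if L p is Some j then antiI i j else false.

Lemma word_gword L s : (forall p, p \in s -> L p != None) -> word L s = cmx (gword L s).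
Proof.
move=> H; rewrite /gword (big_morph _ (@map_mxM _ _ (@mpolyC M C) _ _ _) (map_mx1 _ _)).
by apply: eq_big_seq => p /H; rewrite /letter; case: (L p).
Qed.

Lemma GamI_gword L i s : GamI i *m gword L s =
  (-1) ^+ (\sum_(p <- s) antiL L i p)%N *: (gword L s *m GamI i).
Proof.
elim: s => [|p s IH]; first by rewrite /gword !big_nil scale1r mul1mx mulmx1.
rewrite /gword !big_cons -/(gword L s) exprD -scalerA.
have -> : GamI i *m ((if L p is Some j then GamI j else 1) *m gword L s) =
    (-1) ^+ antiL L i p *: ((if L p is Some j then GamI j else 1) *m (GamI i *m gword L s)).
  rewrite /antiL; case: (L p) => [j|]; last by rewrite scale1r !mul1mx.
  by rewrite mulmxA Gam_comm ?odd_enum_val // -scalemxAl -signr_odd mulmxA.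
by rewrite IH -scalemxAr mulmxA.
Qed.

Lemma gword_cat L s t : gword L (s ++ t) = gword L s *m gword L t.
Proof. exact: big_cat. Qed.

(** Moving one of two equal letters next to the other costs a sign for each anticommuting letter in
    between, after which they square to 1. *)
Lemma gword_remove L i x y s1 s2 s3 : L x = Some i -> L y = Some i ->
  gword L (s1 ++ x :: s2 ++ y :: s3) =
  (-1) ^+ (\sum_(p <- s2) antiL L i p)%N *: gword L (s1 ++ s2 ++ s3).
Proof.
move=> Lx Ly; rewrite !gword_cat.
have cons p t : gword L (p :: t) = (if L p is Some j then GamI j else 1) *m gword L t.
  exact: big_cons.
rewrite cons Lx gword_cat cons Ly.
have -> : GamI i *m (gword L s2 *m (GamI i *m gword L s3)) =
    (GamI i *m gword L s2) *m GamI i *m gword L s3 by rewrite !mulmxA.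
rewrite GamI_gword -!scalemxAl -!mulmxA (mulmxA (GamI i) (GamI i)) Gam_sq // mul1mx.
by rewrite -scalemxAr.
Qed.

Local Notation chord := (chord 'I_M).
Implicit Types (V : seq chord) (v t : chord).

Fixpoint ends V : seq nat := if V is v :: V' then v.1.1 :: v.1.2 :: ends V' else [::].

Fixpoint assign V L : nat -> option 'I_M :=
  if V is v :: V' then assign V' (upd (upd L v.1.1 v.2) v.1.2 v.2) else L.

Lemma assign_notin V L p : p \notin ends V -> assign V L p = L p.
Proof.
elim: V L => //= v V IH L; rewrite !inE !negb_or => /and3P[p1 p2 pV].
by rewrite IH // /upd (negPf p1) (negPf p2).
Qed.

Lemma assign_some V L p : p \in ends V -> assign V L p != None.
Proof.
elim: V L => //= v V IH L; have [pV _|pV] := boolP (p \in ends V); first exact: IH.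
rewrite !inE (negPf pV) orbF assign_notin // /upd; case: (p == v.1.2) => //.
by rewrite orbF => ->.
Qed.

Lemma assign_in V L v : uniq (ends V) -> v \in V ->
  assign V L v.1.1 = Some v.2 /\ assign V L v.1.2 = Some v.2.
Proof.
elim: V L => //= t V IH L; rewrite !inE negb_or => /and3P[/andP[xy x] y uV].
case/predU1P=> [->|vV]; last exact: IH.
by rewrite !assign_notin // /upd !eqxx if_same.
Qed.

Definition inside v p := (v.1.1 < p < v.1.2)%N.

Lemma sum_ends v V (f : nat -> nat) : (forall t, t \in V -> f t.1.2 = f t.1.1) ->
  (\sum_(p <- ends V | inside v p) f p =
   \sum_(t <- V) (inside v t.1.1 + inside v t.1.2) * f t.1.1)%N.
Proof.
elim: V => [|t V IH] H; first by rewrite !big_nil.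
rewrite /= !big_cons IH => [|w wV]; last by apply: H; rewrite inE wV orbT.
by rewrite (H t) ?mem_head //; do 2 case: (inside v _); rewrite ?mul0n ?mul1n ?mulnDl ?addnA //;
  rewrite ?addn0 ?add0n ?mul1n.
Qed.

(** Chords cross when exactly one endpoint of one lies inside the other. A nested chord is met twice
    and its signs cancel, so only crossings contribute to the word. *)
Lemma odd_inside v t : v.1.1 != t.1.1 -> v.1.1 != t.1.2 -> v.1.2 != t.1.1 -> v.1.2 != t.1.2 ->
  (t.1.1 < t.1.2)%N -> odd (inside v t.1.1 + inside v t.1.2) = crossing v t.
Proof.
case: v t => [[x y] i] [[x' y'] j] /=; rewrite /inside /crossing /= oddD !oddb.
case: (ltngtP x x') => // h1; case: (ltngtP x y') => // h2; case: (ltngtP y x') => // h3;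
  case: (ltngtP y y') => // h4 _ _ _ _ h5 //=; lia.
Qed.

Lemma mem_ends v V : v \in V -> v.1.1 \in ends V /\ v.1.2 \in ends V.
Proof.
elim: V => //= t V IH; rewrite !inE; case/predU1P=> [->|/IH[-> ->]]; first by rewrite !eqxx orbT.
by rewrite !orbT.
Qed.

(** Removing the two letters of a chord [v] produces its row of signs, and the shorter word is
    treated by induction. The chords may come in any order. *)
Lemma gword_assign V L s : sorted ltn s -> perm_eq (ends V) s ->
  all (fun v => v.1.1 < v.1.2)%N V ->
  gword (assign V L) s = (diagram_sign R antiI V)%:C *: 1%:M.
Proof.
elim: V L s => [|v V IH] L s ss.
  move=> /perm_size /= /esym/size0nil -> _; rewrite /gword big_nil scale1r //.
move=> pV /= /andP[v12 vV]; have us : uniq s by apply: sorted_uniq ss; [exact: ltn_trans|exact: ltnn].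
have := us; rewrite -(perm_uniq pV) /= inE negb_or => /and3P[/andP[n12 n1] n2 uV].
have xs : v.1.1 \in s by rewrite -(perm_mem pV) mem_head.
have ys : v.1.2 \in s by rewrite -(perm_mem pV) !inE eqxx orbT.
set L' := assign (v :: V) L.
have [Lx Ly] : L' v.1.1 = Some v.2 /\ L' v.1.2 = Some v.2.
  by apply: assign_in; [rewrite (perm_uniq pV) | exact: mem_head].
have := ss; rewrite (sorted_pairwise ltn_trans).
case/splitPr: xs us pV ys ss => s1 t us pV ys ss; rewrite pairwise_cat /= => /and3P[a1 p1 /andP[xt pt]].
have yt : v.1.2 \in t.
  move: ys; rewrite mem_cat inE (gtn_eqF v12) /= => /orP[ys|//].
  have h : (v.1.2 < v.1.1)%N := allrelP a1 _ _ ys (mem_head _ _).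
  by rewrite ltnNge (ltnW v12) in h.
case/splitPr: yt us pV ss xt pt {ys} a1 => s2 s3 us pV ss xt; rewrite pairwise_cat /=.
move=> /and3P[a2 p2 /andP[yt p3]] a1.
rewrite (gword_remove _ _ _ Lx Ly).
have pV' : perm_eq (ends V) (s1 ++ s2 ++ s3).
  apply/permP => a; have /permP/(_ a) := pV; rewrite /= !count_cat /= !count_cat /=.
  move: (a v.1.1 : nat) (a v.1.2 : nat) (count a s1) (count a s2) (count a s3) => a1' a2' c1 c2 c3.
  by move: (count a (ends V)) => c0; clear; lia.
have ss' : sorted ltn (s1 ++ s2 ++ s3).
  apply: (subseq_sorted ltn_trans _ ss); apply: cat_subseq => //.
  apply: subseq_trans (subseq_cons _ _); apply: cat_subseq => //; exact: subseq_cons.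
rewrite (IH _ _ ss' pV' vV) scalerA; congr (_ *: _).
rewrite [RHS]rmorphM; congr (_ * _).
(* The positions are increasing, so those strictly between the ends of [v] are the ones in [s2];
   this turns a sum over letters into a sum over chord ends. *)
have -> : (\sum_(p <- s2) antiL L' v.2 p = \sum_(p <- ends V | inside v p) antiL L' v.2 p)%N.
  rewrite (perm_big _ pV') !big_cat /=.
  have -> : (\sum_(p <- s1 | inside v p) antiL L' v.2 p = 0)%N.
    rewrite big_seq_cond big1 // => p /andP[ps /andP[+ _]].
    have h : (p < v.1.1)%N := allrelP a1 _ _ ps (mem_head _ _).
    by rewrite ltnNge (ltnW h).
  have -> : (\sum_(p <- s3 | inside v p) antiL L' v.2 p = 0)%N.
    rewrite big_seq_cond big1 // => p /andP[ps /andP[_ +]].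
    have h : (v.1.2 < p)%N := allP yt _ ps.
    by rewrite ltnNge (ltnW h).
  rewrite add0n addn0 [LHS]big_seq [RHS]big_seq_cond; apply: eq_bigl => p.
  case ps: (p \in s2) => //=; apply/esym/andP; split.
    by apply: (allP xt); rewrite mem_cat ps.
  exact: (allrelP a2 _ _ ps (mem_head _ _)).
clear t; have aL t : t \in V -> antiL L' v.2 t.1.1 = antiI v.2 t.2 /\ antiL L' v.2 t.1.2 = antiI v.2 t.2.
  by move=> tV; rewrite /antiL /L' /=; have [-> ->] := assign_in (upd (upd L v.1.1 v.2) v.1.2 v.2) uV tV.
rewrite (@sum_ends v V (fun p => antiL L' v.2 p)) => [|t tV]; last by have [-> ->] := aL t tV.
rewrite (big_morph _ (exprD (-1)) (expr0 _)) [RHS]rmorph_prod; apply: eq_big_seq => t tV.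
have [-> _] := aL t tV; have [t1 t2] := mem_ends tV.
have oI : odd (inside v t.1.1 + inside v t.1.2) = crossing v t.
  apply: odd_inside; last exact: (allP vV).
  - by apply: contraNneq n1 => ->.
  - by apply: contraNneq n1 => ->.
  - by apply: contraNneq n2 => ->.
  - by apply: contraNneq n2 => ->.
rewrite /chord_sign rmorphXn rmorphN1 -signr_odd oddM oddb oI.
by case: (crossing v t); case: (antiI v.2 t.2).
Qed.

Lemma ntrace_gword_assign tau V L s : sorted ltn s -> perm_eq (ends V) s ->
  all (fun v => v.1.1 < v.1.2)%N V ->
  ntrace tau (gword (assign V L) s) = (diagram_sign R antiI V)%:C.
Proof. by move=> ss pV vV; rewrite gword_assign // ntraceZ ntrace1 // mulr1. Qed.

Lemma sum_pick_rem (T : eqType) (h : T -> seq T -> R) (r : seq T) : uniq r ->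
  sum_pick h r = \sum_(y <- r) h y (rem y r).
Proof.
elim: r h => [|y r IH] h /=; first by rewrite big_nil.
case/andP=> yr ur; rewrite big_cons eqxx IH //; congr (_ + _).
by apply: eq_big_seq => z zr; case: eqP => // yz; rewrite yz zr in yr.
Qed.

Lemma card_qsubsets : M = 'C(N, q).
Proof. by rewrite -[N in RHS]card_ord -card_draws; apply: eq_card => A; rewrite !inE. Qed.

Lemma coef_sq : coef * coef = (M%:R^-1)%:C.
Proof.
by rewrite /coef card_qsubsets -rmorphM -expr2 exprVn sqr_sqrtr ?ler0n.
Qed.

(** * Moments and cumulants of the model *)

Section Moments.
Context d (Omega : measurableType d) (P : probability Omega R).
Variable J : {set 'I_N} -> {RV P >-> R}.
Hypothesis iid : iid_std_normal (qsubsets N q) J.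
Local Notation pexp := (pexpect (D := qsubsets N q) J).

Definition wexp tau L s : C := pexp (ptrace tau (word L s)).

Lemma pexp_sum (T : Type) (r : seq T) (Q : pred T) (F : T -> poly) :
  pexp (\sum_(k <- r | Q k) F k) = \sum_(k <- r | Q k) pexp (F k).
Proof. exact: (raddf_sum (gauss_expect iid)). Qed.

Lemma pexpZ c (p : poly) : pexp (mpolyC M c * p) = c * pexp p.
Proof. by rewrite mul_mpolyC; exact: (pexpect_is_scalable iid). Qed.

Lemma pexpC c : pexp (mpolyC M c) = c.
Proof. by rewrite -[mpolyC M c]mulr1 pexpZ (pexpect1 iid) mulr1. Qed.

(** The H at [x] is expanded into couplings times Gamma_i, and integration by parts turns the
    coupling into a derivative, which hits each remaining H at some [y]. *)
Lemma wexp_expand tau L s x : uniq s -> x \in s -> L x = None ->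
  wexp tau L s = \sum_i coef * \sum_(y <- s | upd L x i y == None)
    coef * wexp tau (upd (upd L x i) y i) s.
Proof.
move=> us xs Lx; rewrite /wexp (word_expand us xs Lx) ptrace_sum pexp_sum.
apply: eq_bigr => i _; rewrite ptraceZ -mulrA pexpZ (pexpect_ibp iid) mderiv_ptrace.
rewrite (dmx_word _ _ us) ptrace_sum pexp_sum; congr (_ * _); apply: eq_bigr => y _.
by rewrite ptraceZ pexpZ.
Qed.

Lemma filter_upd L x i s :
  [seq p <- s | upd L x i p == None] = [seq p <- [seq p <- s | L p == None] | p != x].
Proof.
rewrite -filter_predI; apply: eq_filter => p /=.
by rewrite /upd; case: (p == x) => //=; rewrite andTb.
Qed.

(** Induction on the number of uncontracted positions: the first of them is contracted with each of
    the others. Only the values of completely contracted words enter, through [F]. *)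
Lemma wexp_match tau L (F : seq chord -> R) s : sorted ltn s ->
  (forall V, perm_eq (ends V) [seq p <- s | L p == None] -> all (fun v => v.1.1 < v.1.2)%N V ->
     wexp tau (assign V L) s = (F V)%:C) ->
  wexp tau L s = (sum_match F [seq p <- s | L p == None])%:C.
Proof.
move=> ss; have us : uniq s by apply: sorted_uniq ss; [exact: ltn_trans|exact: ltnn].
have [n] := ubnP (size [seq p <- s | L p == None]); elim: n L F => // n IH L F; rewrite ltnS.
case E : [seq p <- s | L p == None] => [|x u] un HF.
  by rewrite -(HF [::]).
have /andP[] : (x \in [seq p <- s | L p == None]) && true by rewrite E mem_head.
rewrite mem_filter => /andP[/eqP Lx xs] _.
have := filter_uniq (fun p => L p == None) us; rewrite E /= => /andP[xu uu].
have sxu : sorted ltn (x :: u) by rewrite -E; apply: sorted_filter ss; exact: ltn_trans.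
have fx i : [seq p <- s | upd L x i p == None] = u.
  rewrite filter_upd E /= eqxx /=; apply/all_filterP/allP => y yu.
  by apply: contraNneq xu => <-.
(* The two normalizations M^(-1/2) combine to 1/M and turn the sum over labels into [average]. *)
rewrite (wexp_expand tau us xs Lx) sum_match_cons sum_pick_average /average card_ord.
apply: etrans _ (esym (rmorphM (real_complex R) _ _)).
apply: etrans _ (congr1 (fun z => z * _) coef_sq).
rewrite rmorph_sum mulr_sumr; apply: eq_bigr => i _.
rewrite -mulrA; congr (_ * _); rewrite -big_filter fx -mulr_sumr; congr (_ * _).
rewrite sum_pick_rem // rmorph_sum; apply: eq_big_seq => y yu.
have fy : [seq p <- s | upd (upd L x i) y i p == None] = rem y u.
  by rewrite filter_upd fx rem_filter.
rewrite -fy; apply: IH; first by rewrite fy size_rem //; apply: leq_trans un; rewrite ltnS leq_pred.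
rewrite fy => V pV aV; rewrite -(HF ((x, y, i) :: V)) //=.
  by rewrite perm_cons perm_sym (perm_trans (perm_to_rem yu)) // perm_cons perm_sym.
rewrite aV andbT; have := sxu; rewrite /= (path_sortedE ltn_trans) => /andP[/allP/(_ y yu)].
by [].
Qed.

(** The right side is free of [tau]: a completely contracted word is plus or minus the identity,
    whose normalized trace is 1 in each sector. *)
Lemma wexp_match_sum tau s : sorted ltn s ->
  wexp tau (fun=> None) s = (match_sum R antiI s)%:C.
Proof.
move=> ss; rewrite -[Y in match_sum _ _ Y](filter_predT s).
rewrite (@wexp_match tau (fun=> None) (diagram_sign R antiI)) // => V.
rewrite (@eq_filter _ _ predT) // filter_predT => pV aV.
rewrite /wexp word_gword ?ptrace_cmx ?pexpC ?ntrace_gword_assign // => p.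
by rewrite -(perm_mem pV) => /assign_some.
Qed.

Lemma word_None s : word (fun=> None) s = formal_syk ^+ size s.
Proof. by rewrite /word /letter big_const_seq count_predT -Monoid.iteropE. Qed.

Definition sector_moment (k : nat) : R := complex.Re (pexp (ptrace Full (formal_syk ^+ k))).

Lemma match_sum_moment s : sorted ltn s -> match_sum R antiI s = sector_moment (size s).
Proof. by move=> ss; rewrite /sector_moment -word_None -/(wexp Full _ s) wexp_match_sum. Qed.

Lemma pexp_moment tau (j : nat) : pexp (ptrace tau (formal_syk ^+ j)) = (sector_moment j)%:C.
Proof.
suff H s : sorted ltn s -> pexp (ptrace tau (formal_syk ^+ size s)) = (sector_moment (size s))%:C.
  have := H (iota 0 j) (iota_ltn_sorted 0 j).
  by move: (size_iota 0 j) => ->.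
move=> ss; rewrite -(match_sum_moment ss) -word_None.
exact: wexp_match_sum.
Qed.

Lemma meval_formal_syk w : map_mx (meval (coupling (D := qsubsets N q) J w)) formal_syk = sykH q J w.
Proof.
rewrite /formal_syk /sykH /syk [\sum_(A in _) _]big_enum_val scaler_sumr.
apply/matrixP => a b; rewrite !mxE !summxE [LHS]raddf_sum; apply: eq_bigr => i _.
transitivity (meval (coupling (D := qsubsets N q) J w)
    ((mpolyC M coef * X i) * mpolyC M (GamI i a b))); first by rewrite !mxE.
by rewrite !mevalM !mevalC mevalXU !mxE mulrA.
Qed.

Lemma meval_formal_sykX w (j : nat) :
  map_mx (meval (coupling (D := qsubsets N q) J w)) (formal_syk ^+ j) = sykH q J w ^+ j.
Proof.
elim: j => [|j IH]; first by rewrite !expr0 [LHS]map_mx1.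
by rewrite !exprS -IH -meval_formal_syk [LHS]map_mxM.
Qed.

Lemma parity_sykH w : comm_mx (parity R N) (sykH q J w).
Proof.
have commZ c (Y : 'M[C]_D) : comm_mx (parity R N) Y -> comm_mx (parity R N) (c *: Y).
  by rewrite /comm_mx -scalemxAl -scalemxAr => ->.
apply: (commZ); apply: comm_mx_sum => A; rewrite inE => /eqP Aq.
by apply: (commZ); apply: parity_Gam => //; rewrite Aq.
Qed.

Lemma parity_sykHX w (j : nat) : comm_mx (parity R N) (sykH q J w ^+ j).
Proof.
elim: j => [|j IH]; first exact: comm_mx1.
by rewrite exprS; apply: comm_mxM; [exact: parity_sykH | exact: IH].
Qed.

Lemma momentE (j : nat) : moment q J j = sector_moment j.
Proof.
rewrite /moment /sector_moment /pexpect /cexpect /= /Rintegral; congr fine.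
apply: eq_integral => w _; congr (_%:E).
by rewrite meval_ptrace meval_formal_sykX -sector_traceE //; exact: parity_sykHX.
Qed.

Hypotheses (M_gt0 : (0 < 'C(N, q))%N) (alpha_gt0 : 0 < alpha R N q).
Local Notation a := (alpha R N q).
Local Notation mu := (moment q J).

Lemma anti_average_alpha i : average (fun j => (antiI i j)%:R) = a :> R.
Proof.
rewrite (alphaP R oN oq (card_enum_val i)) /average.
have -> : #|'I_M|%:R^-1 = ('C(N, q)%:R^-1 : R) by rewrite card_ord card_qsubsets.
rewrite mulrC; congr (_ / _).
rewrite -natr_sum; congr (_%:R); apply: etrans _ (sum1_card _).
rewrite (eq_bigl (fun B => (B \in qsubsets N q) && odd #|enum_val i :&: B|)); last first.
  by move=> B; rewrite !inE Gam_anti // odd_enum_val.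
rewrite big_mkcondr [RHS]big_enum_val /=; apply: eq_bigr => j _.
by rewrite /antiI; case: odd.
Qed.

Lemma moment_match_sum s : sorted ltn s -> match_sum R antiI s = mu (size s).
Proof. by move=> ss; rewrite momentE match_sum_moment. Qed.

(** This fixes b = sqrt(4 alpha) in the cluster expansion. *)
Lemma anti_average_sqrt i :
  average (fun j => (antiI i j)%:R) <= Num.sqrt (4 * a) ^+ 2 / 4 :> R.
Proof.
rewrite anti_average_alpha sqr_sqrtr ?mulr_ge0 ?(ltW alpha_gt0) //.
by rewrite mulrAC divff ?mul1r // pnatr_eq0.
Qed.

Lemma antiI_sym : ssrbool.symmetric antiI.
Proof. by move=> i j; rewrite /antiI finset.setIC. Qed.

Lemma moment_norm_le (j : nat) : `|mu j| <= (nmatch j)%:R.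
Proof.
rewrite -[j in mu j](size_iota 0) -moment_match_sum ?iota_ltn_sorted //.
have := @match_sum_norm_le R 'I_M antiI (iota 0 j).
by rewrite size_iota; apply.
Qed.

Lemma moment_odd (j : nat) : odd j -> mu j = 0.
Proof.
by move=> oj; apply/eqP; rewrite -normr_le0; have := moment_norm_le j; rewrite nmatch_odd.
Qed.

Lemma moment0 : mu 0 = 1.
Proof. by rewrite -(moment_match_sum (s := [::])). Qed.

Lemma moment2 : mu 2 = 1.
Proof.
rewrite -(moment_match_sum (s := [:: 0; 1]%N)) // /match_sum sum_match_cons /=.
rewrite addr0 /average card_ord; under eq_bigr do rewrite /sum_match /= /row_sign big_nil mul1r.
rewrite sumr_const card_ord mulVf // pnatr_eq0 card_qsubsets -lt0n //.
Qed.

Local Notation cc := (coef_c a mu).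

Lemma size_coefs x (nu : nat -> R) r : size (coefs x nu r) = r.+1.
Proof. by elim: r => //= r IH; rewrite size_rcons IH. Qed.

Lemma nth_coefs x (nu : nat -> R) (r s : nat) : (s <= r)%N -> (coefs x nu r)`_s = coef_c x nu s.
Proof.
elim: r => [|r IH]; first by rewrite leqn0 => /eqP ->.
rewrite leq_eqVlt => /predU1P[-> //|sr].
by rewrite /= nth_rcons size_coefs sr IH.
Qed.

(** The definition of c_r solved for the highest moment; positivity of alpha undoes the division by
    alpha^r in [coefs]. *)
Lemma moment_rec r : mu (2 * r + 2) = (2 * r).+1%:R * mu (2 * r) -
  \sum_(1 <= s < r.+1) 'C((2 * r).+1, (2 * s).+1)%:R * (cc s * a ^+ s) * mu (2 * r - 2 * s).
Proof.
case: r => [|r]; first by rewrite big_geq // subr0 moment0 moment2 mul1r.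
have E : cc r.+1 * a ^+ r.+1 = (2 * r.+1).+1%:R * mu (2 * r.+1) - mu (2 * r.+1 + 2) -
    \sum_(1 <= s < r.+1) 'C((2 * r.+1).+1, (2 * s).+1)%:R * (cc s * a ^+ s) * mu (2 * r.+1 - 2 * s).
  rewrite {1}/coef_c /= nth_rcons size_coefs ltnn eqxx divfK; last first.
    by rewrite expf_neq0 // gt_eqF.
  congr (_ - _); apply: eq_big_nat => s /andP[_ sr].
  by rewrite nth_coefs // mulrA.
rewrite big_nat_recr //= binn mul1r subnn moment0 mulr1 E; ring.
Qed.

(** The index is shifted: entry j is the cumulant of order j + 1, as suits the recursion for
    mu_(j+1). Entry 1 is the variance. *)
Definition cumulant (j : nat) : R :=
  if odd j then (if j == 1%N then 1 else - (cc j./2 * a ^+ j./2)) else 0.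

Lemma cumulant_odd (k : nat) : (0 < k)%N -> cumulant (2 * k).+1 = - (cc k * a ^+ k).
Proof.
move=> k0; rewrite /cumulant /= oddM /= eqSS muln_eq0 /= (gtn_eqF k0) uphalf_half oddM /= add0n.
by rewrite mul2n doubleK.
Qed.

Lemma sum_odd_index (f : nat -> R) r : (forall k : nat, ~~ odd k -> f k = 0) ->
  \sum_(i < (2 * r).+2) f i = \sum_(s < r.+1) f (2 * s).+1.
Proof.
move=> f0; elim: r => [|r IH].
  by rewrite big_ord_recl !big_ord1 -[RHS]add0r; congr (_ + _); exact: (f0 0%N isT).
rewrite [RHS]big_ord_recr -IH /= (_ : (2 * r.+1).+2 = (2 * r).+4); last lia.
rewrite 2!big_ord_recr /= f0 ?addr0; last by rewrite /= oddM.
by congr (_ + f _); lia.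
Qed.

Lemma cumulantP (j : nat) : mu j.+1 = \sum_(i < j.+1) 'C(j, i)%:R * (cumulant i * mu (j - i)).
Proof.
have [oj|ej] := boolP (odd j); last first.
  rewrite moment_odd ?big1 // => i _; rewrite /cumulant; case: ifP => oi; rewrite ?mul0r ?mulr0 //.
  by rewrite moment_odd ?mulr0 // oddB ?oi ?(negPf ej) // -ltnS.
have [r jE] : exists r, j = (2 * r).+1 by exists j./2; lia.
rewrite {}jE; have := @sum_odd_index
  (fun k => 'C((2 * r).+1, k)%:R * (cumulant k * mu ((2 * r).+1 - k))) r.
move=> -> => [|k ok]; last by rewrite /cumulant (negPf ok) mul0r mulr0.
rewrite (_ : (2 * r).+2 = (2 * r + 2)%N) ?moment_rec; last lia.
rewrite big_ord_recl; congr (_ + _).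
  by rewrite muln0 bin1 (_ : cumulant 1 = 1) // mul1r subn1.
rewrite big_add1 big_mkord -sumrN; apply: eq_bigr => k _.
rewrite lift0 cumulant_odd // (_ : (2 * r).+1 - (2 * k.+1).+1 = 2 * r - 2 * k.+1)%N //.
by ring.
Qed.

(** The cumulant bound contains b^(2s) = (4 alpha)^s, and the factor alpha^s cancels against the
    normalization of c_s. *)
Lemma coef_c_bound (s : nat) : (0 < s)%N -> `|cc s| <= 2 * (2 * s).+1`!%:R * 4 ^+ s.
Proof.
move=> s0; have := @cumulant_bound R 'I_M antiI _ antiI_sym (sqrtr_ge0 (4 * a)) anti_average_sqrt
  mu cumulant moment_match_sum cumulantP (2 * s).+1.
rewrite cumulant_odd // normrN normrM [`|a ^+ s|]ger0_norm ?exprn_ge0 ?(ltW alpha_gt0) //.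
move=> H; rewrite -(ler_pM2r (exprn_gt0 s alpha_gt0)); apply: le_trans H _.
by rewrite exprM sqr_sqrtr ?mulr_ge0 ?(ltW alpha_gt0) // exprMn mulrA.
Qed.

End Moments.

End Wick.

(** * The spectral form factor *)

Section FormFactor.
Local Open Scope complex_scope.
Local Open Scope ring_scope.
Variables (R : realType) (N q : nat).
Hypotheses (oN : ~~ odd N) (oq : ~~ odd q) (N_gt0 : (0 < N)%N) (qN : (2 * q < N)%N).
Local Notation C := R[i].
Local Notation D := (2 ^ N./2)%N.
Local Notation M := #|qsubsets N q|.
Local Notation poly := (mpoly M C).
Local Notation conjp := (@map_mpoly M C C (@conjc R)).
Context d (Omega : measurableType d) (P : probability Omega R).
Variable J : {set 'I_N} -> {RV P >-> R}.
Hypothesis iid : iid_std_normal (qsubsets N q) J.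
Local Notation pexp := (pexpect (D := qsubsets N q) J).
Local Notation v := (coupling (D := qsubsets N q) J).
Local Notation H := (sykH q J).
Local Notation f := (formal_syk R N q).
Local Notation mu := (moment q J).
Variables (tau : sector) (t : R).
Implicit Types (i : 'I_M) (n k : nat) (w : Omega).

Let z : C := - ('i%C * t%:C).

Definition exp_coef k : C := z ^+ k / k`!%:R.

Lemma conj_z : z^*%C = - z.
Proof. by rewrite /z; apply/eqP; rewrite eq_complex /=; apply/andP; split; apply/eqP; ring. Qed.

Lemma norm_z : `|z| = `|t|%:C.
Proof.
rewrite /z normrN normrM (_ : `|'i%C| = 1) ?mul1r; last by rewrite normc_def /= expr0n expr1n add0r sqrtr1.
by rewrite normc_def /= expr0n addr0 sqrtr_sqr.
Qed.

Lemma conj_exp_coef k : (exp_coef k)^*%C = (- z) ^+ k / k`!%:R.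
Proof. apply: etrans (rmorphM (@conjc R) _ _) _; congr (_ * _).
  exact: etrans (rmorphXn (@conjc R) _ _) (congr1 (fun x => x ^+ k) conj_z).
by apply: etrans (fmorphV (@conjc R) _) _; congr (_^-1); exact: conjc_nat. Qed.

Definition exp_trunc n w : 'M[C]_D := \sum_(k < n) exp_coef k *: H w ^+ k.

Definition trunc n : poly := \sum_(k < n) mpolyC M (exp_coef k) * ptrace tau (f ^+ k).

Lemma meval_trunc n w : meval (v w) (trunc n) = ntrace tau (exp_trunc n w).
Proof.
rewrite /trunc /exp_trunc meval_sum ntrace_sum; apply: eq_bigr => k _.
by rewrite mevalM mevalC meval_ptrace meval_formal_sykX ntraceZ.
Qed.

Lemma parity_exp_trunc n w : comm_mx (parity R N) (exp_trunc n w).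
Proof.
apply: comm_mx_sum => k _; rewrite /comm_mx -scalemxAl -scalemxAr.
by rewrite [_ *m _](parity_sykHX oN oq).
Qed.

Lemma adj_sykH w : adjmx (H w) = H w.
Proof.
rewrite /sykH /syk adjmxZ adjmx_sum; congr (_ *: _); first exact: conjc_real.
apply: eq_bigr => A _; rewrite adjmxZ Gam_adj //; congr (_ *: _).
exact: conjc_real.
Qed.

Lemma adj_sykHX w k : adjmx (H w ^+ k) = H w ^+ k.
Proof.
elim: k => [|k IH]; first exact: adjmx1.
by rewrite {1}exprS exprSr adjmxM IH adj_sykH.
Qed.

Definition square_trunc n : poly := \sum_(j < n) \sum_(k < n)
  mpolyC M ((exp_coef j)^*%C * exp_coef k) * ptrace tau (f ^+ (j + k)).

Lemma meval_square_trunc n w :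
  meval (v w) (square_trunc n) = ntrace tau (adjmx (exp_trunc n w) *m exp_trunc n w).
Proof.
rewrite /square_trunc /exp_trunc adjmx_sum mulmx_suml ntrace_sum meval_sum.
apply: eq_bigr => j _; rewrite mulmx_sumr ntrace_sum meval_sum; apply: eq_bigr => k _.
rewrite mevalM mevalC meval_ptrace meval_formal_sykX adjmxZ adj_sykHX.
by rewrite -scalemxAl -scalemxAr scalerA ntraceZ exprD.
Qed.

(** In the half sectors cyclicity requires that one factor commute with the parity in the weight. *)
Lemma ntrace_mulC (A B : 'M[C]_D) : comm_mx (parity R N) A ->
  ntrace tau (A *m B) = ntrace tau (B *m A).
Proof.
move=> PA; rewrite /ntrace mulmxA (sector_weight_comm tau PA) -mulmxA mxtrace_mulC.
by rewrite mulmxA.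
Qed.

Lemma map_mevalM (x : 'I_M -> C) (A B : 'M[poly]_D) :
  map_mx (meval x) (A * B) = map_mx (meval x) A *m map_mx (meval x) B.
Proof. exact: map_mxM. Qed.

(** By cyclicity each of the k factors H contributes the same term. The power H^j on the left
    collects the factors that the product rule has already passed. *)
Lemma ntrace_dmx_power i w j k :
  ntrace tau (H w ^+ j *m map_mx (meval (v w)) (dmx i (f ^+ k))) =
  k%:R * (coef R N q * ntrace tau (GamI R i *m H w ^+ (j + k).-1)).
Proof.
elim: k j => [|k IH] j.
  rewrite mul0r expr0 (_ : 1 = map_mx (@mpolyC M C) 1%:M) ?dmx_cmx; last first.
    by apply/matrixP => a b; rewrite !mxE; case: eqP => _; rewrite ?mpolyC1 // mpolyC0.
  by rewrite map_mx0 mulmx0 /ntrace mulmx0 mxtrace0 mul0r.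
rewrite exprS dmxM dmx_formal_syk map_mxD mulmxDr ntraceD.
have -> : map_mx (meval (v w)) (f * dmx i (f ^+ k)) = H w *m map_mx (meval (v w)) (dmx i (f ^+ k)).
  by rewrite map_mevalM meval_formal_syk.
rewrite mulmxA -[_ *m H w]/(H w ^+ j * H w) -exprSr IH.
have -> : map_mx (meval (v w)) ((mpolyC M (coef R N q) *: map_mx (@mpolyC M C) (GamI R i)) * f ^+ k) =
    coef R N q *: (GamI R i *m H w ^+ k).
  rewrite map_mevalM meval_formal_sykX scalemxAl; congr (_ *m _).
  by apply/matrixP => a b; rewrite !mxE mevalM !mevalC.
rewrite -scalemxAr ntraceZ (ntrace_mulC _ (parity_sykHX oN oq J w j)) -mulmxA.
rewrite -[_ *m H w ^+ j]/(H w ^+ k * H w ^+ j) -exprD addSn addnS /= [(k + j)%N]addnC.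
by rewrite -natr1 mulrDl mul1r addrC.
Qed.

Lemma meval_deriv_trunc i w n : meval (v w) (mderiv i (trunc n.+1)) =
  z * (coef R N q * ntrace tau (GamI R i *m exp_trunc n w)).
Proof.
have E k : meval (v w) (mderiv i (mpolyC M (exp_coef k) * ptrace tau (f ^+ k))) =
    exp_coef k * (k%:R * (coef R N q * ntrace tau (GamI R i *m H w ^+ k.-1))).
  rewrite mderiv_mulC mderiv_ptrace mevalM mevalC meval_ptrace.
  congr (_ * _); have := ntrace_dmx_power i w 0 k.
  by rewrite expr0 [_ *m map_mx _ _]mul1mx.
transitivity (\sum_(k < n.+1) exp_coef k *
    (k%:R * (coef R N q * ntrace tau (GamI R i *m H w ^+ k.-1)))).
  by rewrite /trunc mderiv_sum meval_sum; apply: eq_bigr => k _; exact: E.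
rewrite big_ord_recl mul0r mulr0 add0r /exp_trunc mulmx_sumr ntrace_sum !mulr_sumr.
apply: eq_bigr => k _; rewrite lift0 -scalemxAr ntraceZ /exp_coef exprS factS natrM.
rewrite invfM; have : (k.+1%:R : C) != 0 by rewrite pnatr_eq0.
rewrite -[k.+1.-1]/(nat_of_ord k).
by move: (ntrace tau _) (coef R N q) (z ^+ k) (k`!%:R^-1) (k.+1%:R) => y c u x m m0; field.
Qed.

Lemma card_M_coef : `|coef R N q| ^+ 2 = (M%:R^-1)%:C.
Proof. by rewrite -coef_sq -expr2 sqr_normc conjc_real expr2. Qed.

(** Differentiation lowers the truncation order by one. The truncated exponential is not unitary, so
    its square stays on the right, to be compared with 1 in the limit. *)
Lemma trunc_poincare n :
  pexp (trunc n.+1 * conjp (trunc n.+1)) - `|pexp (trunc n.+1)| ^+ 2 <=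
  (t ^+ 2 / M%:R)%:C * pexp (square_trunc n).
Proof.
apply: le_trans (coupling_poincare iid _) _.
rewrite -(pexp_sum iid) -(pexpZ iid); apply: (pexpect_le iid) => w.
rewrite mevalM mevalC meval_square_trunc meval_sum.
have E i : meval (v w) (mderiv i (trunc n.+1) * conjp (mderiv i (trunc n.+1))) =
    (t ^+ 2 / M%:R)%:C * `|ntrace tau (GamI R i *m exp_trunc n w)| ^+ 2.
  rewrite mevalM meval_conj meval_deriv_trunc -sqr_normc !normrM !exprMn card_M_coef norm_z.
  by rewrite -rmorphXn /= real_normK ?num_real // mulrA -rmorphM.
under eq_bigr do rewrite E.
rewrite -mulr_sumr; apply: ler_wpM2l.
  by rewrite -[0]/(0%:C) lecR divr_ge0 ?sqr_ge0.
have := ntrace_bessel oN tau qN oq (parity_exp_trunc n w).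
by rewrite big_enum_val.
Qed.

Definition char_trunc n : R := \sum_(k < n) sgn_half R k * mu k * t ^+ k / k`!%:R.

Lemma exp_coef_moment k : exp_coef k * (mu k)%:C = (sgn_half R k * mu k * t ^+ k / k`!%:R)%:C.
Proof.
have [ok|ek] := boolP (odd k).
  by rewrite (moment_odd oN oq N_gt0 iid) // mulr0 mulr0 !mul0r.
rewrite /exp_coef /sgn_half (negPf ek).
have -> : z ^+ k = ((-1) ^+ k./2 * t ^+ k)%:C.
  have z2 : z ^+ 2 = (- t ^+ 2)%:C.
    by rewrite /z; apply/eqP; rewrite eq_complex /=; apply/andP; split; apply/eqP; ring.
  rewrite -[k in LHS]odd_double_half (negPf ek) add0n -mul2n exprM z2 -rmorphXn /= -[- t ^+ 2]mulN1r exprMn.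
  by rewrite -exprM mul2n; congr ((_ * t ^+ _)%:C); rewrite -[RHS]odd_double_half (negPf ek).
rewrite -[k`!%:R]/(k`!%:R : C) -(rmorph_nat (real_complex R)) -fmorphV -!rmorphM; congr (_%:C) => /=.
by ring.
Qed.

Lemma pexp_trunc n : pexp (trunc n) = (char_trunc n)%:C.
Proof.
rewrite /trunc (pexp_sum iid) rmorph_sum; apply: eq_bigr => k _.
rewrite (pexpZ iid) (pexp_moment oN oq N_gt0 iid) -(momentE oN oq J).
exact: exp_coef_moment.
Qed.

Definition moment_tail k : R := (2 * `|t|) ^+ k * (nmatch k)%:R / k`!%:R.

(** Below the truncation order the coefficients are those of exp(z) exp(-z) = 1, by the binomial
    theorem. *)
Lemma exp_coef_mul n k : (k < n)%N ->
  ((\poly_(j < n) (exp_coef j)^*%C) * (\poly_(j < n) exp_coef j))`_k = (k == 0%N)%:R.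
Proof.
move=> kn; rewrite coefM.
transitivity ((k`!%:R)^-1 * (z + - z) ^+ k); last first.
  by rewrite subrr expr0n; case: k {kn} => [|k] /=; rewrite ?mulr0 // fact0 invr1 mulr1.
rewrite exprDn mulr_sumr; apply: eq_bigr => -[j /= jk] _.
rewrite !coef_poly (leq_ltn_trans _ kn) // (leq_ltn_trans (leq_subr _ _) kn).
rewrite conj_exp_coef /exp_coef -mulr_natr.
have := bin_fact (jk : (j <= k)%N) => /(congr1 (fun n => n%:R : C)); rewrite !natrM => <-.
have f0 m : (m`!%:R : C) != 0 by rewrite pnatr_eq0 -lt0n fact_gt0.
have b0 : ('C(k, j)%:R : C) != 0 by rewrite pnatr_eq0 -lt0n bin_gt0.
by move: (f0 j) (f0 (k - j)%N) b0 => h1 h2 h3; field; rewrite h1 h2 h3.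
Qed.

Lemma exp_coef_mul_le n k :
  `|((\poly_(j < n) (exp_coef j)^*%C) * (\poly_(j < n) exp_coef j))`_k| <=
  ((2 * `|t|) ^+ k / k`!%:R)%:C.
Proof.
rewrite coefM; apply: le_trans (ler_norm_sum _ _ _) _.
have -> : (2 * `|t|) ^+ k / k`!%:R = \sum_(j < k.+1) `|t| ^+ k / (j`!%:R * (k - j)`!%:R).
  rewrite exprMn [2 in LHS](_ : 2 = 1 + 1) // exprDn mulr_suml mulr_suml; apply: eq_bigr => -[j /= jk] _.
  rewrite !expr1n mulr1 -mulr_natr mul1r.
  have := bin_fact (jk : (j <= k)%N) => /(congr1 (fun n => n%:R : R)); rewrite !natrM => <-.
  have f0 m : (m`!%:R : R) != 0 by rewrite pnatr_eq0 -lt0n fact_gt0.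
  have b0 : ('C(k, j)%:R : R) != 0 by rewrite pnatr_eq0 -lt0n bin_gt0.
  by move: (f0 j) (f0 (k - j)%N) b0 => h1 h2 h3; field; rewrite h1 h2 h3.
rewrite rmorph_sum; apply: ler_sum => -[j /= jk] _; rewrite normrM.
have coefle (g : nat -> C) (m : nat) : (forall i : nat, `|g i| <= (`|t| ^+ i / i`!%:R)%:C) ->
    `|(\poly_(i < n) g i)`_m| <= (`|t| ^+ m / m`!%:R)%:C.
  move=> gle; rewrite coef_poly; case: ifP => // _.
  by rewrite normr0 -[0]/(0%:C) lecR divr_ge0 ?exprn_ge0.
have ne (m : nat) : `|exp_coef m| <= (`|t| ^+ m / m`!%:R)%:C.
  by rewrite /exp_coef normrM normrX norm_z normfV normr_nat rmorphM rmorphXn fmorphV rmorph_nat.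
have nce (m : nat) : `|(exp_coef m)^*%C| <= (`|t| ^+ m / m`!%:R)%:C.
  by rewrite conj_exp_coef normrM normrX normrN norm_z normfV normr_nat rmorphM rmorphXn fmorphV rmorph_nat.
have -> : `|t| ^+ k / (j`!%:R * (k - j)`!%:R) = (`|t| ^+ j / j`!%:R) * (`|t| ^+ (k - j) / (k - j)`!%:R).
  by rewrite -{1}(subnKC (jk : (j <= k)%N)) exprD invfM mulrACA.
by rewrite rmorphM ler_pM //; exact: coefle.
Qed.

(** Unitarity holds in all degrees up to n; the degrees from n + 1 on are bounded by a tail of a
    convergent series. *)
Lemma pexp_square_trunc n :
  `|pexp (square_trunc n.+1) - 1| <= (\sum_(n.+1 <= k < 2 * n.+1) moment_tail k)%:C.
Proof.
pose A := \poly_(j < n.+1) (exp_coef j)^*%C; pose B := \poly_(j < n.+1) exp_coef j.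
have E : pexp (square_trunc n.+1) = pairing (fun k => (mu k)%:C) (A * B).
  have pm (m : nat) : pexp (ptrace tau (f ^+ m)) = (mu m)%:C.
    by rewrite (pexp_moment oN oq N_gt0 iid) (momentE oN oq J).
  rewrite {1}/A poly_def mulr_suml pairing_sum (pexp_sum iid); apply: eq_bigr => j _.
  rewrite -scalerAl pairingZ pairingMXn (@pairingE _ n.+1) ?size_poly // (pexp_sum iid) mulr_sumr.
  by apply: eq_bigr => k _; rewrite (pexpZ iid) pm coef_poly ltn_ord mulrA.
have sAB : (size (A * B)%R <= 2 * n.+1)%N.
  apply: leq_trans (size_polyMleq _ _) _.
  have := size_poly n.+1 (fun j => (exp_coef j)^*%C); have := size_poly n.+1 exp_coef.
  rewrite -/A -/B; lia.
rewrite E (pairingE _ sAB) -(big_mkord xpredT (fun k => (A * B)`_k * (mu k)%:C)).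
rewrite (big_cat_nat (n := n.+1)) //=; last lia.
have -> : \sum_(0 <= k < n.+1) (A * B)`_k * (mu k)%:C = 1.
  rewrite big_nat_recl // exp_coef_mul // (moment0 oN oq N_gt0 iid) mul1r big_nat big1 ?addr0 // => k /andP[_ kn].
  by rewrite exp_coef_mul // mul0r.
rewrite addrAC subrr add0r; apply: le_trans (ler_norm_sum _ _ _) _; rewrite rmorph_sum.
apply: ler_sum => k _; rewrite normrM /moment_tail.
have -> : (2 * `|t|) ^+ k * (nmatch k)%:R / k`!%:R = (2 * `|t|) ^+ k / k`!%:R * (nmatch k)%:R.
  by rewrite mulrAC.
rewrite rmorphM ler_pM // ?exp_coef_mul_le //.
rewrite normc_def /= expr0n addr0 sqrtr_sqr lecR.
exact: (moment_norm_le oN oq N_gt0 iid).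
Qed.

End FormFactor.

(** * Componentwise limits of complex sequences *)

Section ComplexLimits.
Local Open Scope complex_scope.
Local Open Scope ring_scope.
Variable R : realType.
Local Notation C := R[i].
Local Notation Re := complex.Re.
Local Notation Im := complex.Im.
Implicit Types (u : nat -> C) (l : C).

Definition ccvg u l :=
  ((fun n => Re (u n)) @ \oo --> Re l) /\ ((fun n => Im (u n)) @ \oo --> Im l).

Lemma ccvg_limn u l : ccvg u l -> limn (u : nat -> C^o) = l.
Proof.
move=> [ur ui]; apply: cvg_lim; first exact: norm_hausdorff.
apply/cvgrPdist_le => e e0.
have [r r0 eE] : exists2 r : R, 0 < r & e = r%:C.
  case: e e0 => r s; rewrite ltcE /= => /andP[/eqP s0 r0]; exists r => //.
  by rewrite /real_complex_def s0.
have r2 : 0 < r / 2 by rewrite divr_gt0.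
move/cvgrPdist_le: ur => /(_ _ r2) [n1 _ H1]; move/cvgrPdist_le: ui => /(_ _ r2) [n2 _ H2].
exists (maxn n1 n2) => // n /=; rewrite geq_max => /andP[h1 h2].
apply: le_trans (normc_le_ReIm _) _; rewrite eE lecR.
have := lerD (H1 n h1) (H2 n h2); rewrite -splitr.
by case: (u n) (l) => a b [a' b'].
Qed.

Lemma ccvg_unique u l l' : ccvg u l -> ccvg u l' -> l = l'.
Proof. by move=> /ccvg_limn <- /ccvg_limn. Qed.

Lemma ccvgD u v l m : ccvg u l -> ccvg v m -> ccvg (fun n => u n + v n) (l + m).
Proof.
move=> [u1 u2] [v1 v2]; split.
  rewrite raddfD (_ : (fun n => _) = (fun n => Re (u n)) + (fun n => Re (v n))); first exact: cvgD.
  by apply/funext => n; rewrite raddfD.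
rewrite raddfD (_ : (fun n => _) = (fun n => Im (u n)) + (fun n => Im (v n))); first exact: cvgD.
by apply/funext => n; rewrite raddfD.
Qed.

Lemma ccvg_cst l : ccvg (fun=> l) l.
Proof. by split; exact: cvg_cst. Qed.

Lemma ccvgZ c u l : ccvg u l -> ccvg (fun n => c * u n) (c * l).
Proof.
case: c => a b [u1 u2]; split.
  rewrite (_ : Re (_ * l) = a * Re l - b * Im l); last by case: (l).
  rewrite (_ : (fun n => _) = (fun n => a * Re (u n) - b * Im (u n))).
    by apply: cvgB; apply: cvgM => //; exact: cvg_cst.
  by apply/funext => n; case: (u n).
rewrite (_ : Im (_ * l) = a * Im l + b * Re l); last by case: (l).
rewrite (_ : (fun n => _) = (fun n => a * Im (u n) + b * Re (u n))).
  by apply: cvgD; apply: cvgM => //; exact: cvg_cst.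
by apply/funext => n; case: (u n).
Qed.

Lemma ccvg_sum (I : Type) (r : seq I) (F : I -> nat -> C) (L : I -> C) :
  (forall i, ccvg (F i) (L i)) -> ccvg (fun n => \sum_(i <- r) F i n) (\sum_(i <- r) L i).
Proof.
move=> FL; elim: r => [|i r IH].
  by rewrite big_nil; under eq_fun do rewrite big_nil; exact: ccvg_cst.
by rewrite big_cons; under eq_fun do rewrite big_cons; exact: ccvgD.
Qed.

Lemma ccvg_sqnormc u l : ccvg u l -> sqnormc (u n) @[n --> \oo] --> sqnormc l.
Proof.
move=> [u1 u2]; rewrite /sqnormc !expr2; under eq_fun do rewrite !expr2.
by apply: cvgD; apply: cvgM.
Qed.

Lemma exp_bound_cvg (u : nat -> R) (c : R) : 0 <= c ->
  (forall k, `|u k| <= c ^+ k / k`!%:R) -> cvgn (series u).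
Proof.
move=> c0 uc; apply: (@normed_cvg R R).
apply: (series_le_cvg _ _ uc); first by move=> n; exact: normr_ge0.
  by move=> n; rewrite divr_ge0 // exprn_ge0.
exact: is_cvg_series_exp_coeff.
Qed.

Lemma exp_bound_ccvg u (c : R) : 0 <= c -> (forall k, `|u k| <= (c ^+ k / k`!%:R)%:C) ->
  exists l, ccvg (fun n => \sum_(k < n) u k) l.
Proof.
move=> c0 uc.
have Rec : cvgn (series (fun k => Re (u k))).
  by apply: (exp_bound_cvg c0) => k; rewrite -lecR; exact: le_trans (normc_ge_Re _) (uc k).
have Imc : cvgn (series (fun k => Im (u k))).
  by apply: (exp_bound_cvg c0) => k; rewrite -lecR; exact: le_trans (normc_ge_Im _) (uc k).
exists (limn (series (fun k => Re (u k))) +i* limn (series (fun k => Im (u k)))); split => /=.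
  rewrite (_ : (fun n => _) = series (fun k => Re (u k))) //.
  by apply/funext => n; rewrite raddf_sum /series /= big_mkord.
rewrite (_ : (fun n => _) = series (fun k => Im (u k))) //.
by apply/funext => n; rewrite raddf_sum /series /= big_mkord.
Qed.

Lemma exp_sum_le (c : R) n : 0 <= c -> \sum_(k < n) c ^+ k / k`!%:R <= expR c.
Proof.
move=> c0; rewrite -(big_mkord xpredT (fun k => c ^+ k / k`!%:R)).
apply: (@nondecreasing_cvgn_le _ (series (exp_coeff c))); last exact: is_cvg_series_exp_coeff.
move=> m p mp; rewrite -subr_ge0 sub_series_geq //; apply: sumr_ge0 => k _.
by rewrite divr_ge0 // exprn_ge0.
Qed.

End ComplexLimits.

(** * Removal of the truncation *)

Section FormFactorLimit.
Local Open Scope complex_scope.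
Local Open Scope ring_scope.
Variables (R : realType) (N q : nat).
Hypotheses (oN : ~~ odd N) (oq : ~~ odd q) (N_gt0 : (0 < N)%N) (qN : (2 * q < N)%N).
Local Notation C := R[i].
Local Notation D := (2 ^ N./2)%N.
Local Notation M := #|qsubsets N q|.
Local Notation poly := (mpoly M C).
Local Notation conjp := (@map_mpoly M C C (@conjc R)).
Context d (Omega : measurableType d) (P : probability Omega R).
Variable J : {set 'I_N} -> {RV P >-> R}.
Hypothesis iid : iid_std_normal (qsubsets N q) J.
Local Notation pexp := (pexpect (D := qsubsets N q) J).
Local Notation H := (sykH q J).
Variables (tau : sector) (t : R).
Implicit Types (w : Omega) (a b : 'I_D) (k n : nat).

Let M_gt0 : (0 < 'C(N, q))%N. Proof. by rewrite bin_gt0; lia. Qed.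

Definition coupling_norm w : R := \sum_(A in qsubsets N q) `|J A w|.

Lemma coupling_norm_ge0 w : 0 <= coupling_norm w.
Proof. exact: sumr_ge0. Qed.

Lemma norm_real (x : R) : `|x%:C| = `|x|%:C :> C.
Proof. by rewrite normc_def /= expr0n addr0 sqrtr_sqr. Qed.

Lemma norm_sykH w a b : `|H w a b| <= (coupling_norm w)%:C.
Proof.
rewrite /sykH /syk mxE summxE normrM.
have c1 : `|((Num.sqrt 'C(N, q)%:R)^-1)%:C| <= 1 :> C.
  rewrite norm_real lecR ger0_norm ?invr_ge0 ?sqrtr_ge0 // invf_le1 ?sqrtr_gt0 ?ltr0n //.
  by rewrite -[leLHS]sqrtr1 ler_wsqrtr // ler1n.
apply: le_trans (ler_piMl (normr_ge0 _) c1) _; apply: le_trans (ler_norm_sum _ _ _) _.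
rewrite rmorph_sum; apply: ler_sum => A; rewrite inE => /eqP Aq; rewrite mxE normrM norm_real.
rewrite ler_piMr // -?norm_real //; apply: unitary_entry_le.
by rewrite Gam_adj ?Aq // Gam_sq ?Aq.
Qed.

Lemma norm_sykHX w a b k : `|(H w ^+ k) a b| <= ((D%:R * coupling_norm w) ^+ k)%:C.
Proof.
elim: k a b => [|k IH] a b.
  by rewrite !expr0 [X in `|X|]mxE; case: eqP => _ /=; rewrite ?normr1 ?normr0 ?ler01.
rewrite exprS mxE; apply: le_trans (ler_norm_sum _ _ _) _.
have E c : `|H w a c * (H w ^+ k) c b| <=
    (coupling_norm w * (D%:R * coupling_norm w) ^+ k)%:C.
  by rewrite normrM rmorphM ler_pM // norm_sykH.
apply: le_trans (ler_sum _ (fun c _ => E c)) _.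
by rewrite sumr_const card_ord -(raddfMn (real_complex R)) lecR exprS -[leLHS]mulr_natl mulrA.
Qed.

Let lam : R := `|t| * D%:R.

Lemma lam_ge0 : 0 <= lam. Proof. by rewrite mulr_ge0. Qed.

Lemma norm_exp_term w a b k :
  `|exp_coef t k * (H w ^+ k) a b| <= ((lam * coupling_norm w) ^+ k / k`!%:R)%:C.
Proof.
rewrite normrM /exp_coef normrM normrX norm_z normfV normr_nat.
have -> : ((lam * coupling_norm w) ^+ k / k`!%:R)%:C =
    `|t|%:C ^+ k / k`!%:R * ((D%:R * coupling_norm w) ^+ k)%:C.
  rewrite -rmorphXn -(rmorph_nat (real_complex R)) -fmorphV -!rmorphM; congr (_%:C) => /=.
  by rewrite /lam -(mulrA _ D%:R) exprMn mulrAC.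
by rewrite ler_wpM2l ?norm_sykHX // divr_ge0 ?exprn_ge0 // -norm_real.
Qed.

Lemma exp_truncE w a b n :
  exp_trunc q J t n w a b = \sum_(k < n) exp_coef t k * (H w ^+ k) a b.
Proof. by rewrite /exp_trunc summxE; apply: eq_bigr => k _; rewrite mxE. Qed.

Local Notation expH w := (mexp (- ('i%C * t%:C) *: H w)).

Lemma scale_expn c (A : 'M[C]_D) k : (c *: A) ^+ k = c ^+ k *: A ^+ k.
Proof.
elim: k => [|k IH]; first by rewrite !expr0 scale1r.
rewrite exprS IH -[LHS]/((c *: A) *m (c ^+ k *: A ^+ k)) -scalemxAl -scalemxAr scalerA.
by rewrite -exprS -[A *m _]/(A * A ^+ k) -exprS.
Qed.

Lemma ccvg_exp_trunc w a b : ccvg (fun n => exp_trunc q J t n w a b) (expH w a b).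
Proof.
have [l cl] : exists l, ccvg (fun n => exp_trunc q J t n w a b) l.
  have c0 : 0 <= lam * coupling_norm w by rewrite mulr_ge0 ?lam_ge0 ?coupling_norm_ge0.
  have [l cl] := exp_bound_ccvg c0 (norm_exp_term w a b); exists l.
  by under eq_fun do rewrite exp_truncE.
suff <- : l = expH w a b by [].
rewrite /mexp mxE -(ccvg_limn cl).
have -> : (fun n => exp_trunc q J t n w a b) =
    series (fun k => k`!%:R^-1 * ((- ('i%C * t%:C) *: H w) ^+ k) a b); last by [].
apply/funext => n; rewrite exp_truncE /series /= big_mkord; apply: eq_bigr => k _.
by rewrite (scale_expn _ (H w)) mxE /exp_coef [LHS]mulrAC [LHS]mulrC.
Qed.

Lemma parity_expH w : comm_mx (parity R N) (expH w).
Proof.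
apply/matrixP => a b.
apply: (@ccvg_unique _ (fun n => (parity R N *m exp_trunc q J t n w) a b)).
  rewrite mxE; under eq_fun do rewrite mxE; apply: ccvg_sum => c; apply: ccvgZ.
  exact: ccvg_exp_trunc.
under eq_fun do rewrite (parity_exp_trunc oN oq) mxE.
rewrite mxE; apply: ccvg_sum => c; rewrite mulrC; under eq_fun do rewrite mulrC.
by apply: ccvgZ; exact: ccvg_exp_trunc.
Qed.

Lemma ntraceE (A : 'M[C]_D) :
  ntrace tau A = \sum_a \sum_b sector_weight R N tau a b / D%:R * A b a.
Proof.
rewrite /ntrace /mxtrace mulr_suml; apply: eq_bigr => a _; rewrite mxE mulr_suml.
by apply: eq_bigr => b _; rewrite mulrAC.
Qed.

Lemma ccvg_ntrace w :
  ccvg (fun n => ntrace tau (exp_trunc q J t n w)) (sector_trace tau (expH w)).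
Proof.
rewrite sector_traceE //; last exact: parity_expH.
rewrite ntraceE; under eq_fun do rewrite ntraceE.
by apply: ccvg_sum => a; apply: ccvg_sum => b; apply: ccvgZ; exact: ccvg_exp_trunc.
Qed.

Lemma ntrace_trunc_bound : exists2 B : R, 0 <= B & forall n w,
  sqnormc (ntrace tau (exp_trunc q J t n w)) <= B * expR (2 * lam * coupling_norm w).
Proof.
pose b0 : R := complex.Re (\sum_a \sum_b `|sector_weight R N tau a b / D%:R|).
have b0E : \sum_a \sum_b `|sector_weight R N tau a b / D%:R| = b0%:C.
  have : 0 <= \sum_a \sum_b `|sector_weight R N tau a b / D%:R|.
    by apply: sumr_ge0 => a _; apply: sumr_ge0.
  by rewrite /b0; case: (\sum_a _) => x y; rewrite lecE /= => /andP[/eqP -> _].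
exists (b0 ^+ 2); first exact: sqr_ge0.
move=> n w; have c0 : 0 <= lam * coupling_norm w by rewrite mulr_ge0 ?lam_ge0 ?coupling_norm_ge0.
have le_exp a b : `|exp_trunc q J t n w a b| <= (expR (lam * coupling_norm w))%:C.
  rewrite exp_truncE; apply: le_trans (ler_norm_sum _ _ _) _.
  apply: le_trans; first by apply: ler_sum => k _; exact: norm_exp_term.
  by rewrite -rmorph_sum lecR exp_sum_le.
have L : `|ntrace tau (exp_trunc q J t n w)| <= (b0 * expR (lam * coupling_norm w))%:C.
  have -> : (b0 * expR (lam * coupling_norm w))%:C = b0%:C * (expR (lam * coupling_norm w))%:C.
    by rewrite rmorphM.
  rewrite ntraceE -b0E mulr_suml; apply: le_trans (ler_norm_sum _ _ _) _.
  apply: ler_sum => a _; rewrite mulr_suml; apply: le_trans (ler_norm_sum _ _ _) _.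
  by apply: ler_sum => b _; rewrite normrM ler_wpM2l.
rewrite -lecR /sqnormc add_Re2_Im2 (_ : 2 * lam * _ = lam * coupling_norm w + lam * coupling_norm w).
  rewrite expRD -expr2 -exprMn rmorphXn; apply: lerXn2r (L); rewrite nnegrE //.
  exact: le_trans (normr_ge0 _) L.
ring.
Qed.

(** The exponential of a sum of |J_A| is a product of functions of single couplings, each of
    exponential growth and hence Gaussian-integrable. *)
Lemma rintegrable_dominating : rintegrable P (fun w => expR (2 * lam * coupling_norm w)).
Proof.
have tg : tame (fun x : R => expR (2 * lam * `|x|)).
  split; first by apply: measurableT_comp => //; apply: measurable_funM => //; exact: measurableT_comp.
  exists 1, (2 * lam); split=> //; first by rewrite mulr_ge0 // lam_ge0.
  by move=> x; rewrite ger0_norm ?expR_ge0 // mul1r.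
have := integrable_prod iid (subxx _) (fun _ => tg).
apply: eq_integrable => // w _ /=; congr EFin.
by rewrite /coupling_norm mulr_sumr expR_sum.
Qed.

Lemma sqnormc_mul (x : C) : sqnormc x = complex.Re (x * x^*%C).
Proof. by rewrite /sqnormc; case: x => a b /=; ring. Qed.

Lemma expect_sqnorm_trunc n :
  (\int[P]_w (sqnormc (ntrace tau (exp_trunc q J t n w)))%:E)%E =
  (complex.Re (pexp (trunc N q tau t n * conjp (trunc N q tau t n))))%:E.
Proof.
rewrite /pexpect /cexpect /= /Rintegral fineK; last first.
  by apply: integrable_fin_num => //; have [] := cintegrable_meval iid (trunc N q tau t n * conjp (trunc N q tau t n)).
apply: eq_integral => w _; congr EFin.
by rewrite mevalM meval_conj meval_trunc sqnormc_mul.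
Qed.

Lemma cvg_sff :
  complex.Re (pexp (trunc N q tau t n * conjp (trunc N q tau t n))) @[n --> \oo] --> sff q J tau t.
Proof.
have [B B0 HB] := ntrace_trunc_bound.
pose g w : \bar R := (B * expR (2 * lam * coupling_norm w))%:E.
pose fn n w : \bar R := (sqnormc (ntrace tau (exp_trunc q J t n w)))%:E.
pose fl w : \bar R := (sqnormc (sector_trace tau (expH w)))%:E.
have mfn n : measurable_fun setT (fn n).
  have [+ _] := cintegrable_meval iid (trunc N q tau t n * conjp (trunc N q tau t n)).
  move=> /integrableP[+ _]; apply: eq_measurable_fun => w _ /=.
  by rewrite /fn mevalM meval_conj meval_trunc sqnormc_mul.
have cfn w : fn n w @[n --> \oo] --> fl w.
  by apply: cvg_EFin; [exact: nearW | exact: ccvg_sqnormc (ccvg_ntrace w)].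
have mfl : measurable_fun setT fl by apply: (emeasurable_fun_cvg fn) => // w _; exact: cfn.
have ig : P.-integrable setT g by exact: (rintegrableZ B rintegrable_dominating).
have bnd w n : (`|fn n w| <= g w)%E.
  by rewrite /fn gee0_abs ?lee_fin ?HB // /sqnormc addr_ge0 ?sqr_ge0.
have [ifl _ cv] := dominated_convergence measurableT mfn mfl
  (aeW _ (fun w _ => cfn w)) ig (aeW _ (fun w n _ => bnd w n)).
have {}cv : (\int[P]_w fn n w)%E @[n --> \oo] --> (\int[P]_w fl w)%E by exact: cv.
rewrite /sff -/fl.
have ffin : (\int[P]_w fl w)%E \is a fin_num by exact: integrable_fin_num.
rewrite -(fineK ffin) in cv.
rewrite (_ : (fun n => _) = (fun n => fine (\int[P]_w fn n w)%E)); first exact: fine_cvg cv.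
by apply/funext => n; rewrite /fn expect_sqnorm_trunc.
Qed.

Definition char_coef k : R := sgn_half R k * moment q J k / k`!%:R.

Lemma norm_char_coef k : `|char_coef k| <= (nmatch k)%:R / k`!%:R.
Proof.
rewrite /char_coef !normrM normfV normr_nat ler_wpM2r ?invr_ge0 //.
have s1 : `|sgn_half R k| <= 1.
  by rewrite /sgn_half; case: ifP => _; rewrite ?normr0 // normrX normrN1 expr1n.
by apply: le_trans (ler_piMl (normr_ge0 _) s1) _; exact: moment_norm_le.
Qed.

Definition char_fun (x : R) : R := limn (pseries char_coef x).

(** As nmatch(2k)/(2k)! = 1/(2^k k!) and odd terms vanish, the even partial sums are partial sums of
    exp(r^2/2). *)
Lemma is_cvg_char (r : R) : cvgn (series (fun k => (nmatch k)%:R / k`!%:R * `|r| ^+ k)).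
Proof.
pose u k : R := (nmatch k)%:R / k`!%:R * `|r| ^+ k.
have u0 k : 0 <= u k by rewrite mulr_ge0 ?exprn_ge0 ?divr_ge0.
have even_sum n : series u n.*2 = \sum_(k < n) (r ^+ 2 / 2) ^+ k / k`!%:R.
  elim: n => [|n IH]; first by rewrite big_ord0 /series /= big_geq.
  rewrite big_ord_recr -IH /series /= !big_nat_recr //= -addrA; congr +%R.
  rewrite {2}/u nmatch_odd /= ?odd_double // !mul0r addr0 /u.
  have f0 : (n.*2)`!%:R != 0 :> R by rewrite pnatr_eq0 -lt0n fact_gt0.
  have f1 : n`!%:R != 0 :> R by rewrite pnatr_eq0 -lt0n fact_gt0.
  have /(congr1 (fun m => m%:R : R)) := nmatch_fact n; rewrite !natrM natrX => E.
  rewrite -[Y in (nmatch Y)%:R / Y`!%:R]/(n.*2) -[Y in `|r| ^+ Y]/(n.*2).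
  rewrite -[Y in `|r| ^+ Y]muln2 mulnC exprM real_normK ?num_real // [in RHS]expr_div_n -E.
  have p0 : (2 : R) ^+ n != 0 by rewrite expf_neq0.
  have m0 : (nmatch n.*2)%:R != 0 :> R.
    by apply: contraNneq f0 => m0; rewrite -E m0 mul0r.
  by field; rewrite m0 f1 p0.
apply: nondecreasing_is_cvgn.
  by apply/nondecreasing_seqP => n; rewrite /series /= big_nat_recr //= lerDl.
exists (expR (r ^+ 2 / 2)) => _ [n _ <-]; apply: (@le_trans _ _ (series u n.*2)).
  rewrite -subr_ge0 sub_series_geq; last by rewrite -addnn leq_addr.
  by apply: sumr_ge0.
by rewrite even_sum exp_sum_le // divr_ge0 ?sqr_ge0.
Qed.

Lemma is_cvg_pseries_char (x : R) : cvgn (pseries char_coef x).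
Proof.
have le k : `|char_coef k * x ^+ k| <= (nmatch k)%:R / k`!%:R * `|x| ^+ k.
  by rewrite normrM normrX ler_wpM2r ?exprn_ge0 ?norm_char_coef.
apply: (@normed_cvg R R); apply: (series_le_cvg _ _ le); last exact: is_cvg_char.
  by move=> n; exact: normr_ge0.
by move=> n; rewrite mulr_ge0 ?exprn_ge0 ?divr_ge0.
Qed.

Lemma char_truncE n : char_trunc q J t n = pseries char_coef t n.
Proof.
by rewrite /pseries /series /= big_mkord; apply: eq_bigr => k _; rewrite /char_coef mulrAC.
Qed.

Lemma cvg_subseq (u : R^nat) (l : R) (h : nat -> nat) : (forall n, n <= h n)%N ->
  u @ \oo --> l -> (fun n => u (h n)) @ \oo --> l.
Proof.
move=> nh ul; apply: (cvg_comp _ _ _ ul) => A [m _ mA].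
by exists m => // n /= mn; apply: mA => /=; exact: leq_trans mn (nh n).
Qed.

Lemma cvg_moment_tail :
  (fun n => \sum_(n.+1 <= k < 2 * n.+1) moment_tail t k) @ \oo --> (0 : R).
Proof.
have cu : cvgn (series (moment_tail t)).
  rewrite (_ : moment_tail t = fun k => (nmatch k)%:R / k`!%:R * `|2 * t| ^+ k).
    exact: is_cvg_char.
  by apply/funext => k; rewrite /moment_tail normrM normr_nat -mulrA mulrC.
rewrite (_ : (fun n => _) =
  (fun n => series (moment_tail t) (2 * n.+1) - series (moment_tail t) n.+1)); last first.
  by apply/funext => n; rewrite sub_series_geq //; lia.
rewrite -(subrr (limn (series (moment_tail t)))).
apply: cvgB.
  by apply: (cvg_subseq (h := fun n => (2 * n.+1)%N)) cu => n; lia.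
by apply: (cvg_subseq (h := fun n => n.+1)) cu.
Qed.

(** The truncated variances lie between 0 and (t^2/M)(1 + tail), and both bounds pass to the
    limit. *)
Lemma sff_char_fun : `|sff q J tau t - char_fun t ^+ 2| <= t ^+ 2 / M%:R.
Proof.
pose v n := complex.Re (pexp (trunc N q tau t n * conjp (trunc N q tau t n))).
pose rest (n : nat) : R := \sum_(n.+1 <= k < 2 * n.+1) moment_tail t k.
have bound n : 0 <= v n.+2 - pseries char_coef t n.+2 ^+ 2 <= t ^+ 2 / M%:R * (1 + rest n).
  have := coupling_variance_ge0 iid (trunc N q tau t n.+2).
  have := trunc_poincare oN oq qN iid tau t n.+1.
  have := pexp_square_trunc oN oq N_gt0 qN iid tau t n.
  rewrite (pexp_trunc oN oq N_gt0 iid) norm_real -char_truncE /v -/(rest n).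
  have -> (x : R) : `|x|%:C ^+ 2 = (x ^+ 2)%:C by rewrite -rmorphXn real_normK ?num_real.
  move: (pexp (square_trunc N q tau t n.+1)) (pexp (_ * _)) => [sa sb] [va vb] h1 h2 h3.
  have {}h1 : `|sa - 1| <= rest n by rewrite -lecR; apply: le_trans (normc_ge_Re _) h1.
  move: h2 h3; rewrite !lecE /= !mul0r !subr0 => /andP[_ h2] /andP[_ ->] /=.
  apply: le_trans h2 _; rewrite ler_wpM2l ?divr_ge0 ?sqr_ge0 //.
  by move: (le_trans (ler_norm _) h1); rewrite lerBlDl.
have cv : v n.+2 - pseries char_coef t n.+2 ^+ 2 @[n --> \oo] --> sff q J tau t - char_fun t ^+ 2.
  have vl : v @ \oo --> sff q J tau t := cvg_sff.
  have S2 n : (n <= n.+2)%N by rewrite -addn2 leq_addr.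
  apply: cvgB; first exact: (@cvg_subseq v _ (fun n => n.+2) S2 vl).
  rewrite expr2; under eq_fun do rewrite expr2.
  have pc : cvgn (pseries char_coef t) by exact: is_cvg_pseries_char.
  have pl := @cvg_subseq (pseries char_coef t) _ (fun n => n.+2) S2 pc.
  by apply: cvgM; exact: pl.
have cr : t ^+ 2 / M%:R * (1 + rest n) @[n --> \oo] --> t ^+ 2 / M%:R * (1 + 0).
  apply: cvgM; first exact: cvg_cst.
  by apply: cvgD; [exact: cvg_cst | exact: cvg_moment_tail].
rewrite addr0 mulr1 in cr; rewrite ger0_norm.
  by apply: (ler_cvg_to cv cr); apply: nearW => n; have /andP[] := bound n.
by apply: (ler_cvg_to (cvg_cst 0) cv); apply: nearW => n; have /andP[] := bound n.
Qed.

End FormFactorLimit.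

(** * Comparison of the characteristic function with the profile *)

Section CauchyProduct.
Local Open Scope ring_scope.
Variable R : realType.
Implicit Types (a b u : R^nat).

Lemma series_bounded_cvg u (B : R) :
  (forall k, 0 <= u k) -> (forall n, series u n <= B) -> cvgn (series u).
Proof.
move=> u0 uB; apply: nondecreasing_is_cvgn; last by exists B => _ [n _ <-]; exact: uB.
by apply/nondecreasing_seqP => n; rewrite /series /= big_nat_recr //= lerDl.
Qed.

Lemma nondecreasing_series u : (forall k, 0 <= u k) -> {homo series u : m n / (m <= n)%N >-> m <= n}.
Proof.
by move=> u0 m n mn; rewrite -subr_ge0 sub_series_geq //; exact: sumr_ge0.
Qed.

Definition conv a b n : R := \sum_(i < n) a i * series b (n - i)%N.

Lemma series_conv a b n :
  series (fun k => \sum_(i < k.+1) a i * b (k - i)%N) n = conv a b n.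
Proof.
elim: n => [|n IH]; first by rewrite /series /= big_geq // /conv big_ord0.
rewrite /series /= big_nat_recr //= -[Y in Y + _]/(series _ n) IH /conv !big_ord_recr /=.
rewrite addrA -big_split /= subnn subSnn; congr (_ + _).
  apply: eq_bigr => i _; rewrite subSn ?(ltnW (ltn_ord i)) //.
  by rewrite {2}/series /= big_nat_recr //= mulrDr.
by rewrite /series /= big_nat1.
Qed.

Lemma conv_sub a b n : series a n * series b n - conv a b n =
  \sum_(i < n) a i * (series b n - series b (n - i)%N).
Proof.
rewrite {1}/series /= big_mkord mulr_suml /conv -sumrB.
by apply: eq_bigr => i _; rewrite mulrBr.
Qed.

(** For nonnegative terms the product of the n-th partial sums lies between the partial sums of
    order n and 2n of the Cauchy product. So the gap for [a] and [b] is at most a tail of the Cauchy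
    product of absolute values. *)
Lemma cvg_conv a b : cvgn (series (fun k => `|a k|)) -> cvgn (series (fun k => `|b k|)) ->
  conv a b @ \oo --> limn (series a) * limn (series b).
Proof.
move=> ca cb; pose a' k := `|a k|; pose b' k := `|b k|.
have a'0 k : 0 <= a' k by exact: normr_ge0.
have b'0 k : 0 <= b' k by exact: normr_ge0.
have sa n : 0 <= series a' n by apply: sumr_ge0.
have sb n : 0 <= series b' n by apply: sumr_ge0.
have upper n : conv a' b' n <= series a' n * series b' n.
  rewrite -subr_ge0 conv_sub; apply: sumr_ge0 => i _; rewrite mulr_ge0 // subr_ge0.
  by apply: nondecreasing_series => //; exact: leq_subr.
have lower n : series a' n * series b' n <= conv a' b' (2 * n).
  rewrite {1}/series /= big_mkord mulr_suml /conv mul2n -addnn big_split_ord /=.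
  rewrite ler_wpDr //; first by apply: sumr_ge0 => i _; rewrite mulr_ge0.
  apply: ler_sum => i _; rewrite ler_wpM2l //; apply: nondecreasing_series => //.
  by have := ltn_ord i; lia.
pose e k := \sum_(i < k.+1) a' i * b' (k - i)%N.
have e0 k : 0 <= e k by apply: sumr_ge0 => i _; exact: mulr_ge0.
have ce : cvgn (series e).
  apply: (@series_bounded_cvg _ (limn (series a') * limn (series b'))) => // n.
  rewrite series_conv; apply: le_trans (upper n) _.
  by rewrite ler_pM // nondecreasing_cvgn_le //; exact: nondecreasing_series.
have gap n : `|series a n * series b n - conv a b n| <= series e (2 * n) - series e n.
  rewrite !series_conv; apply: (@le_trans _ _ (series a' n * series b' n - conv a' b' n)); last first.
    by rewrite lerD2r.
  rewrite !conv_sub; apply: le_trans (ler_norm_sum _ _ _) _; apply: ler_sum => i _.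
  rewrite normrM ler_wpM2l // !sub_series_geq ?leq_subr //; exact: ler_norm_sum.
have ce2 : series e (2 * n)%N @[n --> \oo] --> limn (series e).
  by apply: (@cvg_subseq _ (series e) _ (fun n => (2 * n)%N) _ ce) => n; lia.
have gap0 : series e (2 * n)%N - series e n @[n --> \oo] --> (0 : R).
  by rewrite -(subrr (limn (series e))); apply: cvgB.
have d0 : series a n * series b n - conv a b n @[n --> \oo] --> (0 : R).
  apply/norm_cvg0P; apply: (squeeze_cvgr _ (cvg_cst 0) gap0).
  by apply: nearW => n; rewrite normr_ge0 gap.
have ab : series a n * series b n @[n --> \oo] --> limn (series a) * limn (series b).
  by apply: cvgM; apply: (@normed_cvg R R).
have cd := cvgB ab d0; rewrite subr0 in cd.
rewrite (_ : conv a b =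
    (fun n => series a n * series b n - (series a n * series b n - conv a b n))).
  exact: cd.
by apply/funext => n; rewrite opprB addrCA subrr addr0.
Qed.

End CauchyProduct.

(** * Power series that converge absolutely everywhere *)

Section EntireSeries.
Local Open Scope ring_scope.
Variable R : realType.
Implicit Types (f h : R^nat) (x : R).

Definition entire f := forall x, cvgn (series (fun k => `|f k| * `|x| ^+ k)).

Lemma entire_pseries f x : entire f -> cvgn (series (fun k => `|f k * x ^+ k|)).
Proof.
move=> ef; rewrite (_ : (fun k => `|f k * x ^+ k|) = (fun k => `|f k| * `|x| ^+ k)); first exact: ef.
by apply/funext => k; rewrite normrM normrX.
Qed.

Lemma entire_cvg f x : entire f -> cvgn (pseries f x).
Proof. by move=> ef; apply: (@normed_cvg R R); exact: entire_pseries. Qed.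

Lemma entire_diffs f : entire f -> entire (pseries_diffs f).
Proof.
(* The factor 2 in [y] absorbs the k + 1 of the derivative, as k + 1 <= 2^(k+1); the 1 makes the
   powers of 1 + |x| nondecreasing. *)
move=> ef x; pose y := 2 * (1 + `|x|).
have y0 : 0 <= y by rewrite mulr_ge0 // addr_ge0.
have le k : `|pseries_diffs f k| * `|x| ^+ k <= `|f k.+1| * `|y| ^+ k.+1.
  rewrite /pseries_diffs normrM normr_nat mulrC mulrA mulrC ler_wpM2l //.
  rewrite (ger0_norm y0) exprMn mulrC; apply: ler_pM => //; rewrite ?exprn_ge0 //.
    by rewrite -natrX ler_nat ltnW // ltn_expl.
  apply: (@le_trans _ _ ((1 + `|x|) ^+ k)); first by rewrite lerXn2r ?nnegrE ?addr_ge0 ?lerDr.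
  by rewrite exprS ler_peMl ?exprn_ge0 ?addr_ge0 // lerDl.
apply: (@series_bounded_cvg _ _ (limn (series (fun k => `|f k| * `|y| ^+ k)))).
  by move=> k; rewrite mulr_ge0 ?exprn_ge0.
move=> n; apply: (@le_trans _ _ (series (fun k => `|f k| * `|y| ^+ k) n.+1)); last first.
  apply: nondecreasing_cvgn_le; last exact: ef.
  by apply: nondecreasing_series => k; rewrite mulr_ge0 ?exprn_ge0.
rewrite /series /= [leRHS]big_nat_recl //= ler_wpDl ?mulr_ge0 //.
by apply: ler_sum.
Qed.

Lemma entire_derive f x : entire f ->
  is_derive x (1 : R) (fun y : R => limn (pseries f y)) (limn (pseries (pseries_diffs f) x)).
Proof.
move=> ef; apply: (@pseries_snd_diffs _ f (`|x| + 1)).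
- exact: entire_cvg.
- by apply: entire_cvg; exact: entire_diffs.
- by apply: entire_cvg; do 2!apply: entire_diffs.
- by rewrite [ltRHS]ger0_norm ?addr_ge0 // ltrDl.
Qed.

(** The coefficient recursion sums to F' = h F. Convergence of [h] is required only at this point,
    because only a finite radius is known for the logarithmic derivative. *)
Lemma entire_derive_conv f h x : entire f -> cvgn (series (fun k => `|h k * x ^+ k|)) ->
  (forall k, k.+1%:R * f k.+1 = \sum_(i < k.+1) h i * f (k - i)%N) ->
  limn (pseries (pseries_diffs f) x) = limn (pseries h x) * limn (pseries f x).
Proof.
move=> ef ch fh; apply: cvg_lim => //.
rewrite (_ : pseries (pseries_diffs f) x =
    conv (fun k => h k * x ^+ k) (fun k => f k * x ^+ k)).
  by apply: cvg_conv => //; exact: (entire_pseries (x := x)).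
apply/funext => n; rewrite -series_conv; congr (series _ n); apply/funext => k.
rewrite -[LHS]/(pseries_diffs f k * x ^+ k) /pseries_diffs fh mulr_suml; apply: eq_bigr => -[i /= ik] _.
have -> : x ^+ k = x ^+ i * x ^+ (k - i) by rewrite -exprD subnKC.
exact: mulrACA.
Qed.

End EntireSeries.

(** * A linear differential inequality on a short interval *)

Section LinearOde.
Local Open Scope ring_scope.
Variable R : realType.

(** At a maximum of |D| on [-T, T] the mean value bound gives |D| <= T (g |D| + r) <= |D|/2 + T r.
    This takes the place of Gronwall's inequality. *)
Lemma linear_ode_small (D D' : R -> R) (T g r : R) :
  0 <= T -> g * T <= 1 / 2 -> 0 <= g -> 0 <= r -> D 0 = 0 ->
  (forall x, is_derive x (1 : R) D (D' x)) ->
  (forall x, `|x| <= T -> `|D' x| <= g * `|D x| + r) ->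
  forall x, `|x| <= T -> `|D x| <= 2 * T * r.
Proof.
move=> T0 gT g0 r0 D0 dD D'le x xT.
have cD : {within `[- T, T], continuous (fun y => `|D y|)}.
  apply: continuous_subspaceT => y; apply: continuous_comp; last exact: norm_continuous.
  exact: is_derive_continuous dD y.
have [z zT zmax] := EVT_max (ge0_cp T0).2 cD.
have in_T y : (y \in `[- T, T]) = (`|y| <= T) by rewrite in_itv /= ler_norml.
apply: (@le_trans _ _ `|D z|); first by apply: zmax; rewrite in_T.
rewrite in_T in zT.
have := @bounded_derive_lipschitz R D D' 0 z (g * `|D z| + r) dD.
rewrite subr0 => /(_ _) Dz; have {}Dz : `|D z - D 0| <= (g * `|D z| + r) * `|z|.
  apply: Dz => y; rewrite subr0 => yz; have yT := le_trans yz zT.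
  apply: le_trans (D'le y yT) _; rewrite lerD2r ler_wpM2l //.
  by apply: zmax; rewrite in_T.
rewrite D0 subr0 in Dz.
have Dz0 := normr_ge0 (D z).
have : (g * `|D z| + r) * `|z| <= (g * `|D z| + r) * T.
  by rewrite ler_wpM2l // addr_ge0 // mulr_ge0.
by nra.
Qed.

End LinearOde.

(** * Comparison of the two differential equations *)

Section ProfileComparison.
Local Open Scope ring_scope.
Variables (R : realType) (c : nat -> R) (a : R).
Hypotheses (a_ge0 : 0 <= a)
  (c_le : forall s, (0 < s)%N -> `|c s| <= 2 * (2 * s).+1`!%:R * 4 ^+ s).
Implicit Types (s r k n L : nat) (t T y : R).

Definition corr_coef s : R := (-1) ^+ s * (c s * a ^+ s) / (2 * s).+1`!%:R.

Lemma corr_coef_le s : (0 < s)%N -> `|corr_coef s| <= 2 * (4 * a) ^+ s.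
Proof.
move=> s0; rewrite /corr_coef !normrM normrX normrN1 expr1n mul1r normfV normr_nat.
rewrite (ger0_norm (exprn_ge0 s a_ge0)) ler_pdivrMr ?ltr0n ?fact_gt0 //.
apply: le_trans (ler_wpM2r (exprn_ge0 s a_ge0) (c_le s0)) _.
by rewrite exprMn le_eqVlt; apply/orP; left; apply/eqP; ring.
Qed.

Lemma corr_term_le s t T : (0 < s)%N -> `|t| <= T ->
  `|corr_coef s * t ^+ (2 * s).+1| <= 2 * T * (4 * a * T ^+ 2) ^+ s.
Proof.
move=> s0 tT; have T0 := le_trans (normr_ge0 t) tT.
rewrite normrM normrX; apply: (@le_trans _ _ (2 * (4 * a) ^+ s * T ^+ (2 * s).+1)).
  by apply: ler_pM => //; [exact: corr_coef_le | rewrite lerXn2r ?nnegrE].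
rewrite [(4 * a * _) ^+ s]exprMn -exprM [T ^+ _.+1]exprS le_eqVlt; apply/orP; left.
by apply/eqP; ring.
Qed.

Lemma sum_geometric_le y m n : 0 <= y <= 1 / 2 -> \sum_(m <= s < n) y ^+ s <= 2 * y ^+ m.
Proof.
move=> /andP[y0 y1]; have [nm|mn] := leqP n m.
  by rewrite big_geq // mulr_ge0 ?exprn_ge0.
suff : \sum_(m <= s < n) y ^+ s + 2 * y ^+ n <= 2 * y ^+ m.
  by apply: le_trans; rewrite lerDl mulr_ge0 ?exprn_ge0.
move/ltnW: mn; elim: n => [|n IH].
  by rewrite leqn0 => /eqP ->; rewrite big_geq // add0r.
rewrite leq_eqVlt => /orP[/eqP <-|]; first by rewrite big_geq // add0r.
rewrite ltnS => mn'; rewrite big_nat_recr //= -addrA; apply: le_trans (IH mn').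
by rewrite lerD2l exprS; have := exprn_ge0 n y0; nra.
Qed.

(* The Taylor coefficients of the logarithmic derivative of the characteristic function. *)
Definition log_coef k : R :=
  if odd k then (if k == 1%N then -1 else corr_coef k./2) else 0.

Lemma log_coef_odd s : (0 < s)%N -> log_coef (2 * s).+1 = corr_coef s.
Proof.
move=> s0; rewrite /log_coef /= oddM /= eqSS muln_eq0 /= (gtn_eqF s0) uphalf_half oddM /= add0n.
by rewrite mul2n doubleK.
Qed.

Lemma series_log (F : nat -> R) n : (forall k, ~~ odd k -> F k = 0) ->
  \sum_(0 <= k < 2 * n.+1) F k = F 1%N + \sum_(1 <= s < n.+1) F (2 * s).+1.
Proof.
move=> F0; elim: n => [|n IH].
  by rewrite muln1 big_nat_recr //= big_nat1 F0 // add0r big_geq // addr0.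
rewrite (_ : (2 * n.+2 = (2 * n.+1).+2)%N); last by lia.
rewrite big_nat_recr // big_nat_recr // IH /= (F0 (2 * n.+1)%N) ?oddM // addr0 -addrA; congr (_ + _).
by rewrite [RHS]big_nat_recr.
Qed.

Section Bounded.
Variables (t T : R).
Hypotheses (tT : `|t| <= T) (aT : 4 * a * T ^+ 2 <= 1 / 2).

Let T_ge0 : 0 <= T. Proof. exact: le_trans (normr_ge0 t) tT. Qed.
Let y01 : 0 <= 4 * a * T ^+ 2 <= 1 / 2.
Proof. by rewrite aT !mulr_ge0 ?sqr_ge0. Qed.

Lemma is_cvg_log : cvgn (series (fun k => `|log_coef k * t ^+ k|)).
Proof.
apply: (@series_bounded_cvg _ _ (T + 2 * T * (2 * (4 * a * T ^+ 2) ^+ 1))) => // n.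
apply: (@le_trans _ _ (series (fun k => `|log_coef k * t ^+ k|) (2 * n.+1)%N)).
  by apply: nondecreasing_series => //; lia.
rewrite /series /= series_log; last by move=> k; rewrite /log_coef => /negPf ->; rewrite mul0r normr0.
apply: lerD; first by rewrite /log_coef /= mulN1r normrN expr1.
apply: (@le_trans _ _ (\sum_(1 <= s < n.+1) 2 * T * (4 * a * T ^+ 2) ^+ s)).
  rewrite big_nat [leRHS]big_nat; apply: ler_sum => s /andP[s0 _].
  by rewrite log_coef_odd //; exact: corr_term_le.
by rewrite -mulr_sumr ler_wpM2l ?sum_geometric_le // mulr_ge0.
Qed.

Lemma log_series_approx m :
  `|limn (pseries log_coef t) + t - \sum_(1 <= s < m.+1) corr_coef s * t ^+ (2 * s).+1|
  <= 4 * T * (4 * a * T ^+ 2) ^+ m.+1.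
Proof.
pose S n := \sum_(1 <= s < n.+1) corr_coef s * t ^+ (2 * s).+1.
have SE n : pseries log_coef t (2 * n.+1)%N = - t + S n.
  rewrite /pseries /series /= series_log; last by move=> k; rewrite /log_coef => /negPf ->; rewrite mul0r.
  rewrite /log_coef /= mulN1r expr1; congr (_ + _).
  rewrite big_nat [RHS]big_nat; apply: eq_bigr => s /andP[s0 _].
  by have := log_coef_odd s0; rewrite /log_coef => ->.
have cl : cvgn (pseries log_coef t) by apply: (@normed_cvg R R); exact: is_cvg_log.
have c2 : (- t + S n) + t - S m @[n --> \oo] --> limn (pseries log_coef t) + t - S m.
  apply: cvgB; last exact: cvg_cst.
  apply: cvgD; last exact: cvg_cst.
  rewrite (_ : (fun n => - t + S n) = (fun n => pseries log_coef t (2 * n.+1)%N)).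
    by apply: (@cvg_subseq _ (pseries log_coef t) _ (fun n => (2 * n.+1)%N) _ cl) => n; lia.
  by apply/funext => n; rewrite SE.
apply: (ler_cvg_to (cvg_norm c2) (cvg_cst _)); exists m => // n /= mn.
rewrite [- t + _ + t]addrAC addNr add0r /S (big_cat_nat (n := m.+1)) //= addrAC subrr add0r.
apply: le_trans (ler_norm_sum _ _ _) _.
apply: (@le_trans _ _ (\sum_(m.+1 <= s < n.+1) 2 * T * (4 * a * T ^+ 2) ^+ s)).
  rewrite big_nat [leRHS]big_nat; apply: ler_sum => s /andP[s0 _].
  by apply: corr_term_le => //; exact: leq_ltn_trans s0.
rewrite -mulr_sumr (_ : 4 * T * _ = 2 * T * (2 * (4 * a * T ^+ 2) ^+ m.+1)); last by ring.
by rewrite ler_wpM2l ?sum_geometric_le // mulr_ge0.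
Qed.

End Bounded.

Local Notation w s := (wick (theta_poly c s)).

(** The origin of the base 12: with ratio 4/12 the geometric sum 2/3 + 2/9 + ... equals 1, so the
    recursive bound reproduces itself. *)
Lemma sum_pow_4_12 s : \sum_(1 <= r < s.+1) 2 * 4 ^+ r * 12 ^+ (s - r) = 12 ^+ s - 4 ^+ s :> R.
Proof.
elim: s => [|s IH]; first by rewrite big_geq // subrr.
rewrite big_nat_recr //= subnn expr0 mulr1.
rewrite (_ : \sum_(1 <= r < s.+1) _ = 12 * (12 ^+ s - 4 ^+ s)).
  by rewrite !exprS; ring.
rewrite -IH mulr_sumr big_nat [RHS]big_nat; apply: eq_bigr => r /andP[_ rs].
by rewrite subSn // exprS; ring.
Qed.

(** The polynomial vanishes at 0 for s >= 1, so a bound on its derivative suffices. As T >= 1 and r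
    >= 1, the derivative costs at most T^(4s-1), and integration adds one power. *)
Lemma wick_theta_bound s t T : 1 <= T -> `|t| <= T -> `|(w s).[t]| <= 12 ^+ s * T ^+ (4 * s).
Proof.
move=> T1 tT; have T0 : 0 <= T by exact: le_trans T1.
elim/ltn_ind: s t tT => -[|s] IH t tT; first by rewrite wick0 hornerC normr1 !expr0 mulr1.
have w0 : (w s.+1).[0] = 0.
  rewrite horner_coef0 coef_wick; apply/eqP; rewrite mulf_eq0; apply/orP; right.
  by apply: contraT => /(theta_poly_support (ltn0Sn s)); rewrite addn2.
have := @bounded_derive_lipschitz R (fun x => (w s.+1).[x]) (fun x => (w s.+1)^`().[x]) 0 t
  (12 ^+ s.+1 * T ^+ (4 * s).+3) (fun x => is_derive_poly (w s.+1) x).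
rewrite w0 !subr0 => H; apply: le_trans (H _) _; last first.
  rewrite (_ : (4 * s.+1 = (4 * s).+4)%N); last by lia.
  by rewrite [T ^+ (4 * s).+4]exprSr mulrA ler_wpM2l // mulr_ge0 ?exprn_ge0.
move=> x; rewrite subr0 => xt; have xT := le_trans xt tT.
rewrite wick_theta_deriv horner_sum; apply: le_trans (ler_norm_sum _ _ _) _.
apply: (@le_trans _ _ (\sum_(1 <= r < s.+2) 2 * 4 ^+ r * 12 ^+ (s.+1 - r) * T ^+ (4 * s).+3)).
  rewrite big_nat [leRHS]big_nat; apply: ler_sum => r /andP[r0 rs].
  rewrite hornerZ hornerM hornerXn !normrM normrX normrN1 expr1n mul1r normfV normr_nat normrX.
  have cr : `|c r| / (2 * r).+1`!%:R <= 2 * 4 ^+ r.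
    by rewrite ler_pdivrMr ?ltr0n ?fact_gt0 // mulrAC; exact: c_le.
  rewrite -[leRHS]mulrA; apply: ler_pM => //; rewrite ?divr_ge0 // ?mulr_ge0 ?exprn_ge0 //.
  have ws : `|(w (s.+1 - r)).[x]| <= 12 ^+ (s.+1 - r) * T ^+ (4 * (s.+1 - r)).
    by apply: IH => //; lia.
  apply: (@le_trans _ _ (T ^+ (2 * r).+1 * (12 ^+ (s.+1 - r) * T ^+ (4 * (s.+1 - r))))).
    by apply: ler_pM => //; rewrite ?exprn_ge0 ?lerXn2r ?nnegrE.
  rewrite mulrCA -exprD ler_wpM2l ?exprn_ge0 //.
  by apply: ler_weXn2l => //; move: r0 rs; clear; lia.
by rewrite -mulr_suml sum_pow_4_12 ler_wpM2r ?exprn_ge0 // gerBl exprn_ge0.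
Qed.

Local Notation Q L := (profile_poly c a L).

Lemma profile_polyE L : Q L = \sum_(0 <= s < L.+1) a ^+ s *: w s.
Proof. by rewrite big_nat_recl // wick0 expr0 scale1r /profile_poly big_add1. Qed.

(** The index L - r expresses the truncation: replacing it by L throughout would give an exact
    linear equation, and the difference is the residual estimated in [char_approx]. *)
Lemma profile_deriv L : (Q L)^`() =
  \sum_(1 <= r < L.+1) corr_coef r *: ('X^((2 * r).+1) * Q (L - r)).
Proof.
elim: L => [|L IH]; first by rewrite /profile_poly !big_geq // addr0 derivC.
rewrite {1}/profile_poly big_nat_recr //= addrA -/(profile_poly c a L) derivD IH.
rewrite derivZ wick_theta_deriv [Y in _ *: Y]big_nat_recr //= scalerDr addrA [RHS]big_nat_recr //=.
congr (_ + _); last first.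
  rewrite subnn wick0 /profile_poly big_geq // addr0 scalerA; congr (_ *: _).
  by rewrite /corr_coef; ring.
rewrite scaler_sumr -big_split /= big_nat [RHS]big_nat; apply: eq_bigr => r /andP[r0 rL].
rewrite subSn // [Q (L - r).+1]profile_polyE big_nat_recr //= -profile_polyE.
move: (profile_poly c a (L - r)) => p; rewrite mulrDr scalerDr.
congr (_ + _); rewrite -subSn // -[in RHS]scalerAr ![in LHS]scalerA [in RHS]scalerA.
congr (_ *: _); rewrite /corr_coef (_ : a ^+ L.+1 = a ^+ r * a ^+ (L.+1 - r)); first by ring.
by rewrite -exprD subnKC // ltnW.
Qed.

Variables (f : nat -> R).
Hypotheses (f0 : f 0%N = 1) (f_entire : entire f)
  (f_rec : forall k, k.+1%:R * f k.+1 = \sum_(i < k.+1) log_coef i * f (k - i)%N).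

Local Notation F := (fun x : R => limn (pseries f x)).

(** Multiplying by exp(t^2/2) removes the leading term -t of the logarithmic derivative. What
    remains is O(a T^3), small enough on [-T, T] for [linear_ode_small]. *)
Lemma char_approx L t T : 1 <= T -> `|t| <= T -> 32 * (a * T ^+ 4) <= 1 ->
  `|(Q L).[t]| <= 2 /\
  `|limn (pseries f t) - expR (- (t ^+ 2 / 2)) * (Q L).[t]| <=
    (8 * L%:R + 16) * 12 ^+ L.+1 * (T ^+ 2 * (a * T ^+ 4) ^+ L.+1).
Proof.
move=> T1 tT xT; pose x := 12 * (a * T ^+ 4).
have T0 : 0 <= T by exact: le_trans T1.
have x0 : 0 <= x by rewrite /x !mulr_ge0 ?exprn_ge0.
have x01 : 0 <= x <= 1 / 2 by rewrite x0 /x; lra.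
have yx : 4 * a * T ^+ 2 <= x.
  rewrite /x -mulrA; apply: ler_pM => //; rewrite ?mulr_ge0 ?sqr_ge0 //; first by lra.
  by rewrite ler_wpM2l //; apply: ler_weXn2l.
have aT : 4 * a * T ^+ 2 <= 1 / 2 by apply: le_trans yx _; have /andP[] := x01.
have y0 : 0 <= 4 * a * T ^+ 2 by rewrite !mulr_ge0 ?sqr_ge0.
have wx s y : `|y| <= T -> `|a ^+ s * (w s).[y]| <= x ^+ s.
  move=> yT; rewrite normrM (ger0_norm (exprn_ge0 s a_ge0)) /x exprMn exprMn -exprM mulrCA.
  by rewrite ler_wpM2l ?exprn_ge0 // wick_theta_bound.
have Qdiff m n y : (m <= n)%N -> `|y| <= T -> `|(Q n).[y] - (Q m).[y]| <= 2 * x ^+ m.+1.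
  move=> mn yT; rewrite !profile_polyE !horner_sum (big_cat_nat (n := m.+1)) //=.
  rewrite addrAC subrr add0r; apply: le_trans (ler_norm_sum _ _ _) _.
  apply: le_trans (sum_geometric_le _ _ x01).
  by apply: ler_sum => s _; rewrite hornerZ wx.
have Q2 n y : `|y| <= T -> `|(Q n).[y]| <= 2.
  move=> yT; have := Qdiff 0%N n y isT yT.
  have -> : (Q 0).[y] = 1 by rewrite /profile_poly big_geq // addr0 hornerC.
  move=> H; have := ler_normB ((Q n).[y] - 1) (-1); rewrite opprK subrK normrN1 => H'.
  by apply: le_trans H' _; have /andP[_] := x01; move: H; rewrite expr1; lra.
split; first exact: Q2.
pose g y := limn (pseries log_coef y) + y.
(* The tail of the logarithmic derivative contributes 8 T x^(L+1), and each of the L truncated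
   products 4 T x^(L+1). *)
pose rho := (4 * L%:R + 8) * T * x ^+ L.+1.
have g_le y : `|y| <= T -> `|g y| <= 4 * T * (4 * a * T ^+ 2).
  by move=> yT; have := log_series_approx yT aT 0; rewrite big_geq // subr0 expr1.
have rho_le y : `|y| <= T -> `|g y * (Q L).[y] - (Q L)^`().[y]| <= rho.
  move=> yT; pose gL := \sum_(1 <= r < L.+1) corr_coef r * y ^+ (2 * r).+1.
  have -> : g y * (Q L).[y] - (Q L)^`().[y] = (g y - gL) * (Q L).[y] +
      \sum_(1 <= r < L.+1) corr_coef r * y ^+ (2 * r).+1 * ((Q L).[y] - (Q (L - r)).[y]).
    rewrite profile_deriv horner_sum mulrBl -addrA; congr (_ + _).
    rewrite /gL mulr_suml -sumrN -sumrN -big_split /=; apply: eq_bigr => r _.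
    by rewrite hornerZ hornerM hornerXn; ring.
  have H1 : `|(g y - gL) * (Q L).[y]| <= 4 * T * x ^+ L.+1 * 2.
    rewrite normrM; apply: ler_pM => //; last exact: Q2.
    apply: le_trans (log_series_approx yT aT L) _; rewrite ler_wpM2l ?mulr_ge0 //.
    by rewrite lerXn2r ?nnegrE.
  have H2 : `|\sum_(1 <= r < L.+1) corr_coef r * y ^+ (2 * r).+1 * ((Q L).[y] - (Q (L - r)).[y])|
      <= \sum_(1 <= r < L.+1) 4 * T * x ^+ L.+1.
    apply: le_trans (ler_norm_sum _ _ _) _; rewrite big_nat [leRHS]big_nat.
    apply: ler_sum => r /andP[r0 rL]; rewrite normrM.
    rewrite (_ : 4 * T * _ = 2 * T * x ^+ r * (2 * x ^+ (L - r).+1)); last first.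
      by rewrite -subSn // -[in LHS](subnKC (ltnW rL)) exprD; ring.
    apply: ler_pM => //; last by apply: Qdiff => //; exact: leq_subr.
    apply: le_trans (corr_term_le r0 yT) _; rewrite ler_wpM2l ?mulr_ge0 //.
    by rewrite lerXn2r ?nnegrE.
  apply: le_trans (ler_normD _ _) _; apply: le_trans (lerD H1 H2) _.
  rewrite sumr_const_nat subSS subn0 -mulr_natr /rho le_eqVlt; apply/orP; left; apply/eqP.
  by ring.
(* D' = g D + (g Q - Q'), where g is the logarithmic derivative with the Gaussian part -y
   removed. *)
pose D y := limn (pseries f y) * expR (y ^+ 2 / 2) - (Q L).[y].
pose D' y := (limn (pseries (pseries_diffs f) y) + y * limn (pseries f y)) * expR (y ^+ 2 / 2)
  - (Q L)^`().[y].
have D0 : D 0 = 0.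
  have p0 : limn (pseries f 0) = 1.
    apply: cvg_lim => //; apply: cvg_near_cst.
    exists 1%N => // n /= n0; rewrite /pseries /series /= big_ltn // f0 expr0 mulr1.
    rewrite big_nat big1 ?addr0 // => k /andP[k0 _].
    by rewrite expr0n (gtn_eqF k0) mulr0.
  rewrite /D p0 expr0n /= mul0r expR0 mulr1 profile_polyE horner_sum big_nat_recl //=.
  rewrite expr0 scale1r wick0 hornerC big1 ?addr0 ?subrr // => s _.
  rewrite hornerZ horner_coef0 coef_wick.
  have -> : (theta_poly c s.+1)`_0 = 0 by
    apply/eqP; apply: contraT => /(theta_poly_support (ltn0Sn s)); rewrite addn2.
  by rewrite !mulr0.
have dD y : is_derive y (1 : R) D (D' y).
  have dF := entire_derive y f_entire; have dQ := is_derive_poly (Q L) y.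
  have dE : is_derive y (1 : R) (fun z : R => expR (z ^+ 2 / 2)) (expR (y ^+ 2 / 2) * y).
    by apply: is_derive_eq; rewrite /GRing.scale /=; field.
  rewrite /D /D'; apply: is_derive_eq; rewrite /GRing.scale /=; ring.
have D'_le y : `|y| <= T -> `|D' y| <= 4 * T * (4 * a * T ^+ 2) * `|D y| + rho.
  move=> yT; have -> : D' y = g y * D y + (g y * (Q L).[y] - (Q L)^`().[y]).
    rewrite /D' (entire_derive_conv f_entire (is_cvg_log yT aT) f_rec) /D /g.
    ring.
  apply: le_trans (ler_normD _ _) _; apply: lerD; last exact: rho_le.
  by rewrite normrM ler_wpM2r // g_le.
(* The origin of 32: here 16 a T^4 <= 1/2 is needed. *)
have gT : 4 * T * (4 * a * T ^+ 2) * T <= 1 / 2.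
  rewrite (_ : 4 * T * _ * T = 16 * (a * T ^+ 4)); last by ring.
  by lra.
have rho0 : 0 <= rho by rewrite /rho !mulr_ge0 ?addr_ge0 ?exprn_ge0 // mulr_ge0.
have gx0 : 0 <= 4 * T * (4 * a * T ^+ 2) by rewrite !mulr_ge0 ?sqr_ge0.
have := linear_ode_small T0 gT gx0 rho0 D0 dD D'_le tT.
have -> : limn (pseries f t) - expR (- (t ^+ 2 / 2)) * (Q L).[t] = expR (- (t ^+ 2 / 2)) * D t.
  by rewrite /D mulrBr mulrCA -expRD addNr expR0 mulr1.
move=> H; rewrite normrM (ger0_norm (expR_ge0 _)).
apply: le_trans (ler_piMl (normr_ge0 _) _) _.
  by rewrite -[leRHS]expR0 ler_expR oppr_le0 divr_ge0 ?sqr_ge0.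
apply: le_trans H _; rewrite /rho /x [in leLHS]exprMn le_eqVlt; apply/orP; left; apply/eqP.
by ring.
Qed.

End ProfileComparison.

(** * Bounds on the anticommutation proportion *)

Section AlphaBounds.
Variables (R : realType) (N q : nat).
Hypotheses (q_ge2 : (2 <= q)%N) (qN : (2 * q < N)%N).
Local Open Scope ring_scope.

(** Markov's inequality: an odd intersection has size at least 1, and the mean intersection size
    q^2/N comes from Vandermonde's identity. *)
Lemma odd_intersection_le :
  (N * \sum_(r < q.+1 | odd r) 'C(q, r) * 'C(N - q, q - r) <= q ^ 2 * 'C(N, q))%N.
Proof.
have [p qE] : exists p, q = p.+1 by exists q.-1; rewrite prednK // ltnW.
have : (\sum_(r < q.+1 | odd r) 'C(q, r) * 'C(N - q, q - r) <= q * 'C(N.-1, p))%N.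
  apply: (@leq_trans (\sum_(r < q.+1) r * 'C(q, r) * 'C(N - q, q - r))).
    rewrite big_mkcond leq_sum // => r _; case: ifP => // or.
    by rewrite -mulnA leq_pmull //; case: (nat_of_ord r) or.
  rewrite qE big_ord_recl !mul0n add0n (_ : N.-1 = (p + (N - p.+1))%N); last by lia.
  rewrite -binomial.Vandermonde big_distrr leq_sum // => r _.
  rewrite lift0 -mul_bin_diag subSS.
  by rewrite -[leqRHS]/(p.+1 * ('C(p, r) * 'C(N - p.+1, p - r)))%N mulnA.
move/(leq_mul (leqnn N)) => H; apply: leq_trans H _.
by rewrite mulnCA qE mul_bin_diag mulnA.
Qed.

Lemma alpha_le : alpha R N q <= q%:R ^+ 2 / N%:R.
Proof.
have M0 : (0 < 'C(N, q))%N by rewrite bin_gt0; lia.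
rewrite /alpha ler_pdivrMr ?ltr0n // mulrAC ler_pdivlMr ?ltr0n; last by lia.
by rewrite -natrX -!natrM ler_nat mulnC odd_intersection_le.
Qed.

Lemma alpha_pos : 0 < alpha R N q.
Proof.
rewrite /alpha divr_gt0 // ltr0n ?bin_gt0; last by lia.
have h1 : (1 < q.+1)%N by lia.
rewrite (bigD1 (Ordinal h1)) //= addn_gt0 muln_gt0 !bin_gt0.
by apply/orP; left; apply/andP; split; lia.
Qed.

End AlphaBounds.

(** * The characteristic function satisfies its differential equation *)

Section CharacteristicCoefficients.
Local Open Scope ring_scope.
Variables (R : realType) (N q : nat).
Hypotheses (oN : ~~ odd N) (oq : ~~ odd q) (N_gt0 : (0 < N)%N) (qN : (2 * q < N)%N).
Context d (Omega : measurableType d) (P : probability Omega R).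
Variable J : {set 'I_N} -> {RV P >-> R}.
Hypothesis iid : iid_std_normal (qsubsets N q) J.
Hypothesis alpha_gt0 : 0 < alpha R N q.
Local Notation a := (alpha R N q).
Local Notation cc := (coef_c a (moment q J)).

Let M_gt0 : (0 < 'C(N, q))%N. Proof. by rewrite bin_gt0; lia. Qed.

Lemma char_coef0 : char_coef q J 0 = 1.
Proof. by rewrite /char_coef (moment0 oN oq N_gt0 iid) /sgn_half /= fact0 divr1 mulr1. Qed.

Lemma entire_char_coef : entire (char_coef q J).
Proof.
move=> x; have le k : `|char_coef q J k| * `|x| ^+ k <= (nmatch k)%:R / k`!%:R * `|x| ^+ k.
  by rewrite ler_wpM2r ?exprn_ge0 // (norm_char_coef oN oq N_gt0 iid).
apply: (series_le_cvg _ _ le); last exact: is_cvg_char.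
  by move=> k; rewrite mulr_ge0 ?exprn_ge0.
by move=> k; rewrite mulr_ge0 ?exprn_ge0 ?divr_ge0.
Qed.

Lemma log_coef_cumulant (k i : nat) : (i <= k)%N ->
  sgn_half R k.+1 * (cumulant q J i / i`!%:R) = log_coef cc a i * sgn_half R (k - i)%N.
Proof.
move=> ik; have [oi|ei] := boolP (odd i); last first.
  by rewrite /cumulant /log_coef (negPf ei) !mul0r mulr0.
have [m iE] : exists m, i = (2 * m).+1 by exists i./2; lia.
rewrite (_ : k.+1 = (2 * m.+1 + (k - i))%N); last by lia.
have -> : log_coef cc a i = (-1) ^+ m.+1 * (cumulant q J i / i`!%:R).
  rewrite iE; case: m {iE} => [|m].
    by rewrite muln0 (_ : 1`! = 1%N) // /cumulant /log_coef /= divr1 expr1 mulr1.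
  rewrite cumulant_odd // log_coef_odd // /corr_coef [in RHS]exprS.
  by ring.
by rewrite sgn_halfD; ring.
Qed.

(** The moment-cumulant recursion divided by k!; [sgn_half] carries the powers of i that distinguish
    characteristic from moment generating function. *)
Lemma char_coef_rec (k : nat) : k.+1%:R * char_coef q J k.+1 =
  \sum_(i < k.+1) log_coef cc a i * char_coef q J (k - i)%N.
Proof.
rewrite /char_coef (cumulantP oN oq N_gt0 iid M_gt0 alpha_gt0) factS natrM invfM.
have k0 : (k.+1%:R : R) != 0 by rewrite pnatr_eq0.
have f0 m : (m`!%:R : R) != 0 by rewrite pnatr_eq0 -lt0n fact_gt0.
transitivity (sgn_half R k.+1 * (\sum_(i < k.+1) 'C(k, i)%:R * (cumulant q J i * moment q J (k - i)))
    / k`!%:R).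
  move: (\sum_(i < _) _) (sgn_half R _) (k.+1%:R) (k`!%:R) k0 (f0 k) => s u x y x0 y0.
  by field; rewrite x0 y0.
rewrite mulr_sumr mulr_suml; apply: eq_bigr => -[i /= ik] _.
have := log_coef_cumulant (ik : (i <= k)%N) => H.
have -> : log_coef cc a i * (sgn_half R (k - i) * moment q J (k - i) / (k - i)`!%:R) =
    log_coef cc a i * sgn_half R (k - i) * moment q J (k - i) / (k - i)`!%:R by rewrite !mulrA.
rewrite -{}H.
have := bin_fact (ik : (i <= k)%N) => /(congr1 (fun n => n%:R : R)); rewrite !natrM => <-.
have b0 : ('C(k, i)%:R : R) != 0 by rewrite pnatr_eq0 -lt0n bin_gt0.
by move: (f0 i) (f0 (k - i)%N) b0 => h1 h2 h3; field; rewrite h1 h2 h3.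
Qed.

End CharacteristicCoefficients.

(** * Exponent bookkeeping *)

Section PowerBounds.
Local Open Scope ring_scope.
Variable R : realType.
Implicit Types (a u x : R) (m n : nat).

Lemma expR_ge_monomial u n : 0 <= u -> u ^+ n / n`!%:R <= expR u.
Proof.
move=> u0; apply: le_trans (exp_sum_le n.+1 u0); rewrite big_ord_recr /= lerDr.
by apply: sumr_ge0 => k _; rewrite divr_ge0 ?exprn_ge0.
Qed.

Lemma powR_5th (x y : R) : 0 <= x -> 0 <= y -> x ^+ 5 <= y ^+ 4 -> x <= y `^ (4 / 5).
Proof.
move=> x0 y0 xy.
have -> : x = (x ^+ 5) `^ (5^-1) by rewrite -powR_mulrn // -powRrM mulfV // powRr1.
rewrite powRrM powR_mulrn //; apply: ge0_ler_powR => //; rewrite ?nnegrE ?exprn_ge0 //.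
Qed.

(** Compare fifth powers: the left side exceeds the fourth power of the base by a^m T^(12m+10),
    which is at most (a T^22)^m because m >= 1. This is where 22 comes from. *)
Lemma error_term_le a (T : R) m : 0 <= a -> 1 <= T -> a * T ^+ 22 <= 1 -> (0 < m)%N ->
  T ^+ 2 * (a * T ^+ 4) ^+ m <= (a ^+ m * T ^+ (2 * m)) `^ (4 / 5).
Proof.
move=> a0 T1 aT m0; have T0 : 0 <= T by exact: le_trans T1.
apply: powR_5th; rewrite ?mulr_ge0 ?exprn_ge0 ?mulr_ge0 ?exprn_ge0 //.
rewrite (_ : (T ^+ 2 * (a * T ^+ 4) ^+ m) ^+ 5 =
  (a ^+ m * T ^+ (2 * m)) ^+ 4 * (a ^+ m * T ^+ (12 * m + 10))); last first.
  rewrite !exprMn -!exprM [RHS]mulrACA -!exprD mulrCA -exprD.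
  by congr (_ ^+ _ * _ ^+ _); clear; lia.
rewrite -[leRHS]mulr1 ler_wpM2l ?exprn_ge0 ?mulr_ge0 ?exprn_ge0 //.
apply: (@le_trans _ _ ((a * T ^+ 22) ^+ m)); last by rewrite exprn_ile1 ?mulr_ge0 ?exprn_ge0.
rewrite exprMn -exprM ler_wpM2l ?exprn_ge0 //; apply: ler_weXn2l => //.
by move: m0; clear; lia.
Qed.

(** Used with u = log 1/alpha and T^2 <= K u, so that T^22 <= (K u)^11; the twelfth Taylor term of
    the exponential beats this power. *)
Lemma small_of_log_large (K : R) : 0 <= K -> exists U : R,
  forall u, U <= u -> 0 < u -> 32 * (expR (- u) * (K * u) ^+ 11) <= 1.
Proof.
move=> K0; have := @expR_ge_monomial ^~ 12%N.
move: (12`!)%N (fact_gt0 12%N) => f f0 E; exists (32 * f%:R * K ^+ 11) => u H u0.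
have := E u (ltW u0); rewrite ler_pdivrMr ?ltr0n // => {}E.
rewrite expRN mulrCA mulrC ler_pdivrMr ?expR_gt0 // mul1r.
rewrite -(ler_pM2r (_ : 0 < u * f%:R)); last by rewrite mulr_gt0 ?ltr0n.
apply: (@le_trans _ _ (u ^+ 12 * (32 * f%:R * K ^+ 11))).
  by rewrite exprMn [u ^+ 12]exprS le_eqVlt; apply/orP; left; apply/eqP; ring.
by rewrite [leRHS]mulrCA [leRHS]mulrC; apply: ler_pM => //; rewrite ?exprn_ge0 ?mulr_ge0 ?(ltW u0) ?exprn_ge0.
Qed.

Lemma main_term_le a u (T : R) m : 0 <= a -> 0 <= u -> 0 <= T -> T ^+ 2 <= m%:R * u -> (0 < m)%N ->
  (a ^+ m * T ^+ (2 * m)) `^ (4 / 5) <= m%:R ^+ m * (a * u) `^ (4 * m%:R / 5).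
Proof.
move=> a0 u0 T0 Tu m0.
have -> : 4 * m%:R / 5 = m%:R * (4 / 5) :> R by rewrite mulrAC mulrC.
rewrite [(a * u) `^ _]powRrM [(a * u) `^ _]powR_mulrn ?mulr_ge0 //.
apply: (@le_trans _ _ ((m%:R ^+ m * (a * u) ^+ m) `^ (4 / 5))).
  apply: ge0_ler_powR; rewrite ?nnegrE ?mulr_ge0 ?exprn_ge0 ?mulr_ge0 //.
  rewrite exprM -!exprMn; apply: lerXn2r; rewrite ?nnegrE ?mulr_ge0 ?sqr_ge0 //.
  by rewrite [leRHS]mulrCA ler_wpM2l.
rewrite powRM ?exprn_ge0 ?mulr_ge0 // ler_wpM2r ?powR_ge0 //.
rewrite -[leRHS]powRr1 ?exprn_ge0 //; apply: ler_powR; last by lra.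
by apply: exprn_ege1; rewrite ler1n.
Qed.

End PowerBounds.

(** * Form factor and profile put together *)

Section Assembly.
Local Open Scope ring_scope.
Variables (R : realType) (N q L : nat).
Hypotheses (oN : ~~ odd N) (oq : ~~ odd q) (N_gt0 : (0 < N)%N) (qN : (2 * q < N)%N).
Context d (Omega : measurableType d) (P : probability Omega R).
Variable J : {set 'I_N} -> {RV P >-> R}.
Hypothesis iid : iid_std_normal (qsubsets N q) J.
Hypothesis alpha_gt0 : 0 < alpha R N q.
Local Notation a := (alpha R N q).

Definition approx_const : R := (8 * L%:R + 16) * 12 ^+ L.+1.

Lemma approx_const_ge0 : 0 <= approx_const.
Proof. by rewrite /approx_const mulr_ge0 ?exprn_ge0 // addr_ge0 ?mulr_ge0. Qed.

Lemma sff_profile_le (tau : sector) (t T : R) : 1 <= T -> `|t| <= T -> 32 * (a * T ^+ 22) <= 1 ->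
  `|sff q J tau t - sqnormc (fourier (syk_profile q J L) t)| <=
  (approx_const * (approx_const + 4) + 1) *
    ((a ^+ L.+1 * T ^+ (2 * L + 2)) `^ (4 / 5) + T ^+ 2 / 'C(N, q)%:R).
Proof.
move=> T1 tT aT22; have T0 : 0 <= T by exact: le_trans T1.
have a0 := ltW alpha_gt0.
have M_gt0 : (0 < 'C(N, q))%N by rewrite bin_gt0; lia.
have aT k : (k <= 22)%N -> 32 * (a * T ^+ k) <= 1.
  move=> k22; apply: le_trans aT22; rewrite ler_wpM2l // ler_wpM2l //.
  exact: ler_weXn2l.
have [q2 Fq] := char_approx a0 (coef_c_bound oN oq N_gt0 iid M_gt0 alpha_gt0)
  (char_coef0 oN oq N_gt0 iid) (entire_char_coef oN oq N_gt0 iid)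
  (char_coef_rec oN oq N_gt0 qN iid alpha_gt0) L T1 tT (aT 4%N isT).
rewrite /syk_profile fourier_varrho.
move: q2 Fq; set Q := (profile_poly _ _ _).[t] => q2; set E := expR _ * Q.
rewrite -/(char_fun q J t) -/approx_const; set x := T ^+ 2 * _ => Fq.
have x0 : 0 <= x by rewrite /x mulr_ge0 ?exprn_ge0 ?mulr_ge0 ?exprn_ge0.
have x1 : x <= 1.
  apply: (@le_trans _ _ (T ^+ 2 * (a * T ^+ 4))).
    rewrite /x ler_wpM2l ?exprn_ge0 // exprS ler_piMr ?mulr_ge0 ?exprn_ge0 //.
    rewrite exprn_ile1 ?mulr_ge0 ?exprn_ge0 //.
    by have := aT 4%N isT; have : 0 <= a * T ^+ 4 by [rewrite mulr_ge0 ?exprn_ge0|]; lra.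
  have := aT 6%N isT; have : 0 <= a * T ^+ 6 by rewrite mulr_ge0 ?exprn_ge0.
  by rewrite (_ : T ^+ 2 * _ = a * T ^+ 6); [lra | ring].
have E2 : `|E| <= 2.
  rewrite normrM (ger0_norm (expR_ge0 _)); apply: le_trans q2; rewrite ler_piMl //.
  by rewrite -[leRHS]expR0 ler_expR oppr_le0 divr_ge0 ?sqr_ge0.
have -> : sqnormc E%:C%C = E ^+ 2 by rewrite /sqnormc /= expr0n addr0.
have xB : x <= (a ^+ L.+1 * T ^+ (2 * L + 2)) `^ (4 / 5).
  rewrite (_ : (2 * L + 2 = 2 * L.+1)%N); last by clear; lia.
  by apply: error_term_le => //; have := aT22; have : 0 <= a * T ^+ 22 by [rewrite mulr_ge0 ?exprn_ge0|]; lra.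
have := sff_char_fun oN oq N_gt0 qN iid tau t; rewrite card_qsubsets => H.
have K0 := approx_const_ge0.
(* Factor the difference of squares: |F - E| <= K x and |F + E| <= K x + 2 |E| <= K + 4. *)
have F2 : `|char_fun q J t ^+ 2 - E ^+ 2| <= approx_const * (approx_const + 4) * x.
  rewrite subr_sqr normrM (_ : _ * _ * x = approx_const * x * (approx_const + 4)); last by ring.
  apply: ler_pM => //; rewrite (_ : char_fun _ _ _ + E = (char_fun q J t - E) + (E + E)); last by ring.
  apply: le_trans (ler_normD _ _) _; apply: lerD; last first.
    by apply: le_trans (ler_normD _ _) _; lra.
  by apply: le_trans Fq _; rewrite ler_piMr.
have tT2 : t ^+ 2 / 'C(N, q)%:R <= T ^+ 2 / 'C(N, q)%:R.
  by rewrite ler_wpM2r ?invr_ge0 // -(real_normK (num_real t)) lerXn2r ?nnegrE.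
have c0 : 0 <= approx_const * (approx_const + 4) by rewrite mulr_ge0 ?addr_ge0.
have TM0 : 0 <= T ^+ 2 / 'C(N, q)%:R by rewrite divr_ge0 ?sqr_ge0.
rewrite (_ : sff q J tau t - _ = (sff q J tau t - char_fun q J t ^+ 2) +
  (char_fun q J t ^+ 2 - E ^+ 2)); last by ring.
apply: le_trans (ler_normD _ _) _; apply: le_trans (lerD (le_trans H tT2) F2) _.
move: (T ^+ 2 / _) (_ `^ _) (approx_const * _) xB TM0 c0 x0 => u v K xv u0 KK x0.
by rewrite addrC mulrDr; apply: lerD; nra.
Qed.

End Assembly.

(** * Consequences of the bound on q *)

Section Asymptotics.
Local Open Scope ring_scope.
Variables (R : realType) (eps : R) (N q : nat).
Hypotheses (eps_gt0 : 0 < eps) (N_ge2 : (2 <= N)%N) (q_ge2 : (2 <= q)%N)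
  (q_le : q%:R <= N%:R `^ (2^-1 - eps) :> R).

Lemma sqr_q_le : q%:R ^+ 2 <= N%:R * N%:R `^ (- (2 * eps)) :> R.
Proof.
have N0 : 0 < N%:R :> R by rewrite ltr0n ltnW.
apply: (@le_trans _ _ ((N%:R `^ (2^-1 - eps)) ^+ 2)); first by rewrite lerXn2r ?nnegrE ?powR_ge0.
rewrite -powR_mulrn ?powR_ge0 // -powRrM -[Y in _ <= Y * _]powRr1 ?ler0n // -powRD ?(gt_eqF N0) ?implybT //.
by rewrite le_eqVlt; apply/orP; left; apply/eqP; congr (_ `^ _); field.
Qed.

(** As q >= 2, one has 2q <= q^2 < N. *)
Lemma double_q_lt : (2 * q < N)%N.
Proof.
have N1 : 1 < N%:R :> R by rewrite ltr1n.
have N0 : 0 < N%:R :> R by exact: lt_trans N1.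
have : q%:R ^+ 2 < N%:R :> R.
  apply: le_lt_trans sqr_q_le _; rewrite -[ltRHS]mulr1 ltr_pM2l //.
  rewrite powRN invf_lt1 ?powR_gt0 // /powR (gt_eqF N0) expR_gt1.
  by rewrite mulr_gt0 ?ln_gt0 // mulr_gt0.
by rewrite -natrX ltr_nat; apply: leq_ltn_trans; rewrite expnS expn1 leq_mul2r q_ge2 orbT.
Qed.

(** From alpha <= q^2/N <= N^(-2 eps); the lower bound is uniform in q. *)
Lemma log_alpha_ge : 2 * eps * ln N%:R <= ln (alpha R N q)^-1.
Proof.
have N0 : 0 < N%:R :> R by rewrite ltr0n ltnW.
have a0 := alpha_pos R q_ge2 double_q_lt.
rewrite -ln_powR ler_ln ?posrE ?powR_gt0 ?invr_gt0 //.
rewrite -[leLHS]invrK lef_pV2 ?posrE ?invr_gt0 ?powR_gt0 // -powRN.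
apply: le_trans (alpha_le R q_ge2 double_q_lt) _.
by rewrite ler_pdivrMr // mulrC sqr_q_le.
Qed.

End Asymptotics.

Theorem corollary1p8 (R : realType) (L : nat) :
  exists C1 C2 : R, [/\ 0 < C1, 0 < C2 &
  forall eps0 : R, 0 < eps0 ->
  forall delta : R, 0 < delta < 1 ->
  exists N0 : nat, forall N q : nat,
    (0 < N)%N -> ~~ odd N -> (N0 <= N)%N ->
    ~~ odd q -> (2 <= q)%N -> q%:R <= N%:R `^ (2^-1 - eps0) ->
  forall (d : measure_display) (Omega : measurableType d)
    (P : probability Omega R) (J : {set 'I_N} -> {RV P >-> R}),
    iid_std_normal (qsubsets N q) J ->
  forall (tau : sector) (T : R),
    let a : R := alpha R N q in
    let M : R := 'C(N, q)%:R in
    1 <= T ->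
    T <= Num.sqrt ((1 - delta) *
           Num.min (4 * L.+1%:R / 5 * ln a^-1) (ln M)) ->
    let err : R -> R := fun t =>
      `| sff q J tau t - sqnormc (fourier (syk_profile q J L) t) | in
    let B : R := (a ^+ L.+1 * T ^+ (2 * L + 2)) `^ (4 / 5) + T ^+ 2 / M in
    (ereal_sup [set (err t)%:E | t in [set t : R | (`|t| <= T)%R]]
       <= (C1 * B)%:E)%E /\
    C1 * B <= C2 * ((a * ln a^-1) `^ (4 * L.+1%:R / 5) + ln M / M)].
Proof.
pose K := approx_const R L; pose m := L.+1.
have K0 : 0 <= K := approx_const_ge0 R L.
pose C1 := K * (K + 4) + 1.
have C1_gt0 : 0 < C1 by rewrite /C1 ltr_wpDl // mulr_ge0 ?addr_ge0.
have mm1 : 1 <= m%:R ^+ m :> R by rewrite exprn_ege1 // ler1n.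
(* The factor m^m comes from T^2 <= m log(1/alpha), raised to the m-th power. *)
exists C1, (C1 * m%:R ^+ m); split=> //; first by rewrite mulr_gt0 // (lt_le_trans ltr01).
move=> eps0 eps_gt0 delta /andP[delta0 delta1].
have [U U_le] := @small_of_log_large R m%:R (ler0n _ _).
(* Beyond this threshold 2 eps0 log N >= U, which forces log(1/alpha) >= U for every admissible
   q. *)
exists (maxn 2 (Num.truncn (expR (U / (2 * eps0)))).+1).
move=> N q N_gt0 oN; rewrite geq_max => /andP[N_ge2 NU] oq q_ge2 q_le d Omega P J iid tau T a M.
move=> T1 T_le err B.
have T0 : 0 <= T by exact: le_trans T1.
have qN := double_q_lt eps_gt0 N_ge2 q_ge2 q_le.
have a_gt0 : 0 < a := alpha_pos R q_ge2 qN.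
have M_gt0 : 0 < M by rewrite ltr0n bin_gt0; move: qN; clear; lia.
pose u := ln a^-1.
have Uu : U <= u.
  apply: le_trans (log_alpha_ge eps_gt0 N_ge2 q_ge2 q_le).
  rewrite mulrC -ler_pdivrMr ?mulr_gt0 // -ler_expR lnK ?posrE ?ltr0n //.
  by apply: ltW; apply: lt_le_trans (truncnS_gt _) _; rewrite ler_nat.
have min_gt0 : 0 < (1 - delta) * Num.min (4 * L.+1%:R / 5 * ln a^-1) (ln M).
  by rewrite -sqrtr_gt0; apply: lt_le_trans T_le; apply: lt_le_trans T1.
have T2 : T ^+ 2 <= Num.min (4 * L.+1%:R / 5 * u) (ln M).
  apply: (@le_trans _ _ ((1 - delta) * Num.min (4 * L.+1%:R / 5 * u) (ln M))).
    by rewrite -[leRHS]sqr_sqrtr ?(ltW min_gt0) // lerXn2r ?nnegrE ?sqrtr_ge0.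
  have d1 : 0 < 1 - delta by rewrite subr_gt0.
  rewrite ler_piMl //; last by rewrite lerBlDr lerDl ltW.
  by move: min_gt0; rewrite pmulr_rgt0 // => /ltW.
have [Tu TM] : T ^+ 2 <= 4 * L.+1%:R / 5 * u /\ T ^+ 2 <= ln M.
  by move: T2; rewrite le_min => /andP.
have u_gt0 : 0 < u.
  have : 0 < 4 * L.+1%:R / 5 * u by apply: lt_le_trans Tu; rewrite exprn_gt0 // (lt_le_trans ltr01).
  by rewrite pmulr_rgt0 // !mulr_gt0 ?ltr0n.
have Tmu : T ^+ 2 <= m%:R * u.
  apply: le_trans Tu _; rewrite ler_wpM2r ?(ltW u_gt0) //.
  by have : 0 <= m%:R :> R by []; rewrite -/m; lra.
(* With alpha = exp(-u) and T^22 <= (m u)^11 this is the smallness condition provided by the choice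
   of [U]. *)
have aT : 32 * (a * T ^+ 22) <= 1.
  apply: le_trans (U_le u Uu u_gt0); rewrite ler_wpM2l //.
  rewrite expRN lnK ?posrE ?invr_gt0 // invrK ler_wpM2l ?(ltW a_gt0) //.
  by rewrite (exprM T 2 11) lerXn2r ?nnegrE ?sqr_ge0 ?mulr_ge0 ?(ltW u_gt0).
split.
  apply: ge_ereal_sup => _ [t /= tT <-]; rewrite lee_fin.
  exact: (sff_profile_le L oN oq N_gt0 qN iid a_gt0 tau T1 tT aT).
have B0 : 0 <= (a * ln a^-1) `^ (4 * L.+1%:R / 5) by exact: powR_ge0.
rewrite -mulrA ler_wpM2l ?(ltW C1_gt0) // mulrDr; apply: lerD.
  rewrite /B (_ : (2 * L + 2 = 2 * m)%N); last by rewrite /m; clear; lia.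
  exact: (main_term_le (ltW a_gt0) (ltW u_gt0) T0 Tmu).
apply: (@le_trans _ _ (ln M / M)); first by rewrite ler_wpM2r // invr_ge0 ltW.
by rewrite ler_peMl // divr_ge0 ?(ltW M_gt0) // (le_trans _ TM) // sqr_ge0.
Qed.
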